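(* Let $D\subseteq\mathbb{C}$ be a domain, let $\mathcal{F}$ be a family of meromorphic functions in $D$, and let $S_1$ and $S_2$ be two finite subsets of $\mathbb{C}$ with $S_1=\{a_1,a_2\}$, where $a_1,a_2$ are non-zero distinct complex numbers. Let $P=\sum_{i=1}^{m}c_iM_i$ be a differential polynomial with coefficients $c_i$ holomorphic in $D$ and normalized differential monomials $M_i[f]=\prod_{j=1}^{k_i}\left(f^{(j)}\right)^{n_{ij}}$, satisfying $$1+\alpha:=\frac{w(M_1)}{d(M_1)}\geq\frac{w(M_t)}{d(M_t)}\quad\text{for } 2\leq t\leq m,$$ where $\alpha$ is an integer with $\alpha\geq\kappa$ ($\kappa$ being the differential order of $P$), and such that $c_i$ is non-vanishing in $D$ for every $i$ with $w(M_i)/d(M_i)=1+\alpha$. Suppose that for each $f\in\mathcal{F}$, all zeros of $f-a_i$ $(i=1,2)$ have multiplicity at least $\alpha+1$. If for each $f\in\mathcal{F}$ $$P[f](z)\in S_1\Rightarrow f(z)\in S_2$$ in $D$, and if there exist some $M>0$ and a point $a_3\in\mathbb{C}\setminus S_1$ such that for each $f\in\mathcal{F}$, $\lvert f'(z)\rvert\leq M$ whenever $f(z)=a_3$, then $\mathcal{F}$ is normal in $D$.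
   Context: Normal family: a family $\mathcal{F}$ of meromorphic functions in a domain $D$ is normal in $D$ if every sequence in $\mathcal{F}$ contains a subsequence converging locally uniformly in $D$ with respect to the spherical metric to a function which is either meromorphic in $D$ or identically $\infty$. Differential polynomials: for positive integers $k_i$ and non-negative integers $n_{i1},\dots,n_{ik_i}$, not all zero, the normalized differential monomial $M_i[f]=\prod_{j=1}^{k_i}(f^{(j)})^{n_{ij}}$ (a map on meromorphic functions in $D$; only derivatives of order at least $1$ occur) has degree $d(M_i)=\sum_{j=1}^{k_i}n_{ij}$ and weight $w(M_i)=\sum_{j=1}^{k_i}(j+1)n_{ij}$. The differential polynomial $P=\sum_{i=1}^m c_iM_i$ acts by $P[f]=\sum_{i=1}^m c_i\,M_i[f]$, and its differential order is $\kappa=\max\{k_i:1\leq i\leq m\}$. Partial sharing: for meromorphic $g,f$ in $D$ and $S_1,S_2\subseteq\mathbb{C}$, the notation $g(z)\in S_1\Rightarrow f(z)\in S_2$ in $D$ means $E(g,S_1)\subseteq E(f,S_2)$, where $E(f,S)=\bigcup_{s\in S}\{z\in D: f(z)=s\}$, ignoring multiplicities.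
   Formalization: The differential monomials M_i in P are assumed pairwise distinct; otherwise P = f' − f' = 0 is allowed and the family ℘(nz)+b, with a_i = e_i+b, is a non-normal counterexample. *)

(* Defs.v *)
(* Stdlib world: the classical reals, with Coquelicot's complex numbers. *)
From Stdlib Require Export Reals ZArith List.
From Stdlib Require Import ClassicalEpsilon.
From Coquelicot Require Export Coquelicot.

Open Scope R_scope.

Definition connected (D : C -> Prop) : Prop :=
  forall U V : C -> Prop,
    open U -> open V ->
    (forall z, D z -> U z \/ V z) ->
    (exists z, D z /\ U z) -> (exists z, D z /\ V z) ->
    exists z, D z /\ U z /\ V z.

Definition domain (D : C -> Prop) : Prop :=
  open D /\ (exists z, D z) /\ connected D.

Definition finite_set (S : C -> Prop) : Prop :=
  exists l : list C, forall s, S s <-> In s l.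

Definition holomorphic (D : C -> Prop) (g : C -> C) : Prop :=
  forall z, D z -> ex_derive g z.

(* The extended plane (Riemann sphere). *)
Inductive Csph : Type :=
  | Fin : C -> Csph
  | Inf : Csph.

(* The value at [Inf] is irrelevant: it is only used near points where the
   function is finite, or on punctured neighbourhoods of poles. *)
Definition finval (p : Csph) : C :=
  match p with Fin z => z | Inf => 0 end.

Definition finpart (f : C -> Csph) : C -> C := fun z => finval (f z).

(* Half the Euclidean distance between the stereographic images of the two
   points on the unit sphere. *)
Definition half_chord (p q : Csph) : R :=
  match p, q with
  | Fin z, Fin w =>
      Cmod (z - w) / (sqrt (1 + Cmod z ^ 2) * sqrt (1 + Cmod w ^ 2))
  | Fin z, Inf | Inf, Fin z => 1 / sqrt (1 + Cmod z ^ 2)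
  | Inf, Inf => 0
  end.

(* Great-circle distance, i.e. the distance of 2|dz|/(1+|z|^2). *)
Definition spherical_dist (p q : Csph) : R := 2 * asin (half_chord p q).

Definition regular_point (f : C -> Csph) (z0 : C) : Prop :=
  locally z0 (fun z => f z <> Inf /\ ex_derive (finpart f) z).

Definition pole (f : C -> Csph) (z0 : C) : Prop :=
  f z0 = Inf /\
  locally' z0 (fun z => f z <> Inf /\ ex_derive (finpart f) z) /\
  (forall A : R, locally' z0 (fun z => A < Cmod (finpart f z))).

(* A meromorphic function in [D] is a function to the sphere, of which only
   the values on [D] matter; the constant infinity is excluded. *)
Definition meromorphic (D : C -> Prop) (f : C -> Csph) : Prop :=
  forall z, D z -> regular_point f z \/ pole f z.

Definition converges_locally_uniformly
    (D : C -> Prop) (u : nat -> C -> Csph) (g : C -> Csph) : Prop :=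
  forall z0, D z0 ->
    exists delta : posreal, forall eps : posreal, exists N : nat,
      forall n z, (N <= n)%nat -> D z -> Cmod (z - z0) < delta ->
        spherical_dist (u n z) (g z) < eps.

Definition normal_family (D : C -> Prop) (F : (C -> Csph) -> Prop) : Prop :=
  forall u : nat -> C -> Csph, (forall n, F (u n)) ->
    exists phi : nat -> nat, (forall n, (phi n < phi (S n))%nat) /\
    exists g : C -> Csph,
      (meromorphic D g \/ (forall z, D z -> g z = Inf)) /\
      converges_locally_uniformly D (fun n => u (phi n)) g.

(* [z0] is a zero of [f - a] of multiplicity exactly [k].  When [f] is
   identically [a] near [z0] this holds for no [k] (infinite multiplicity). *)
Definition zero_multiplicity (f : C -> Csph) (a z0 : C) (k : nat) : Prop :=
  exists h : C -> C,
    locally z0 (fun z => ex_derive h z) /\ h z0 <> 0 /\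
    locally z0 (fun z => f z = Fin (a + Cpow (z - z0) k * h z)%C).

Definition all_zeros_multiplicity_ge
    (D : C -> Prop) (f : C -> Csph) (a : C) (p : Z) : Prop :=
  forall z0, D z0 -> f z0 = Fin a ->
    forall k : nat, zero_multiplicity f a z0 k -> (p <= Z.of_nat k)%Z.

(* The list of exponents is n_1, ..., n_k; trailing zeros are allowed. *)
Record monomial : Type := Monomial {
  exponents : list nat;
  exponents_nonzero : Exists (fun n => n <> 0%nat) exponents
}.

Definition mono_order (M : monomial) : nat := length (exponents M).

(* n_j, for 1 <= j <= k *)
Definition exponent (M : monomial) (j : nat) : nat :=
  nth (j - 1) (exponents M) 0%nat.

Definition degree (M : monomial) : nat :=
  list_sum (map (exponent M) (seq 1 (mono_order M))).

Definition weight (M : monomial) : nat :=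
  list_sum (map (fun j => (j + 1) * exponent M j)%nat (seq 1 (mono_order M))).

Definition ratio (M : monomial) : R := INR (weight M) / INR (degree M).

(* Terms are indexed by 1, ..., m, the values at other indices being ignored.
   As usual for an expression of a polynomial as a sum of monomials, the
   monomials are pairwise distinct (otherwise c M - c M, the zero polynomial,
   would be an expression with non-vanishing coefficients). *)
Record diff_polynomial : Type := DiffPolynomial {
  nterms : nat;
  coef : nat -> C -> C;
  mono : nat -> monomial;
  nterms_pos : (1 <= nterms)%nat;
  mono_distinct : forall i t, (1 <= i <= nterms)%nat -> (1 <= t <= nterms)%nat ->
    i <> t -> exponents (mono i) <> exponents (mono t)
}.

Definition diff_order (P : diff_polynomial) : nat :=
  list_max (map (fun i => mono_order (mono P i)) (seq 1 (nterms P))).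

Definition C_derive_n (j : nat) (g : C -> C) : C -> C := Nat.iter j C_derive g.

Definition mono_eval (M : monomial) (g : C -> C) (z : C) : C :=
  fold_right Cmult 1
    (map (fun j => Cpow (C_derive_n j g z) (exponent M j))
         (seq 1 (mono_order M))).

Definition poly_eval (P : diff_polynomial) (g : C -> C) (z : C) : C :=
  fold_right Cplus 0
    (map (fun i => (coef P i z * mono_eval (mono P i) g z)%C)
         (seq 1 (nterms P))).

(* The meromorphic function given by the formula [g] outside a discrete set:
   its value at [z] is the limit of [g], [Inf] if there is no finite limit. *)
Definition mero_ext (g : C -> C) : C -> Csph := fun z =>
  if excluded_middle_informative
       (exists l : C, filterlim g (locally' z) (locally l))
  then Fin (C_lim g z) else Inf.

(* P[f] as a meromorphic function: the pointwise formula is meaningful away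
   from the poles of [f]; [mero_ext] gives the value at the poles, where P[f]
   may be finite because of cancellation or zeros of the coefficients. *)
Definition poly_apply (P : diff_polynomial) (f : C -> Csph) : C -> Csph :=
  mero_ext (poly_eval P (finpart f)).

(* E(f, S) *)
Definition preimage_set (D : C -> Prop) (f : C -> Csph) (S : C -> Prop)
    (z : C) : Prop :=
  D z /\ exists s, S s /\ f z = Fin s.

(* g(z) in S1 => f(z) in S2, in D *)
Definition partially_shares (D : C -> Prop) (g : C -> Csph) (S1 : C -> Prop)
    (f : C -> Csph) (S2 : C -> Prop) : Prop :=
  forall z, preimage_set D g S1 z -> preimage_set D f S2 z.

(* Main.v *)
Require Import Defs.
From Stdlib Require Import Lra Lia Psatz ClassicalEpsilon FunctionalExtensionality Cantor.

(** A family of meromorphic functions is normal as soon as its spherical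
    derivatives are locally bounded (Marty's criterion, [marty_normal]). If they
    are unbounded near a point [z0] of [D], the rescaling lemma of Zalcman and
    Pang ([zalcman], [unbounded_zalcman]) provides members [f n] of the family,
    points [z n] tending to [z0] and numbers [s n > 0] tending to 0 such that
    [(f n (z n + s n x) - a1) / (s n)^k], with [k = alpha], converges locally
    uniformly on the plane to a nonconstant map [g] to the sphere. The exponent
    [k] is admissible since the zeros of [f - a1] have order greater than [k],
    and this passes to the zeros of [g].

    Under this rescaling a differential monomial acquires the factor
    [s^(deficit k M)], where the deficit vanishes exactly for the monomials of
    the maximal ratio [1 + k] of weight and degree. As no derivative of order
    greater than [k] occurs, these are powers of the [k]-th derivative, with
    distinct exponents. So [P[f n] (z n + s n x)] converges to [Q (h x)], where
    [h] is the [k]-th derivative of [g] and [Q] is a nonconstant polynomial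
    ([poly_eval_limit], [limit_polynomial_surjective]).

    Now [Q (h)] omits [a1] and [a2] ([rescaled_contradiction]). Otherwise, unless
    [h] is constant, Hurwitz's theorem gives points where [P[f n]] takes such a
    value and the rescaled function is bounded, so that [f n] is close to [a1].
    By hypothesis [f n] lies in the finite set [S2] there, so it equals [a1]; but
    at zeros of [f n - a1], having order greater than [k], all derivatives that
    occur in [P] vanish, and so does [P[f n]], although [a1] and [a2] are not
    zero.

    Since [Q] is surjective, [h] omits two values [b1] and [b2]. The poles of
    the derivative [h] are multiple, so [(h - b1) / (h - b2)] is an entire
    function without zeros all of whose 1-points are multiple. Such a function
    is constant ([entire_ramified]), by another application of the rescaling
    lemma. Then [h] is constant and [g] is a polynomial of degree at most [k]
    with zeros of order greater than [k], which is absurd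
    ([derive_n_locally_constant], [derivative_omits_two]).

    The function theory behind this is developed from Goursat's theorem for
    rectangles. In logarithmic polar coordinates it gives the invariance of
    circular means on annuli ([circmean_annulus]) and thus Cauchy's formula
    ([cauchy_formula]), from which the theorems of Weierstrass, Liouville and
    Hurwitz, orders of zeros and the fundamental theorem of algebra follow. Maps
    to the sphere are treated in the two charts [f] and [1 / f], exchanged by
    the isometry [sinv], and Marty's criterion combines Ascoli's theorem with
    the chordal metric. *)

(** * Limits and complex derivatives *)

Definition disc (c : C) (r : R) (z : C) : Prop := Cmod (z - c) < r.

Lemma Cmod_sym z w : Cmod (z - w) = Cmod (w - z).
Proof. rewrite <- Cmod_opp; f_equal; ring. Qed.

Lemma Cmod_self z : Cmod (z - z) = 0.
Proof. replace (z - z)%C with (RtoC 0) by ring; apply Cmod_0. Qed.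

Lemma Cmod_tri3 a b c : Cmod (a - c) <= Cmod (a - b) + Cmod (b - c).
Proof. replace (a - c)%C with ((a - b) + (b - c))%C by ring; apply Cmod_triangle. Qed.

Lemma Cmod_ge_sub a b : Cmod a - Cmod b <= Cmod (a - b).
Proof.
  pose proof (Cmod_triangle (a - b) b) as H.
  replace (a - b + b)%C with a in H by ring; lra.
Qed.

Lemma Cmod_pos z w : z <> w -> 0 < Cmod (z - w).
Proof.
  intros H; apply Cmod_gt_0; intros E; apply H.
  replace z with ((z - w) + w)%C by ring; rewrite E; ring.
Qed.

Lemma Cminus_nz z w : z <> w -> (z - w)%C <> 0.
Proof. intros H; apply Cmod_gt_0, Cmod_pos, H. Qed.

Lemma Cminus_eq z w : (z - w)%C = 0 -> z = w.
Proof. intros H; replace z with ((z - w) + w)%C by ring; rewrite H; ring. Qed.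

Lemma disc_center c r : 0 < r -> disc c r c.
Proof. intros H; unfold disc; rewrite Cmod_self; exact H. Qed.

Lemma disc_sub c r z : disc c r z ->
  exists s, 0 < s /\ forall w, disc z s w -> disc c r w.
Proof.
  intros H; exists (r - Cmod (z - c)); unfold disc in *; split; [lra|].
  intros w Hw; pose proof (Cmod_tri3 w z c); lra.
Qed.

Lemma disc_le c r s z : r <= s -> disc c r z -> disc c s z.
Proof. unfold disc; lra. Qed.

Lemma disc_minl {c r s z} : disc c (Rmin r s) z -> disc c r z.
Proof. apply disc_le, Rmin_l. Qed.

Lemma disc_minr {c r s z} : disc c (Rmin r s) z -> disc c s z.
Proof. apply disc_le, Rmin_r. Qed.

Ltac pos := first [assumption | apply Rmin_glb_lt; pos | apply Rdiv_lt_0_compat; pos | lra].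

Lemma Cmod_small z : (forall eps, 0 < eps -> Cmod z <= eps) -> z = 0.
Proof.
  intros H; apply Cmod_eq_0; pose proof (Cmod_ge_0 z).
  destruct (Req_dec (Cmod z) 0) as [E|E]; [exact E|].
  specialize (H (Cmod z / 2)); lra.
Qed.

Lemma locally_disc (z : C) (P : C -> Prop) :
  locally z P <-> exists d, 0 < d /\ forall w, disc z d w -> P w.
Proof.
  split.
  - intros [d H]; exists d; split; [apply cond_pos|].
    intros w Hw; apply H; apply C_NormedModule_mixin_compat1; exact Hw.
  - intros [d [Hd H]].
    assert (Hs : 0 < sqrt 2) by (apply sqrt_lt_R0; lra).
    assert (Hp : 0 < d / sqrt 2) by (apply Rdiv_lt_0_compat; lra).
    exists (mkposreal _ Hp); intros w Hw; apply H.
    pose proof (C_NormedModule_mixin_compat2 z w _ Hw) as H2; simpl in H2.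
    unfold disc; change (Cmod (w - z)) with (Cmod (minus w z)).
    replace d with (sqrt 2 * (d / sqrt 2)) by (field; lra); exact H2.
Qed.

Lemma locally_disc' (z : C) (P : C -> Prop) :
  locally' z P <-> exists d, 0 < d /\ forall w, disc z d w -> w <> z -> P w.
Proof. unfold locally', within; rewrite locally_disc; reflexivity. Qed.

Lemma open_disc (D : C -> Prop) : open D <->
  forall z, D z -> exists d, 0 < d /\ forall w, disc z d w -> D w.
Proof.
  unfold open; split; intros H z Hz; apply locally_disc, H, Hz.
Qed.

Lemma disc_open c r z : disc c r z -> locally z (disc c r).
Proof. intros H; apply locally_disc, disc_sub, H. Qed.

Lemma punctured_open c r z : disc c r z -> z <> c -> locally z (fun w => disc c r w /\ w <> c).
Proof.
  intros Hz Hne; apply filter_and; [apply disc_open, Hz|].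
  apply locally_disc; exists (Cmod (z - c)); split; [apply Cmod_pos, Hne|].
  intros w Hw ->; unfold disc in Hw; rewrite Cmod_sym in Hw; lra.
Qed.

Lemma near_point c r s : 0 < r -> 0 < s -> exists z, z <> c /\ disc c r z /\ disc c s z.
Proof.
  intros Hr Hs; set (h := Rmin r s / 2); assert (Hh : 0 < h < r /\ h < s) by (unfold h, Rmin; destruct Rle_dec; lra).
  assert (Eh : Cmod (c + RtoC h - c) = h).
  { replace (c + RtoC h - c)%C with (RtoC h) by ring; rewrite Cmod_R; apply Rabs_pos_eq; lra. }
  exists (c + RtoC h)%C; unfold disc; repeat split; try lra; intros Q; rewrite Q, Cmod_self in Eh; lra.
Qed.

(** Stated for an arbitrary filter, so that the same algebra serves functions
    of a complex variable and curves [R -> C]. *)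
Definition clim {T : Type} (F : (T -> Prop) -> Prop) (f : T -> C) (l : C) : Prop :=
  forall eps, 0 < eps -> F (fun x => Cmod (f x - l) < eps).

Lemma clim_const {T} (F : (T -> Prop) -> Prop) {FF : Filter F} c : clim F (fun _ => c) c.
Proof. intros e He; apply filter_forall; intros _; rewrite Cmod_self; exact He. Qed.

Lemma clim_ext {T} (F : (T -> Prop) -> Prop) {FF : Filter F} f g l :
  F (fun x => f x = g x) -> clim F f l -> clim F g l.
Proof.
  intros E H e He; generalize (filter_and _ _ E (H e He)).
  apply filter_imp; intros x [<- K]; exact K.
Qed.

Lemma clim_eq {T} (F : (T -> Prop) -> Prop) f l m : clim F f l -> l = m -> clim F f m.
Proof. intros H <-; exact H. Qed.

Lemma clim_plus {T} (F : (T -> Prop) -> Prop) {FF : Filter F} f g l m :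
  clim F f l -> clim F g m -> clim F (fun x => f x + g x)%C (l + m)%C.
Proof.
  intros Hf Hg e He.
  assert (He2 : 0 < e / 2) by lra.
  generalize (filter_and _ _ (Hf _ He2) (Hg _ He2)); apply filter_imp; intros x [A B].
  replace (f x + g x - (l + m))%C with ((f x - l) + (g x - m))%C by ring.
  pose proof (Cmod_triangle (f x - l) (g x - m)); lra.
Qed.

Lemma clim_mult {T} (F : (T -> Prop) -> Prop) {FF : Filter F} f g l m :
  clim F f l -> clim F g m -> clim F (fun x => f x * g x)%C (l * m)%C.
Proof.
  intros Hf Hg e He.
  pose proof (Cmod_ge_0 l); pose proof (Cmod_ge_0 m).
  set (b := 1 + Cmod l + Cmod m).
  set (d := Rmin 1 (e / (2 * b))).
  assert (Hb : 0 < b) by (unfold b; lra).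
  assert (Hq : 0 < e / (2 * b)) by (apply Rdiv_lt_0_compat; lra).
  assert (Hd : 0 < d) by pos.
  assert (d <= 1) by apply Rmin_l.
  assert (d * (2 * b) <= e).
  { apply Rle_trans with (e / (2 * b) * (2 * b)).
    - apply Rmult_le_compat_r; [lra|apply Rmin_r].
    - right; field; lra. }
  generalize (filter_and _ _ (Hf _ Hd) (Hg _ Hd)); apply filter_imp; intros x [A B].
  replace (f x * g x - l * m)%C
    with ((f x - l) * (g x - m) + ((f x - l) * m + l * (g x - m)))%C by ring.
  eapply Rle_lt_trans; [apply Cmod_triangle|].
  eapply Rle_lt_trans; [apply Rplus_le_compat_l, Cmod_triangle|].
  rewrite !Cmod_mult.
  pose proof (Cmod_ge_0 (f x - l)); pose proof (Cmod_ge_0 (g x - m)).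
  assert (Cmod (f x - l) * Cmod (g x - m) <= d * 1) by (apply Rmult_le_compat; lra).
  assert (Cmod (f x - l) * Cmod m <= d * Cmod m) by (apply Rmult_le_compat_r; lra).
  assert (Cmod l * Cmod (g x - m) <= Cmod l * d) by (apply Rmult_le_compat_l; lra).
  unfold b in *; nra.
Qed.

Lemma clim_opp {T} (F : (T -> Prop) -> Prop) {FF : Filter F} f l :
  clim F f l -> clim F (fun x => - f x)%C (- l)%C.
Proof.
  intros H e He; generalize (H e He); apply filter_imp; intros x Hx.
  replace (- f x - - l)%C with (- (f x - l))%C by ring; rewrite Cmod_opp; exact Hx.
Qed.

Lemma clim_minus {T} (F : (T -> Prop) -> Prop) {FF : Filter F} f g l m :
  clim F f l -> clim F g m -> clim F (fun x => f x - g x)%C (l - m)%C.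
Proof. intros Hf Hg; exact (clim_plus F _ _ _ _ Hf (clim_opp F _ _ Hg)). Qed.

Lemma clim_inv {T} (F : (T -> Prop) -> Prop) {FF : Filter F} f (l : C) :
  l <> 0 -> clim F f l -> clim F (fun x => / f x)%C (/ l)%C.
Proof.
  intros Hl H e He.
  assert (Hm : 0 < Cmod l) by (apply Cmod_gt_0; exact Hl).
  assert (Hm2 : 0 < Cmod l * Cmod l) by nra.
  assert (Hd : 0 < Rmin (Cmod l / 2) (e * (Cmod l * Cmod l) / 2)) by (apply Rmin_glb_lt; nra).
  generalize (H _ Hd); apply filter_imp; intros x Hx.
  pose proof (Rmin_l (Cmod l / 2) (e * (Cmod l * Cmod l) / 2)).
  pose proof (Rmin_r (Cmod l / 2) (e * (Cmod l * Cmod l) / 2)).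
  pose proof (Cmod_ge_sub l (f x)) as S; rewrite Cmod_sym in S.
  assert (Hfx : Cmod l / 2 < Cmod (f x)) by lra.
  assert (Hfn : f x <> 0) by (apply Cmod_gt_0; lra).
  replace (/ f x - / l)%C with ((l - f x) / (f x * l))%C by (field; auto).
  rewrite Cmod_div by (apply Cmult_neq_0; assumption).
  rewrite Cmod_mult, Cmod_sym.
  apply Rlt_div_l; [nra|].
  assert (Cmod l / 2 * Cmod l < Cmod (f x) * Cmod l) by nra.
  assert (e * (Cmod l / 2 * Cmod l) < e * (Cmod (f x) * Cmod l)) by (apply Rmult_lt_compat_l; lra).
  nra.
Qed.

Lemma clim_filterlim {T} (F : (T -> Prop) -> Prop) {FF : Filter F} f l :
  clim F f l <-> filterlim f F (locally l).
Proof.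
  split.
  - intros H P HP; apply locally_disc in HP; destruct HP as [d [Hd HP]].
    unfold filtermap; generalize (H d Hd); apply filter_imp; intros x Hx; apply HP, Hx.
  - intros H e He; apply (H (disc l e)); apply locally_disc; exists e; auto.
Qed.

Lemma clim_comp {T} {U} (F : (T -> Prop) -> Prop) (G : (U -> Prop) -> Prop)
  (p : T -> U) (f : U -> C) l : filterlim p F G -> clim G f l -> clim F (fun x => f (p x)) l.
Proof. intros Hp Hf e He; exact (Hp _ (Hf e He)). Qed.

Notation cts f z := (clim (locally z) f%function (f%function z)).

Lemma cts_id (z : C) : cts (fun w : C => w) z.
Proof. intros e He; apply locally_disc; exists e; auto. Qed.

Lemma cts_eps (f : C -> C) z : cts f z <->
  forall eps, 0 < eps -> exists d, 0 < d /\ forall w, disc z d w -> Cmod (f w - f z) < eps.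
Proof. split; intros H e He; apply locally_disc, H, He. Qed.

Definition isd (f : C -> C) (z l : C) : Prop :=
  forall eps, 0 < eps -> exists d, 0 < d /\
    forall w, disc z d w -> Cmod (f w - f z - l * (w - z)) <= eps * Cmod (w - z).

Lemma isd_is_derive f z l : isd f z l <-> is_derive f z l.
Proof.
  split.
  - intros H; split; [apply is_linear_scal_l|].
    intros x Hx; apply (@is_filter_lim_locally_unique C_AbsRing (AbsRing_NormedModule C_AbsRing) z x) in Hx; subst x.
    intros eps; destruct (H eps (cond_pos eps)) as [d [Hd K]].
    exists (mkposreal d Hd); intros w Hw.
    exact (eq_ind_r (fun a => Cmod a <= _) (K w Hw) (f_equal (fun a => f w - f z - a)%C (Cmult_comm (w - z) l))).
  - intros [_ H] eps He.
    destruct (H z (fun P HP => HP) (mkposreal eps He)) as [d K].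
    exists d; split; [apply cond_pos|]; intros w Hw; specialize (K w Hw).
    rewrite Cmult_comm; exact K.
Qed.

Lemma ex_derive_isd f z : ex_derive f z <-> isd f z (C_derive f z).
Proof.
  split.
  - intros H; apply isd_is_derive, C_derive_correct; [exact z|exact H].
  - intros H; exists (C_derive f z); apply isd_is_derive, H.
Qed.

Lemma isd_C_derive f z l : isd f z l -> C_derive f z = l.
Proof. intros H; apply is_C_derive_unique, isd_is_derive, H. Qed.

(** Caratheodory's form of differentiability, which turns the rules of calculus
    into the algebra of limits. *)
Lemma isd_slope f z l : isd f z l <->
  exists phi, clim (locally z) phi l /\ phi z = l /\ forall w, f w = (f z + phi w * (w - z))%C.
Proof.
  split.
  - intros H; exists (fun w => if excluded_middle_informative (w = z) then l else ((f w - f z) / (w - z))%C).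
    split; [|split].
    + intros e He; destruct (H (e / 2)) as [d [Hd K]]; [lra|].
      apply locally_disc; exists d; split; [exact Hd|]; intros w Hw.
      destruct excluded_middle_informative as [E|E]; [rewrite Cmod_self; exact He|].
      pose proof (Cmod_pos _ _ E).
      replace ((f w - f z) / (w - z) - l)%C with ((f w - f z - l * (w - z)) / (w - z))%C
        by (field; apply Cminus_nz, E).
      rewrite Cmod_div by (apply Cminus_nz, E); apply Rlt_div_l; [lra|].
      specialize (K w Hw); nra.
    + destruct excluded_middle_informative as [E|E]; [reflexivity|now elim E].
    + intros w; destruct excluded_middle_informative as [E|E]; [subst; ring|].
      field; apply Cminus_nz, E.
  - intros [phi [H [E K]]] e He; destruct (proj1 (locally_disc _ _) (H e He)) as [d [Hd L]].
    exists d; split; [exact Hd|]; intros w Hw.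
    rewrite (K w); replace (f z + phi w * (w - z) - f z - l * (w - z))%C with ((phi w - l) * (w - z))%C by ring.
    rewrite Cmod_mult; apply Rmult_le_compat_r; [apply Cmod_ge_0|]; left; apply L, Hw.
Qed.

Lemma isd_cts f z l : isd f z l -> cts f z.
Proof.
  intros H; apply isd_slope in H; destruct H as [phi [H [_ K]]].
  refine (clim_ext _ (fun w => f z + phi w * (w - z))%C _ _ _ _); [apply filter_forall; intros; symmetry; apply K|].
  apply clim_eq with (f z + l * (z - z))%C; [|ring].
  refine (clim_plus _ _ _ _ _ _ _); [exact (clim_const _ _)|].
  refine (clim_mult _ _ _ _ _ _ _); [exact H|refine (clim_minus _ _ _ _ _ _ _); [apply cts_id|exact (clim_const _ _)]].
Qed.

Lemma isd_ext_loc f g z l : locally z (fun w => f w = g w) -> isd f z l -> isd g z l.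
Proof.
  intros E H e He; destruct (H e He) as [d [Hd K]].
  apply locally_disc in E; destruct E as [d' [Hd' E]].
  exists (Rmin d d'); split; [pos|]; intros w Hw.
  rewrite <- (E z), <- (E w); [apply K| |apply disc_center; exact Hd'];
    eapply disc_le; try exact Hw; [apply Rmin_l|apply Rmin_r].
Qed.

Lemma isd_ext f g z l : (forall w, f w = g w) -> isd f z l -> isd g z l.
Proof. intros E; apply isd_ext_loc, filter_forall, E. Qed.

Lemma isd_const c z : isd (fun _ => c) z 0.
Proof. apply isd_slope; exists (fun _ => RtoC 0); repeat split; [exact (clim_const _ _)|intros; ring]. Qed.

Lemma isd_id z : isd (fun w => w) z 1.
Proof. apply isd_slope; exists (fun _ => RtoC 1); repeat split; [exact (clim_const _ _)|intros; ring]. Qed.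

Lemma isd_plus f g z l m : isd f z l -> isd g z m -> isd (fun w => f w + g w)%C z (l + m)%C.
Proof.
  rewrite !isd_slope; intros [p [A [B K]]] [q [A' [B' K']]].
  exists (fun w => p w + q w)%C; split; [refine (clim_plus _ _ _ _ _ _ _); assumption|split; [congruence|]].
  intros w; rewrite (K w), (K' w); ring.
Qed.

Lemma isd_mult f g z l m : isd f z l -> isd g z m ->
  isd (fun w => f w * g w)%C z (l * g z + f z * m)%C.
Proof.
  intros Hf Hg; pose proof (isd_cts _ _ _ Hg) as Cg; revert Hf Hg.
  rewrite !isd_slope; intros [p [A [B K]]] [q [A' [B' K']]].
  exists (fun w => p w * g w + f z * q w)%C; split; [|split].
  - refine (clim_plus _ _ _ _ _ _ _); [refine (clim_mult _ _ _ _ _ _ _); assumption|refine (clim_mult _ _ _ _ _ _ _); [exact (clim_const _ _)|assumption]].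
  - congruence.
  - intros w; rewrite (K w), (K' w); ring.
Qed.

Lemma isd_comp f g z l m : isd g z m -> isd f (g z) l -> isd (fun w => f (g w)) z (l * m)%C.
Proof.
  intros Hg Hf; pose proof (isd_cts _ _ _ Hg) as Cg; revert Hf Hg.
  rewrite !isd_slope; intros [p [A [B K]]] [q [A' [B' K']]].
  exists (fun w => p (g w) * q w)%C; split; [|split].
  - refine (clim_mult _ _ _ _ _ _ _); [|assumption].
    eapply clim_comp; [|exact A]; apply clim_filterlim; [typeclasses eauto|exact Cg].
  - congruence.
  - intros w; assert (E : (g w - g z)%C = (q w * (w - z))%C) by (rewrite (K' w); ring).
    rewrite (K (g w)), E; ring.
Qed.

(** Outside a disc on which [f] has no zeros the function is first replaced by
    one for which the identity of [isd_slope] holds trivially. *)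
Lemma isd_inv (f : C -> C) z l : f z <> 0 -> isd f z l -> isd (fun w => / f w)%C z (- l / (f z * f z))%C.
Proof.
  intros Hz Hf; pose proof (isd_cts _ _ _ Hf) as Cf.
  assert (N : locally z (fun w => f w <> 0)).
  { generalize (Cf (Cmod (f z)) (proj1 (Cmod_gt_0 _) Hz)); apply filter_imp; intros w Hw E.
    rewrite E, Cmod_sym in Hw; replace (f z - 0)%C with (f z) in Hw by ring; lra. }
  apply isd_slope in Hf; destruct Hf as [p [A [B K]]].
  apply locally_disc in N; destruct N as [r [Hr N]].
  assert (I : isd (fun w => if Rlt_dec (Cmod (w - z)) r then / f w else / f z - p w * (w - z) / (f z * f z))%C z (- l / (f z * f z))%C).
  { apply isd_slope.
    exists (fun w => if Rlt_dec (Cmod (w - z)) r then - p w * / (f w * f z) else - p w / (f z * f z))%C.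
    assert (D : forall w : C, disc z r w -> (if Rlt_dec (Cmod (w - z)) r then - p w * / (f w * f z) else - p w / (f z * f z))%C = (- p w * / (f w * f z))%C).
    { intros w Hw; destruct Rlt_dec as [|n]; [reflexivity|elim n; exact Hw]. }
    split; [|split].
    - refine (clim_ext _ (fun w => - p w * / (f w * f z))%C _ _ _ _).
      + apply locally_disc; exists r; split; [exact Hr|]; intros w Hw; symmetry; apply D, Hw.
      + refine (clim_mult _ _ _ _ _ _ _); [refine (clim_opp _ _ _ A)|]; refine (clim_inv _ _ _ _ _); [apply Cmult_neq_0; assumption|].
        refine (clim_mult _ _ _ _ _ _ _); [exact Cf|exact (clim_const _ _)].
    - rewrite D by (apply disc_center; exact Hr); rewrite B; reflexivity.
    - intros w; destruct (Rlt_dec (Cmod (z - z)) r) as [_|n]; [|elim n; apply disc_center; exact Hr].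
      destruct Rlt_dec as [h|n].
      + rewrite (K w) at 1; assert (Nw := N w h); rewrite (K w) in Nw |- *; field; auto.
      + field; exact Hz. }
  eapply isd_ext_loc; [|exact I].
  apply locally_disc; exists r; split; [exact Hr|]; intros w Hw.
  destruct Rlt_dec as [|n]; [reflexivity|elim n; exact Hw].
Qed.

(** Derivatives as bare existence: the form in which they are mostly used. *)
Notation der f z := (isd f%function z (C_derive f%function z)).

Lemma isd_der f z l : isd f z l -> der f z.
Proof. intros H; rewrite (isd_C_derive _ _ _ H); exact H. Qed.

Lemma der_cts f z : der f z -> cts f z.
Proof. apply isd_cts. Qed.

Lemma der_ext_loc f g z : locally z (fun w => f w = g w) -> der f z -> der g z.
Proof. intros E H; eapply isd_der, isd_ext_loc; eassumption. Qed.

Lemma der_const c z : der (fun _ => c) z.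
Proof. eapply isd_der, isd_const. Qed.

Lemma der_id z : der (fun w => w) z.
Proof. eapply isd_der, isd_id. Qed.

Lemma der_plus f g z : der f z -> der g z -> der (fun w => f w + g w)%C z.
Proof. intros; eapply isd_der, isd_plus; eassumption. Qed.

Lemma der_mult f g z : der f z -> der g z -> der (fun w => f w * g w)%C z.
Proof. intros; eapply isd_der, isd_mult; eassumption. Qed.

Lemma der_opp f z : der f z -> der (fun w => - f w)%C z.
Proof.
  intros H; apply isd_der with (0 * f z + RtoC (-1) * C_derive f z)%C.
  apply isd_ext with (fun w => RtoC (-1) * f w)%C; [intros; ring|].
  apply isd_mult; [apply isd_const|exact H].
Qed.

Lemma der_minus f g z : der f z -> der g z -> der (fun w => f w - g w)%C z.
Proof. intros; apply der_plus; [|apply der_opp]; assumption. Qed.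

Lemma der_sub c z : der (fun w => w - c)%C z.
Proof. apply der_minus; [apply der_id|apply der_const]. Qed.

Lemma der_inv (f : C -> C) z : f z <> 0 -> der f z -> der (fun w => / f w)%C z.
Proof. intros; eapply isd_der, isd_inv; eassumption. Qed.

Lemma der_div (f g : C -> C) z : g z <> 0 -> der f z -> der g z -> der (fun w => f w / g w)%C z.
Proof. intros; apply der_mult; [|apply der_inv]; assumption. Qed.

Lemma der_comp f g z : der g z -> der f (g z) -> der (fun w => f (g w)) z.
Proof. intros; eapply isd_der, isd_comp; eassumption. Qed.

Lemma der_pow f z n : der f z -> der (fun w => f w ^ n)%C z.
Proof.
  intros H; induction n as [|n IH]; [apply (der_const 1)|].
  apply (der_mult f (fun w => f w ^ n)%C); assumption.
Qed.

Lemma isd_pow c z n : isd (fun w => (w - c) ^ S n)%C z (RtoC (INR (S n)) * (z - c) ^ n)%C.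
Proof.
  induction n as [|n IH].
  - replace (RtoC (INR 1) * (z - c) ^ 0)%C with (1 + - 0)%C by (simpl; ring).
    apply isd_ext with (fun w => w + - c)%C; [intros; simpl; ring|].
    replace (1 + - 0)%C with (1 + 0)%C by ring.
    apply isd_plus; [apply isd_id|apply isd_const].
  - assert (H : isd (fun w => w - c)%C z (1 + 0)%C) by (apply isd_plus; [apply isd_id|apply isd_const]).
    pose proof (isd_mult _ _ _ _ _ H IH) as K; simpl in K.
    rewrite S_INR, RtoC_plus.
    replace ((RtoC (INR (S n)) + 1) * (z - c) ^ S n)%C
      with ((1 + 0) * ((z - c) * (z - c) ^ n) + (z - c) * (RtoC (INR (S n)) * (z - c) ^ n))%C by (simpl; ring).
    exact K.
Qed.

Lemma C_derive_ext_loc f g z : locally z (fun w => f w = g w) -> der f z -> C_derive g z = C_derive f z.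
Proof. intros E H; apply isd_C_derive; eapply isd_ext_loc; eassumption. Qed.

(** * Integrals of complex-valued functions and the theorem of Goursat *)

Definition isI (g : R -> C) (a b : R) (l : C) : Prop := is_RInt (V := C_R_NormedModule) g a b l.
Definition CInt (g : R -> C) (a b : R) : C := RInt (V := C_R_CompleteNormedModule) g a b.
Definition cont_on (g : R -> C) (a b : R) : Prop :=
  forall t, Rmin a b <= t <= Rmax a b -> clim (locally t) g (g t).

Lemma CInt_correct g a b : cont_on g a b -> isI g a b (CInt g a b).
Proof.
  intros H; apply (RInt_correct (V := C_R_CompleteNormedModule)).
  apply (ex_RInt_continuous (V := C_R_CompleteNormedModule)); intros t Ht.
  exact (proj1 (clim_filterlim _ _ _) (H t Ht)).
Qed.

Lemma isI_unique g a b l : isI g a b l -> CInt g a b = l.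
Proof. apply (is_RInt_unique (V := C_R_CompleteNormedModule)). Qed.

Lemma isI_plus g h a b l m : isI g a b l -> isI h a b m -> isI (fun t => g t + h t)%C a b (l + m)%C.
Proof. apply (is_RInt_plus (V := C_R_NormedModule)). Qed.

Lemma isI_ext g h a b l : (forall t, Rmin a b <= t <= Rmax a b -> g t = h t) -> isI g a b l -> isI h a b l.
Proof. intros E; apply (is_RInt_ext (V := C_R_NormedModule)); intros t Ht; apply E; lra. Qed.

Lemma isI_pair g a b u v :
  is_RInt (fun t => fst (g t)) a b u -> is_RInt (fun t => snd (g t)) a b v -> isI g a b (u, v).
Proof. apply (is_RInt_fct_extend_pair (U := R_NormedModule) (V := R_NormedModule)). Qed.

Lemma isI_scal g a b l c : isI g a b l -> isI (fun t => c * g t)%C a b (c * l)%C.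
Proof.
  intros H.
  pose proof (is_RInt_fct_extend_fst (U := R_NormedModule) (V := R_NormedModule) _ _ _ _ H) as H1.
  pose proof (is_RInt_fct_extend_snd (U := R_NormedModule) (V := R_NormedModule) _ _ _ _ H) as H2.
  apply isI_pair; simpl.
  - exact (is_RInt_minus (V := R_NormedModule) _ _ _ _ _ _ (is_RInt_scal _ _ _ (fst c) _ H1) (is_RInt_scal _ _ _ (snd c) _ H2)).
  - exact (is_RInt_plus (V := R_NormedModule) _ _ _ _ _ _ (is_RInt_scal _ _ _ (fst c) _ H2) (is_RInt_scal _ _ _ (snd c) _ H1)).
Qed.

Lemma isI_const c a b : isI (fun _ => c) a b (RtoC (b - a) * c)%C.
Proof.
  replace (RtoC (b - a) * c)%C with (scal (b - a) c : C_R_NormedModule).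
  - apply (is_RInt_const (V := C_R_NormedModule)).
  - destruct c as [x y]; apply injective_projections; simpl; unfold scal, mult; simpl; unfold mult; simpl; ring.
Qed.

Lemma isI_id a b : isI (fun t => RtoC t) a b (RtoC ((b ^ 2 - a ^ 2) / 2)).
Proof.
  apply isI_pair; simpl.
  - replace ((b * (b * 1) - a * (a * 1)) / 2) with (minus (b ^ 2 / 2) (a ^ 2 / 2))
      by (unfold minus, plus, opp; simpl; field).
    apply (is_RInt_derive (fun t => t ^ 2 / 2)).
    + intros x _; auto_derive; [exact I|field].
    + intros x _; apply continuous_id.
  - pose proof (is_RInt_const (V := R_NormedModule) a b 0) as K.
    replace (scal (b - a) (0 : R_NormedModule)) with 0 in K
      by (unfold scal; simpl; unfold mult; simpl; ring).
    exact K.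
Qed.

Lemma CInt_bound_le g a b M : a <= b -> cont_on g a b ->
  (forall t, a <= t <= b -> Cmod (g t) <= M) -> Cmod (CInt g a b) <= (b - a) * M.
Proof.
  intros Hab Hc HM; rewrite Cmod_norm.
  apply (norm_RInt_le_const (V := C_R_NormedModule) g a b _ M Hab); [|apply CInt_correct, Hc].
  intros t Ht; rewrite <- Cmod_norm; apply HM, Ht.
Qed.

Lemma CInt_chasles g a b c : cont_on g a b -> cont_on g b c -> (CInt g a b + CInt g b c)%C = CInt g a c.
Proof.
  intros H1 H2; apply (RInt_Chasles (V := C_R_CompleteNormedModule)); eexists; apply CInt_correct; assumption.
Qed.

Lemma CInt_swap g a b : cont_on g a b -> CInt g b a = (- CInt g a b)%C.
Proof.
  intros H; symmetry; apply (opp_RInt_swap (V := C_R_CompleteNormedModule)).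
  eexists; apply CInt_correct, H.
Qed.

Lemma CInt_bound g a b M : cont_on g a b ->
  (forall t, Rmin a b <= t <= Rmax a b -> Cmod (g t) <= M) -> Cmod (CInt g a b) <= Rabs (b - a) * M.
Proof.
  intros Hc HM; destruct (Rle_dec a b) as [L|L].
  - rewrite Rmin_left, Rmax_right in HM by lra; rewrite Rabs_pos_eq by lra; apply CInt_bound_le; assumption.
  - assert (Hc' : cont_on g b a) by (unfold cont_on; rewrite Rmin_comm, Rmax_comm; exact Hc).
    rewrite (CInt_swap g b a Hc'), Cmod_opp, Rabs_minus_sym.
    rewrite Rmin_right, Rmax_left in HM by lra; rewrite Rabs_pos_eq by lra; apply CInt_bound_le; (assumption || lra).
Qed.

Lemma CInt_ext g h a b : (forall t, Rmin a b <= t <= Rmax a b -> g t = h t) -> CInt g a b = CInt h a b.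
Proof. intros E; apply (RInt_ext (V := C_R_CompleteNormedModule)); intros t Ht; apply E; lra. Qed.

Lemma CInt_scal g a b c : cont_on g a b -> CInt (fun t => c * g t)%C a b = (c * CInt g a b)%C.
Proof. intros; apply isI_unique, isI_scal, CInt_correct; assumption. Qed.

Lemma CInt_minus g h a b : cont_on g a b -> cont_on h a b ->
  CInt (fun t => g t - h t)%C a b = (CInt g a b - CInt h a b)%C.
Proof.
  intros Hg Hh; apply isI_unique.
  apply isI_ext with (fun t => g t + RtoC (-1) * h t)%C; [intros; ring|].
  replace (CInt g a b - CInt h a b)%C with (CInt g a b + RtoC (-1) * CInt h a b)%C by ring.
  apply isI_plus; [|apply isI_scal]; apply CInt_correct; assumption.
Qed.

Lemma clim_horizontal (f : C -> C) (t c : R) : cts f (t, c) -> clim (locally t) (fun s : R => f (s, c)) (f (t, c)).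
Proof.
  intros H e He; apply (proj1 (cts_eps _ _) H) in He; destruct He as [d [Hd K]].
  exists (mkposreal d Hd); intros s Hs; apply K; unfold disc.
  assert (E : forall u : R, ((u, c) - (t, c))%C = RtoC (u - t)) by (intros u; apply injective_projections; simpl; ring).
  rewrite (E s), Cmod_R; exact Hs.
Qed.

Lemma clim_vertical (f : C -> C) (a s : R) : cts f (a, s) -> clim (locally s) (fun t : R => f (a, t)) (f (a, s)).
Proof.
  intros H e He; apply (proj1 (cts_eps _ _) H) in He; destruct He as [d [Hd K]].
  exists (mkposreal d Hd); intros t Ht; apply K; unfold disc.
  assert (E : forall u : R, ((a, u) - (a, s))%C = (Ci * RtoC (u - s))%C) by (intros u; apply injective_projections; simpl; ring).
  rewrite (E t), Cmod_mult, Cmod_Ci, Cmod_R, Rmult_1_l; exact Ht.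
Qed.

Definition rect (a b c d : R) (z : C) : Prop := a <= fst z <= b /\ c <= snd z <= d.

(** Integral along the positively oriented boundary of [rect a b c d]. *)
Definition bdint (f : C -> C) (a b c d : R) : C :=
  (CInt (fun t => f (t, c)) a b + Ci * CInt (fun s => f (b, s)) c d
   - CInt (fun t => f (t, d)) a b - Ci * CInt (fun s => f (a, s)) c d)%C.

Definition cts_rect f a b c d : Prop := forall z, rect a b c d z -> cts f z.

Lemma cts_rect_h f a b c d t1 t2 y : cts_rect f a b c d -> a <= t1 <= b -> a <= t2 <= b -> c <= y <= d ->
  cont_on (fun t => f (t, y)) t1 t2.
Proof.
  intros H H1 H2 Hy t Ht; apply clim_horizontal, H; split; simpl; [|exact Hy].
  revert Ht; unfold Rmin, Rmax; destruct Rle_dec; lra.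
Qed.

Lemma cts_rect_v f a b c d s1 s2 x : cts_rect f a b c d -> c <= s1 <= d -> c <= s2 <= d -> a <= x <= b ->
  cont_on (fun s => f (x, s)) s1 s2.
Proof.
  intros H H1 H2 Hy t Ht; apply clim_vertical, H; split; simpl; [exact Hy|].
  revert Ht; unfold Rmin, Rmax; destruct Rle_dec; lra.
Qed.

(** The integrals over the common sides of the four rectangles cancel. *)
Lemma bdint_split f a m b c n d : cts_rect f a b c d -> a <= m <= b -> c <= n <= d ->
  bdint f a b c d = (bdint f a m c n + bdint f m b c n + bdint f a m n d + bdint f m b n d)%C.
Proof.
  intros H Hm Hn; unfold bdint.
  assert (X : forall y, c <= y <= d -> CInt (fun t => f (t, y)) a b =
    (CInt (fun t => f (t, y)) a m + CInt (fun t => f (t, y)) m b)%C).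
  { intros y Hy; symmetry; apply CInt_chasles; eapply cts_rect_h; try eassumption; lra. }
  assert (Y : forall x, a <= x <= b -> CInt (fun s => f (x, s)) c d =
    (CInt (fun s => f (x, s)) c n + CInt (fun s => f (x, s)) n d)%C).
  { intros x Hx; symmetry; apply CInt_chasles; eapply cts_rect_v; try eassumption; lra. }
  rewrite (X c), (X d), (Y a), (Y b) by lra; ring.
Qed.

(** Computed directly, since an affine function has an explicit primitive. *)
Lemma bdint_affine (l p : C) a b c d : bdint (fun z => p + l * z)%C a b c d = 0.
Proof.
  assert (X : forall y u v, CInt (fun t => p + l * (t, y))%C u v =
    (RtoC (v - u) * (p + l * (Ci * RtoC y)) + l * RtoC ((v ^ 2 - u ^ 2) / 2))%C).
  { intros y u v; apply isI_unique.
    apply isI_ext with (fun t => (p + l * (Ci * RtoC y)) + l * RtoC t)%C.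
    - intros t _; replace (t, y) with (RtoC t + Ci * RtoC y)%C by (apply injective_projections; simpl; ring); ring.
    - apply isI_plus; [apply isI_const|apply isI_scal, isI_id]. }
  assert (Y : forall x u v, CInt (fun t => p + l * (x, t))%C u v =
    (RtoC (v - u) * (p + l * RtoC x) + l * Ci * RtoC ((v ^ 2 - u ^ 2) / 2))%C).
  { intros y u v; apply isI_unique.
    apply isI_ext with (fun t => (p + l * RtoC y) + l * Ci * RtoC t)%C.
    - intros t _; replace (y, t) with (RtoC y + Ci * RtoC t)%C by (apply injective_projections; simpl; ring); ring.
    - apply isI_plus; [apply isI_const|apply isI_scal, isI_id]. }
  unfold bdint; rewrite !X, !Y, !RtoC_minus.
  apply injective_projections; destruct l, p; simpl; field.
Qed.

Lemma bdint_bound f a b c d M : a <= b -> c <= d -> cts_rect f a b c d ->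
  (forall z, rect a b c d z -> Cmod (f z) <= M) -> Cmod (bdint f a b c d) <= 2 * ((b - a) + (d - c)) * M.
Proof.
  intros Hab Hcd H HM; unfold bdint.
  assert (X : forall y, c <= y <= d -> Cmod (CInt (fun t => f (t, y)) a b) <= (b - a) * M).
  { intros y Hy; apply CInt_bound_le; [lra| |].
    - eapply cts_rect_h; try eassumption; lra.
    - intros t Ht; apply HM; split; simpl; lra. }
  assert (Y : forall x, a <= x <= b -> Cmod (CInt (fun s => f (x, s)) c d) <= (d - c) * M).
  { intros y Hy; apply CInt_bound_le; [lra| |].
    - eapply cts_rect_v; try eassumption; lra.
    - intros t Ht; apply HM; split; simpl; lra. }
  pose proof (X c ltac:(lra)) as X1; pose proof (X d ltac:(lra)) as X2.
  pose proof (Y a ltac:(lra)) as Y1; pose proof (Y b ltac:(lra)) as Y2.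
  eapply Rle_trans; [apply Cmod_triangle|]; rewrite Cmod_opp, Cmod_mult, Cmod_Ci.
  eapply Rle_trans; [apply Rplus_le_compat_r, Cmod_triangle|]; rewrite Cmod_opp.
  eapply Rle_trans; [apply Rplus_le_compat_r, Rplus_le_compat_r, Cmod_triangle|]; rewrite Cmod_mult, Cmod_Ci; lra.
Qed.

Record box := Box { bl : R; br : R; bd : R; bu : R }.

(** A property of rectangles that passes from the four quarters of a rectangle
    to the rectangle, and that holds for all small rectangles around each
    point, holds: otherwise successive quartering would produce a point around
    which it fails. *)
Lemma quartering (Q : R -> R -> R -> R -> Prop) a0 b0 c0 d0 : a0 <= b0 -> c0 <= d0 ->
  (forall a b c d, a0 <= a -> a <= b -> b <= b0 -> c0 <= c -> c <= d -> d <= d0 ->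
     Q a ((a + b) / 2) c ((c + d) / 2) -> Q ((a + b) / 2) b c ((c + d) / 2) ->
     Q a ((a + b) / 2) ((c + d) / 2) d -> Q ((a + b) / 2) b ((c + d) / 2) d -> Q a b c d) ->
  (forall p q, a0 <= p <= b0 -> c0 <= q <= d0 -> exists r, 0 < r /\
     forall a b c d, a0 <= a -> a <= p <= b -> b <= b0 -> c0 <= c -> c <= q <= d -> d <= d0 ->
       b - a < r -> d - c < r -> Q a b c d) ->
  Q a0 b0 c0 d0.
Proof.
  intros Hab Hcd Hq Hloc; destruct (classic (Q a0 b0 c0 d0)) as [|HN]; [assumption|exfalso].
  pose (bad := fun x => (a0 <= bl x /\ bl x <= br x /\ br x <= b0) /\
    (c0 <= bd x /\ bd x <= bu x /\ bu x <= d0) /\ ~ Q (bl x) (br x) (bd x) (bu x)).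
  pose (next := fun x y => bl x <= bl y /\ br y <= br x /\ bd x <= bd y /\ bu y <= bu x /\
    br y - bl y = (br x - bl x) / 2 /\ bu y - bd y = (bu x - bd x) / 2).
  assert (step : forall x : {x | bad x}, exists y : {y | bad y}, next (proj1_sig x) (proj1_sig y)).
  { intros [[a b c d] [H1 [H2 H3]]]; simpl in H1, H2, H3.
    assert (K : exists y, bad y /\ next (Box a b c d) y).
    { apply NNPP; intros HK; apply H3, Hq; try lra; apply NNPP; intros HQ; apply HK;
        [exists (Box a ((a + b) / 2) c ((c + d) / 2)) | exists (Box ((a + b) / 2) b c ((c + d) / 2))
        |exists (Box a ((a + b) / 2) ((c + d) / 2) d) | exists (Box ((a + b) / 2) b ((c + d) / 2) d)];
        unfold bad, next; simpl; (split; [split; [lra|split; [lra|exact HQ]]|lra]). }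
    destruct K as [y [Hy K]]; exists (exist _ y Hy); exact K. }
  pose (nx := fun x => proj1_sig (constructive_indefinite_description _ (step x))).
  assert (Hnx : forall x, next (proj1_sig x) (proj1_sig (nx x))).
  { intros x; unfold nx; destruct constructive_indefinite_description; assumption. }
  assert (H0 : bad (Box a0 b0 c0 d0)) by (unfold bad; simpl; split; [lra|split; [lra|exact HN]]).
  pose (sq := fun n => Nat.iter n nx (exist _ _ H0)).
  pose (A := fun n => bl (proj1_sig (sq n))); pose (B := fun n => br (proj1_sig (sq n))).
  pose (E := fun n => bd (proj1_sig (sq n))); pose (U := fun n => bu (proj1_sig (sq n))).
  assert (HS : forall n, A n <= A (S n) /\ B (S n) <= B n /\ E n <= E (S n) /\ U (S n) <= U n /\
    B (S n) - A (S n) = (B n - A n) / 2 /\ U (S n) - E (S n) = (U n - E n) / 2).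
  { intros n; apply (Hnx (sq n)). }
  assert (HB : forall n, bad (Box (A n) (B n) (E n) (U n))).
  { intros n; unfold A, B, E, U; destruct (sq n) as [[a b c d] H]; exact H. }
  assert (Hw : forall n, B n - A n = (b0 - a0) / 2 ^ n /\ U n - E n = (d0 - c0) / 2 ^ n).
  { induction n as [|n [IH1 IH2]]; [split; unfold A, B, E, U; simpl; field|].
    destruct (HS n) as [_ [_ [_ [_ [-> ->]]]]]; rewrite IH1, IH2; simpl; split; field; apply pow_nonzero; lra. }
  assert (mono : forall n k, A n <= A (n + k)%nat /\ B (n + k)%nat <= B n /\
     E n <= E (n + k)%nat /\ U (n + k)%nat <= U n).
  { intros n k; induction k as [|k IH]; [rewrite Nat.add_0_r; lra|].
    rewrite Nat.add_succ_r; pose proof (HS (n + k)%nat); lra. }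
  assert (cross : forall n m, A n <= B m /\ E n <= U m).
  { intros n m; pose proof (mono n m); pose proof (mono m n); rewrite (Nat.add_comm m n) in *.
    destruct (HB (n + m)%nat) as [h1 [h2 _]]; simpl in h1, h2; lra. }
  destruct (completeness (fun x => exists n, x = A n)) as [p [Hp1 Hp2]].
  { exists (B 0%nat); intros x [n ->]; apply cross. }
  { exists (A 0%nat), 0%nat; reflexivity. }
  destruct (completeness (fun x => exists n, x = E n)) as [q [Hq1 Hq2]].
  { exists (U 0%nat); intros x [n ->]; apply cross. }
  { exists (E 0%nat), 0%nat; reflexivity. }
  assert (Pin : forall n, A n <= p <= B n /\ E n <= q <= U n).
  { intros n; repeat split.
    - apply Hp1; exists n; reflexivity.
    - apply Hp2; intros x [m ->]; apply cross.
    - apply Hq1; exists n; reflexivity.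
    - apply Hq2; intros x [m ->]; apply cross. }
  destruct (Hloc p q) as [r [Hr K]].
  { exact (proj1 (Pin 0%nat)). }
  { exact (proj2 (Pin 0%nat)). }
  destruct (pow_lt_1_zero (/ 2) ltac:(rewrite Rabs_pos_eq; lra) (r / (1 + (b0 - a0) + (d0 - c0)))) as [N HN2].
  { apply Rdiv_lt_0_compat; lra. }
  specialize (HN2 N (le_n N)); destruct (Hw N) as [w1 w2].
  assert (P2 : 0 < (/ 2) ^ N) by (apply pow_lt; lra).
  rewrite Rabs_pos_eq in HN2 by lra; apply Rlt_div_r in HN2; [|lra].
  unfold Rdiv in w1, w2; rewrite <- pow_inv in w1, w2.
  destruct (HB N) as [h1 [h2 h3]]; simpl in h1, h2, h3; apply h3.
  destruct (Pin N) as [pin1 pin2]; apply K; try lra; nra.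
Qed.

(** Near each point [f] is affine up to [e] times the distance, and affine
    functions do not contribute to the integral. So around each point the
    integral is at most a multiple of [e] times the square of the size, a bound
    that is preserved when four quarters are put together; [quartering] makes
    it global. *)
Theorem goursat f a b c d : a <= b -> c <= d ->
  (forall z, rect a b c d z -> der f z) -> bdint f a b c d = 0.
Proof.
  intros Hab Hcd H; apply Cmod_small; intros eps He.
  set (e := eps / (1 + 2 * ((b - a) + (d - c)) ^ 2)).
  assert (Hsq : 0 <= ((b - a) + (d - c)) ^ 2) by (simpl; nra).
  assert (He' : 0 < e) by (apply Rdiv_lt_0_compat; lra).
  assert (HC : cts_rect f a b c d) by (intros z Hz; apply der_cts, H, Hz).
  apply Rle_trans with (2 * e * ((b - a) + (d - c)) ^ 2).
  2:{ apply Rle_trans with (e * (1 + 2 * ((b - a) + (d - c)) ^ 2)); [lra|right; unfold e; field; lra]. }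
  apply (quartering (fun a b c d => Cmod (bdint f a b c d) <= 2 * e * ((b - a) + (d - c)) ^ 2)); [exact Hab|exact Hcd| |].
  - intros a1 b1 c1 d1 L1 L2 L3 L4 L5 L6 Q1 Q2 Q3 Q4.
    rewrite (bdint_split f a1 ((a1 + b1) / 2) b1 c1 ((c1 + d1) / 2) d1).
    2:{ intros z [Z1 Z2]; apply HC; split; lra. }
    2,3: lra.
    eapply Rle_trans; [apply Cmod_triangle|].
    eapply Rle_trans; [apply Rplus_le_compat_r, Cmod_triangle|].
    eapply Rle_trans; [apply Rplus_le_compat_r, Rplus_le_compat_r, Cmod_triangle|].
    simpl in *; nra.
  - intros p q Hp Hq; destruct (H (p, q) (conj Hp Hq) e He') as [r [Hr K]].
    set (l := C_derive f (p, q)) in *.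
    exists (r / 2); split; [lra|]; intros a1 b1 c1 d1 L1 L2 L3 L4 L5 L6 L7 L8.
    (* the affine approximation of [f] at [(p, q)] *)
    pose (g := fun z => (f (p, q) - l * (p, q) + l * z)%C).
    assert (Sub : forall z, rect a1 b1 c1 d1 z -> rect a b c d z) by (intros z [Z1 Z2]; split; lra).
    assert (HCg : forall z, cts g z).
    { intros z; apply der_cts, der_plus; [apply der_const|apply der_mult; [apply der_const|apply der_id]]. }
    assert (EQ : bdint f a1 b1 c1 d1 = bdint (fun z => f z - g z)%C a1 b1 c1 d1).
    { transitivity (bdint f a1 b1 c1 d1 - bdint g a1 b1 c1 d1)%C.
      - unfold g at 1; rewrite bdint_affine; ring.
      - assert (HC1 : cts_rect f a1 b1 c1 d1) by (intros z Hz; apply HC, Sub, Hz).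
        assert (HC2 : cts_rect g a1 b1 c1 d1) by (intros z Hz; apply HCg).
        unfold bdint; rewrite !CInt_minus; try ring;
          (eapply cts_rect_h || eapply cts_rect_v); try eassumption; lra. }
    rewrite EQ.
    replace (2 * e * (b1 - a1 + (d1 - c1)) ^ 2)
      with (2 * ((b1 - a1) + (d1 - c1)) * (e * ((b1 - a1) + (d1 - c1)))) by ring.
    apply bdint_bound; [lra|lra| |].
    + intros z Hz; refine (clim_minus _ _ _ _ _ _ _); [apply HC, Sub, Hz|apply HCg].
    + intros z [Z1 Z2].
      assert (Dz : Cmod (z - (p, q)) <= (b1 - a1) + (d1 - c1)).
      { replace (z - (p, q))%C with (RtoC (fst z - p) + Ci * RtoC (snd z - q))%C
          by (apply injective_projections; simpl; ring).
        eapply Rle_trans; [apply Cmod_triangle|]; rewrite Cmod_mult, Cmod_Ci, !Cmod_R.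
        assert (Rabs (fst z - p) <= b1 - a1) by (apply Rabs_le; lra).
        assert (Rabs (snd z - q) <= d1 - c1) by (apply Rabs_le; lra). lra. }
      replace (f z - g z)%C with (f z - f (p, q) - l * (z - (p, q)))%C by (unfold g; ring).
      eapply Rle_trans; [apply K; unfold disc; lra|]; apply Rmult_le_compat_l; lra.
Qed.

(** * The exponential and Cauchy's integral formula *)

Definition Cexp (z : C) : C := (exp (fst z) * cos (snd z), exp (fst z) * sin (snd z)).

Lemma Cexp_add z w : Cexp (z + w) = (Cexp z * Cexp w)%C.
Proof.
  apply injective_projections; simpl; rewrite exp_plus, ?cos_plus, ?sin_plus; ring.
Qed.

Lemma Cexp_0 : Cexp 0 = 1.
Proof. apply injective_projections; simpl; rewrite exp_0, ?cos_0, ?sin_0; ring. Qed.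

Lemma Cmod_Cexp z : Cmod (Cexp z) = exp (fst z).
Proof.
  unfold Cmod; simpl.
  replace (_ + _) with (exp (fst z) * exp (fst z)).
  - apply sqrt_square; left; apply exp_pos.
  - pose proof (sin2_cos2 (snd z)) as H; unfold Rsqr in H.
    transitivity (exp (fst z) * exp (fst z) * (sin (snd z) * sin (snd z) + cos (snd z) * cos (snd z))); [rewrite H; ring|ring].
Qed.

Lemma Cexp_nz z : Cexp z <> 0.
Proof. apply Cmod_gt_0; rewrite Cmod_Cexp; apply exp_pos. Qed.

Lemma Cexp_opp z : Cexp (- z) = (/ Cexp z)%C.
Proof.
  assert (H : (Cexp (- z) * Cexp z)%C = 1) by (rewrite <- Cexp_add; replace (- z + z)%C with (RtoC 0) by ring; apply Cexp_0).
  replace (/ Cexp z)%C with (Cexp (- z) * Cexp z * / Cexp z)%C by (rewrite H; ring).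
  field; apply Cexp_nz.
Qed.

Lemma Cexp_pow z n : (Cexp z ^ n)%C = Cexp (RtoC (INR n) * z).
Proof.
  induction n as [|n IH].
  - simpl; replace (0 * z)%C with (RtoC 0) by ring; symmetry; apply Cexp_0.
  - rewrite S_INR, RtoC_plus; simpl Cpow; rewrite IH, <- Cexp_add; f_equal; ring.
Qed.

Lemma Cexp_2kPI z (k : Z) : Cexp (z + Ci * RtoC (2 * IZR k * PI)) = Cexp z.
Proof.
  rewrite Cexp_add; replace (Cexp (Ci * RtoC (2 * IZR k * PI))) with (RtoC 1); [ring|].
  assert (N : forall n : nat, sin (2 * INR n * PI) = 0 /\ cos (2 * INR n * PI) = 1).
  { intros n; rewrite <- (Rplus_0_l (2 * INR n * PI)), sin_period, cos_period, sin_0, cos_0; auto. }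
  assert (H : sin (2 * IZR k * PI) = 0 /\ cos (2 * IZR k * PI) = 1).
  { destruct (Z_le_dec 0 k) as [L|L].
    - rewrite <- (Z2Nat.id k L), <- INR_IZR_INZ; apply N.
    - replace k with (- Z.of_nat (Z.to_nat (- k)))%Z by (rewrite Z2Nat.id; lia).
      rewrite opp_IZR, <- INR_IZR_INZ.
      replace (2 * - INR (Z.to_nat (- k)) * PI) with (- (2 * INR (Z.to_nat (- k)) * PI)) by ring.
      rewrite sin_neg, cos_neg; destruct (N (Z.to_nat (- k))) as [-> ->]; split; [ring|reflexivity]. }
  generalize dependent (2 * IZR k * PI); intros x [Hs Hc].
  replace (Ci * RtoC x)%C with ((0, x) : C) by (apply injective_projections; simpl; ring).
  unfold Cexp; simpl; rewrite exp_0, Hs, Hc; apply injective_projections; simpl; ring.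
Qed.

Lemma Cexp_surj u : u <> RtoC 0 -> exists z, Cexp z = u.
Proof.
  intros Hu; assert (Hm : 0 < Cmod u) by (apply Cmod_gt_0; exact Hu).
  set (r := Cmod u) in *.
  assert (E : fst u * fst u + snd u * snd u = r * r).
  { unfold r, Cmod; rewrite sqrt_sqrt; [simpl; ring|simpl; nra]. }
  set (x := fst u / r); set (y := snd u / r).
  assert (Exy : x * x + y * y = 1).
  { unfold x, y; replace (fst u / r * (fst u / r) + snd u / r * (snd u / r)) with ((fst u * fst u + snd u * snd u) / (r * r)) by (field; lra).
    rewrite E; field; lra. }
  assert (Hx : -1 <= x <= 1) by nra.
  assert (S : sin (acos x) = Rabs y).
  { rewrite sin_acos by exact Hx; unfold Rsqr; replace (1 - x * x) with (y * y) by lra; apply sqrt_Rsqr_abs. }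
  assert (F : fst u = r * x /\ snd u = r * y) by (unfold x, y; split; field; lra).
  destruct (Rle_dec 0 y) as [L|L].
  - exists (ln r, acos x); unfold Cexp; simpl; rewrite exp_ln, cos_acos, S, Rabs_pos_eq by assumption.
    destruct F as [F1 F2]; apply injective_projections; simpl; auto.
  - exists (ln r, - acos x); unfold Cexp; simpl; rewrite exp_ln, cos_neg, sin_neg, cos_acos, S, Rabs_left by lra.
    destruct F as [F1 F2]; apply injective_projections; simpl; rewrite ?Ropp_involutive; auto.
Qed.

Lemma small_o (f : R -> R) l : is_derive f 0 l -> forall e, 0 < e -> exists d, 0 < d /\
  forall x, Rabs x < d -> Rabs (f x - f 0 - l * x) <= e * Rabs x.
Proof.
  intros [_ H] e He; destruct (H 0 (fun P HP => HP) (mkposreal e He)) as [d K].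
  exists d; split; [apply cond_pos|]; intros x Hx.
  assert (B : ball 0 d x) by (unfold ball; simpl; unfold AbsRing_ball, minus, plus, opp; simpl; rewrite Ropp_0, Rplus_0_r; exact Hx).
  specialize (K x B); simpl in K; unfold norm, minus, plus, opp, scal in K; simpl in K.
  unfold abs, mult in K; simpl in K.
  replace (f x - f 0 - l * x) with (f x + - f 0 + - ((x + - 0) * l)) by ring.
  replace (e * Rabs x) with (e * Rabs (x + - 0)) by (f_equal; f_equal; ring); exact K.
Qed.

(** By the functional equation it suffices to treat [0], where the real
    exponential, cosine and sine have the derivatives 1, 0 and 1. *)
Lemma isd_Cexp z : isd Cexp z (Cexp z).
Proof.
  assert (H0 : isd Cexp 0 1).
  { intros eps He; set (e := Rmin 1 (eps / 9)).
    assert (He' : 0 < e) by pos.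
    assert (e <= 1) by apply Rmin_l; assert (e <= eps / 9) by apply Rmin_r.
    destruct (small_o exp 1 ltac:(auto_derive; [exact I|rewrite exp_0; ring]) e He') as [d1 [D1 K1]].
    destruct (small_o cos 0 ltac:(auto_derive; [exact I|rewrite sin_0; ring]) e He') as [d2 [D2 K2]].
    destruct (small_o sin 1 ltac:(auto_derive; [exact I|rewrite cos_0; ring]) e He') as [d3 [D3 K3]].
    rewrite exp_0 in K1; rewrite cos_0 in K2; rewrite sin_0 in K3.
    assert (Hd : 0 < Rmin (Rmin d1 d2) (Rmin d3 e)) by pos.
    exists (Rmin (Rmin d1 d2) (Rmin d3 e)); split; [exact Hd|]; intros [x y] Hw.
    unfold disc in Hw; replace ((x, y) - 0)%C with (x, y) in * by (apply injective_projections; simpl; ring).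
    set (m := Cmod (x, y)) in *.
    assert (Hx : Rabs x <= m) by apply (re_le_Cmod (x, y)).
    assert (Hy : Rabs y <= m) by (eapply Rle_trans; [apply Rmax_r|apply (Rmax_Cmod (x, y))]).
    pose proof (Rmin_l (Rmin d1 d2) (Rmin d3 e)); pose proof (Rmin_r (Rmin d1 d2) (Rmin d3 e)).
    pose proof (Rmin_l d1 d2); pose proof (Rmin_r d1 d2); pose proof (Rmin_l d3 e); pose proof (Rmin_r d3 e).
    specialize (K1 x ltac:(lra)); specialize (K2 y ltac:(lra)); specialize (K3 y ltac:(lra)).
    pose (a := (exp x - 1 - 1 * x)); pose (b := (cos y - 1 - 0 * y, sin y - 0 - 1 * y) : C).
    replace (Cexp (x, y) - Cexp 0 - 1 * (x, y))%C
      with (RtoC (x + a) * (Ci * RtoC y + b) + (RtoC a + b))%C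
      by (rewrite Cexp_0; unfold a, b, Cexp; apply injective_projections; simpl; ring).
    assert (B : Cmod b <= 2 * (e * Rabs y)).
    { replace b with (RtoC (cos y - 1 - 0 * y) + Ci * RtoC (sin y - 0 - 1 * y))%C
        by (apply injective_projections; simpl; ring).
      eapply Rle_trans; [apply Cmod_triangle|]; rewrite Cmod_mult, Cmod_Ci, !Cmod_R; lra. }
    assert (A : Rabs a <= e * Rabs x) by exact K1.
    pose proof (Rabs_pos x); pose proof (Rabs_pos y).
    eapply Rle_trans; [apply Cmod_triangle|]; rewrite Cmod_mult, Cmod_R.
    pose proof (Cmod_triangle (Ci * RtoC y) b) as T1; rewrite Cmod_mult, Cmod_Ci, Cmod_R in T1.
    pose proof (Cmod_triangle (RtoC a) b) as T2; rewrite Cmod_R in T2.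
    pose proof (Rabs_triang x a) as T3.
    pose proof (Rabs_pos (x + a)); pose proof (Cmod_ge_0 (Ci * RtoC y + b)).
    assert (P : Rabs (x + a) * Cmod (Ci * RtoC y + b) <= (2 * m) * (3 * m)) by (apply Rmult_le_compat; nra).
    assert (0 <= m) by lra; assert (m <= e) by lra.
    assert (m * m <= e * m) by (apply Rmult_le_compat_r; lra).
    assert (9 * (e * m) <= eps * m) by nra.
    assert (e * Rabs x <= e * m) by (apply Rmult_le_compat_l; lra).
    assert (e * Rabs y <= e * m) by (apply Rmult_le_compat_l; lra).
    lra. }
  assert (Hs : isd (fun w => w - z)%C z 1).
  { replace (RtoC 1) with (1 + 0)%C by ring; apply isd_plus; [apply isd_id|apply isd_const]. }
  assert (H0' : isd Cexp (z - z)%C 1) by (replace (z - z)%C with (RtoC 0) by ring; exact H0).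
  pose proof (isd_mult _ _ _ _ _ (isd_const (Cexp z) z) (isd_comp _ _ _ _ _ Hs H0')) as H.
  cbv beta in H.
  replace (0 * Cexp (z - z) + Cexp z * (1 * 1))%C with (Cexp z) in H by ring.
  refine (isd_ext _ _ _ _ _ H); intros w; rewrite <- Cexp_add; f_equal; ring.
Qed.

Lemma der_Cexp z : der Cexp z.
Proof. eapply isd_der, isd_Cexp. Qed.

Definition circ (r t : R) : C := (r * cos t, r * sin t).

Lemma circ_Cexp r t : 0 < r -> circ r t = Cexp (ln r, t).
Proof. intros H; unfold circ, Cexp; simpl; rewrite exp_ln by exact H; reflexivity. Qed.

Lemma Cmod_circ r t : 0 < r -> Cmod (circ r t) = r.
Proof. intros H; rewrite circ_Cexp, Cmod_Cexp by exact H; simpl; apply exp_ln, H. Qed.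

(** [2 PI] times the mean value of [f] on the circle. *)
Definition circmean (f : C -> C) (c : C) (r : R) : C := CInt (fun t => f (c + circ r t)%C) 0 (2 * PI).

Definition cts_circ (f : C -> C) (c : C) (r : R) : Prop := forall z, Cmod (z - c) = r -> cts f z.

Lemma cts_circ_mult f g c r : cts_circ f c r -> cts_circ g c r -> cts_circ (fun z => f z * g z)%C c r.
Proof. intros Hf Hg z Hz; refine (clim_mult _ _ _ _ _ _ _); [apply Hf, Hz|apply Hg, Hz]. Qed.

Lemma cts_circ_minus f g c r : cts_circ f c r -> cts_circ g c r -> cts_circ (fun z => f z - g z)%C c r.
Proof. intros Hf Hg z Hz; refine (clim_minus _ _ _ _ _ _ _); [apply Hf, Hz|apply Hg, Hz]. Qed.

Lemma cts_circ_const a c r : cts_circ (fun _ => a) c r.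
Proof. intros z _; exact (clim_const _ _). Qed.

Lemma add_sub c w : (c + w - c)%C = w.
Proof. ring. Qed.

Lemma der_polar f c z : der f (c + Cexp z)%C -> der (fun z => f (c + Cexp z)%C) z.
Proof.
  intros H; apply (der_comp f (fun z => c + Cexp z)%C); [|exact H].
  apply der_plus; [apply der_const|apply der_Cexp].
Qed.

Lemma cts_polar f c z : cts f (c + Cexp z)%C -> cts (fun z => f (c + Cexp z)%C) z.
Proof.
  intros H; refine (clim_comp (locally z) (locally (c + Cexp z)%C) (fun z => c + Cexp z)%C f _ _ H).
  apply clim_filterlim; [typeclasses eauto|].
  apply (der_cts (fun z => c + Cexp z)%C), der_plus; [apply der_const|apply der_Cexp].
Qed.

Lemma cont_circ f c r a b : 0 < r -> cts_circ f c r -> cont_on (fun t => f (c + circ r t)%C) a b.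
Proof.
  intros Hr H t _; rewrite circ_Cexp by exact Hr.
  refine (clim_ext _ (fun t => f (c + Cexp (ln r, t))%C) _ _ _ _).
  - apply filter_forall; intros s; rewrite circ_Cexp by exact Hr; reflexivity.
  - apply (clim_vertical (fun z => f (c + Cexp z)%C)), cts_polar, H.
    rewrite add_sub, <- circ_Cexp, Cmod_circ; [reflexivity|exact Hr|exact Hr].
Qed.

Lemma circmean_bound f c r M : 0 < r -> cts_circ f c r ->
  (forall z, Cmod (z - c) = r -> Cmod (f z) <= M) -> Cmod (circmean f c r) <= 2 * PI * M.
Proof.
  intros Hr Hc HM; pose proof PI_RGT_0; unfold circmean.
  replace (2 * PI * M) with ((2 * PI - 0) * M) by ring; apply CInt_bound_le; [lra|apply cont_circ; assumption|].
  intros t _; apply HM; rewrite add_sub; apply Cmod_circ, Hr.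
Qed.

Lemma circmean_ext f g c r : 0 < r -> (forall z, Cmod (z - c) = r -> f z = g z) -> circmean f c r = circmean g c r.
Proof. intros Hr E; apply CInt_ext; intros t _; apply E; rewrite add_sub; apply Cmod_circ, Hr. Qed.

Lemma circmean_minus f g c r : 0 < r -> cts_circ f c r -> cts_circ g c r ->
  circmean (fun z => f z - g z)%C c r = (circmean f c r - circmean g c r)%C.
Proof. intros; apply CInt_minus; apply cont_circ; assumption. Qed.

Lemma circmean_scal f c r a : 0 < r -> cts_circ f c r -> circmean (fun z => a * f z)%C c r = (a * circmean f c r)%C.
Proof. intros; apply (CInt_scal (fun t => f (c + circ r t)%C)), cont_circ; assumption. Qed.

Lemma circmean_const a c r : circmean (fun _ => a) c r = (RtoC (2 * PI) * a)%C.
Proof. unfold circmean; rewrite (isI_unique _ _ _ _ (isI_const a 0 (2 * PI))); f_equal; f_equal; ring. Qed.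

(** In logarithmic polar coordinates an annulus becomes a rectangle, on whose
    horizontal sides a [2 PI]-periodic function has the same integrals; hence
    Goursat's theorem equates the vertical ones. *)
Lemma circmean_annulus f c r1 r2 : 0 < r1 -> r1 <= r2 ->
  (forall z, r1 <= Cmod (z - c) <= r2 -> der f z) -> circmean f c r1 = circmean f c r2.
Proof.
  intros H1 H2 H; pose proof PI_RGT_0.
  pose (g := fun z => f (c + Cexp z)%C).
  assert (L : ln r1 <= ln r2) by (destruct H2 as [H2|<-]; [left; apply ln_increasing; assumption|lra]).
  assert (Hg : forall z, rect (ln r1) (ln r2) 0 (2 * PI) z -> der g z).
  { intros z [Hz _]; apply der_polar, H; rewrite add_sub, Cmod_Cexp.
    rewrite <- (exp_ln r1), <- (exp_ln r2) by lra.
    destruct Hz as [[h|h] [h'|h']]; split; try (rewrite h; lra); try (rewrite <- h'; lra); left; try (apply exp_increasing; assumption);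
      apply exp_increasing; lra. }
  pose proof (goursat g (ln r1) (ln r2) 0 (2 * PI) L ltac:(lra) Hg) as G; unfold bdint in G.
  assert (P : CInt (fun t => g (t, 0)) (ln r1) (ln r2) = CInt (fun t => g (t, 2 * PI)) (ln r1) (ln r2)).
  { apply CInt_ext; intros t _; unfold g.
    replace (t, 2 * PI) with ((t, 0) + Ci * RtoC (2 * 1 * PI))%C by (apply injective_projections; simpl; ring).
    rewrite (Cexp_2kPI (t, 0) 1); reflexivity. }
  rewrite P in G.
  assert (E : forall r, 0 < r -> circmean f c r = CInt (fun s => g (ln r, s)) 0 (2 * PI)).
  { intros r Hr; apply CInt_ext; intros t _; unfold g; rewrite circ_Cexp by exact Hr; reflexivity. }
  rewrite (E r1), (E r2) by lra.
  set (u := CInt (fun s => g (ln r1, s)) 0 (2 * PI)) in *; set (v := CInt (fun s => g (ln r2, s)) 0 (2 * PI)) in *.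
  set (w := CInt (fun t => g (t, 2 * PI)) (ln r1) (ln r2)) in *.
  assert (K : (Ci * (v - u))%C = 0) by (rewrite <- G; ring).
  symmetry; apply Cminus_eq.
  replace (v - u)%C with (- Ci * (Ci * (v - u)))%C by (apply injective_projections; simpl; ring).
  rewrite K; ring.
Qed.

(** Continuity of [f] at the points of the circle is uniform by compactness of
    the interval of angles. *)
Lemma circmean_cts f c rho : 0 < rho -> cts_circ f c rho -> forall eps, 0 < eps -> exists d, 0 < d /\
  forall r, 0 < r -> Rabs (r - rho) < d -> cts_circ f c r -> Cmod (circmean f c r - circmean f c rho) <= eps.
Proof.
  intros Hrho H eps He; pose proof PI_RGT_0.
  set (e := eps / (2 * PI)); assert (He' : 0 < e) by (apply Rdiv_lt_0_compat; lra).
  assert (HL : forall t, exists d : posreal, forall r s, Rabs (r - rho) < d -> Rabs (s - t) < d ->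
    Cmod (f (c + circ r s)%C - f (c + circ rho t)%C) < e / 2).
  { intros t.
    assert (Ht : cts f (c + circ rho t)%C) by (apply H; rewrite add_sub; apply Cmod_circ, Hrho).
    destruct (proj1 (cts_eps _ _) Ht (e / 2) ltac:(lra)) as [d [Hd K]].
    assert (Hr : 0 < d / (2 * (1 + rho))) by (apply Rdiv_lt_0_compat; lra).
    assert (Hm : 0 < Rmin 1 (d / (2 * (1 + rho)))) by pos.
    exists (mkposreal _ Hm); simpl; intros r s h1 h2; apply K; unfold disc.
    pose proof (Rmin_r 1 (d / (2 * (1 + rho)))) as m1.
    replace (c + circ r s - (c + circ rho t))%C with (circ r s - circ rho t)%C by ring.
    assert (X : Rabs (cos s - cos t) <= Rabs (s - t) /\ Rabs (sin s - sin t) <= Rabs (s - t)).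
    { split.
      - destruct (MVT_gen cos t s (fun x => - sin x)) as [x [_ E]].
        + intros x _; auto_derive; [exact I|ring].
        + intros x _; apply derivable_continuous_pt, derivable_pt_cos.
        + rewrite E, Rabs_mult, Rabs_Ropp; pose proof (Rabs_pos (s - t)).
          assert (Rabs (sin x) <= 1) by (apply Rabs_le, SIN_bound); nra.
      - destruct (MVT_gen sin t s cos) as [x [_ E]].
        + intros x _; auto_derive; [exact I|ring].
        + intros x _; apply derivable_continuous_pt, derivable_pt_sin.
        + rewrite E, Rabs_mult; pose proof (Rabs_pos (s - t)).
          assert (Rabs (cos x) <= 1) by (apply Rabs_le, COS_bound); nra. }
    assert (Y : Cmod (circ 1 s - circ 1 t) <= 2 * Rabs (s - t)).
    { replace (circ 1 s - circ 1 t)%C with (RtoC (cos s - cos t) + Ci * RtoC (sin s - sin t))%C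
        by (apply injective_projections; simpl; ring).
      eapply Rle_trans; [apply Cmod_triangle|]; rewrite Cmod_mult, Cmod_Ci, !Cmod_R; lra. }
    replace (circ r s - circ rho t)%C with (RtoC (r - rho) * circ 1 s + RtoC rho * (circ 1 s - circ 1 t))%C
      by (unfold circ; apply injective_projections; simpl; ring).
    eapply Rle_lt_trans; [apply Cmod_triangle|]; rewrite !Cmod_mult, !Cmod_R, (Cmod_circ 1), (Rabs_pos_eq rho) by lra.
    assert (Z : d / (2 * (1 + rho)) * (2 * (1 + rho)) = d) by (field; lra).
    assert (rho * Cmod (circ 1 s - circ 1 t) <= rho * (2 * Rabs (s - t))) by (apply Rmult_le_compat_l; lra).
    assert (rho * (2 * Rabs (s - t)) <= rho * (2 * (d / (2 * (1 + rho))))) by (apply Rmult_le_compat_l; lra).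
    pose proof (Rabs_pos (r - rho)); lra. }
  pose (delta := fun t => proj1_sig (constructive_indefinite_description _ (HL t))).
  destruct (compactness_value_1d 0 (2 * PI) delta) as [d Hd].
  exists d; split; [apply cond_pos|]; intros r Hr Hrd Hc.
  unfold circmean; rewrite <- CInt_minus by (apply cont_circ; assumption).
  replace eps with ((2 * PI - 0) * e) by (unfold e; field; lra).
  apply CInt_bound_le; [lra| |].
  - intros t Ht; refine (clim_minus _ _ _ _ _ _ _); eapply cont_circ; eassumption.
  - intros t Ht; apply Rnot_lt_le; intros Hlt; apply (Hd t Ht); intros [x [_ [Hx Hdx]]].
    unfold delta in *; destruct (constructive_indefinite_description _ (HL x)) as [dx Kx]; simpl in *.
    pose proof (Kx r t ltac:(lra) Hx) as A1.
    pose proof (Kx rho t) as A2; rewrite Rminus_diag, Rabs_R0 in A2.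
    specialize (A2 (cond_pos dx) Hx).
    pose proof (Cmod_tri3 (f (c + circ r t)%C) (f (c + circ rho x)%C) (f (c + circ rho t)%C)) as A3.
    rewrite (Cmod_sym (f (c + circ rho x)%C)) in A3; lra.
Qed.

Lemma circmean_center f c : cts f c -> forall eps, 0 < eps -> exists d, 0 < d /\
  forall r, 0 < r < d -> cts_circ f c r -> Cmod (circmean f c r - RtoC (2 * PI) * f c) <= eps.
Proof.
  intros H eps He; pose proof PI_RGT_0.
  destruct (proj1 (cts_eps _ _) H (eps / (2 * PI)) ltac:(apply Rdiv_lt_0_compat; lra)) as [d [Hd K]].
  exists d; split; [exact Hd|]; intros r Hr Hc.
  assert (Hk := cts_circ_const (f c) c r).
  rewrite <- (circmean_const (f c) c r), <- circmean_minus by (lra || assumption).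
  replace eps with (2 * PI * (eps / (2 * PI))) by (field; lra).
  apply circmean_bound; [lra|apply cts_circ_minus; assumption|].
  intros z Hz; left; apply K; unfold disc; lra.
Qed.

(** One exceptional radius is harmless, by continuity. *)
Lemma circmean_annulus_except f c r1 r2 rho : 0 < r1 -> r1 <= r2 ->
  (forall z, r1 <= Cmod (z - c) <= r2 -> cts f z) ->
  (forall z, r1 <= Cmod (z - c) <= r2 -> Cmod (z - c) <> rho -> der f z) -> circmean f c r1 = circmean f c r2.
Proof.
  intros H1 H2 HC HD.
  destruct (Rlt_dec rho r1) as [a|a]; [apply circmean_annulus; auto; intros z Hz; apply HD; [exact Hz|lra]|].
  destruct (Rlt_dec r2 rho) as [b|b]; [apply circmean_annulus; auto; intros z Hz; apply HD; [exact Hz|lra]|].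
  assert (HCr : forall r, r1 <= r <= r2 -> cts_circ f c r) by (intros r Hr z Hz; apply HC; lra).
  assert (K : forall r, r1 <= r <= r2 -> circmean f c r = circmean f c rho).
  { intros r Hr; apply Cminus_eq, Cmod_small; intros eps He.
    destruct (Req_dec r rho) as [->|Hne]; [rewrite Cmod_self; lra|].
    destruct (circmean_cts f c rho ltac:(lra) (HCr rho ltac:(lra)) eps He) as [d [Hd Kd]].
    destruct (Rlt_dec r rho) as [L|L].
    - pose (s := Rmax r (rho - d / 2)).
      assert (Hs : r <= s < rho /\ rho - d < s) by (unfold s, Rmax; destruct Rle_dec; lra).
      rewrite (circmean_annulus f c r s); [|lra|lra|intros z Hz; apply HD; lra].
      apply Kd; [lra|apply Rabs_def1; lra|apply HCr; lra].
    - pose (s := Rmin r (rho + d / 2)).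
      assert (Hs : rho < s <= r /\ s < rho + d) by (unfold s, Rmin; destruct Rle_dec; lra).
      rewrite <- (circmean_annulus f c s r); [|lra|lra|intros z Hz; apply HD; lra].
      apply Kd; [lra|apply Rabs_def1; lra|apply HCr; lra]. }
  rewrite (K r1), (K r2) by lra; reflexivity.
Qed.

(** Constant in [r > |w - c|], hence equal to its limit for large [r]. *)
Lemma circmean_kernel c w r : Cmod (w - c) < r ->
  circmean (fun z => (z - c) / (z - w))%C c r = RtoC (2 * PI).
Proof.
  intros Hw; pose proof PI_RGT_0; pose proof (Cmod_ge_0 (w - c)).
  set (m := Cmod (w - c)) in *.
  assert (Hfar : forall z, m < Cmod (z - c) -> z <> w) by (intros z Hz ->; unfold m in Hz; lra).
  assert (HD : forall z, m < Cmod (z - c) -> der (fun z => (z - c) / (z - w))%C z).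
  { intros z Hz; apply (der_div (fun z => z - c)%C (fun z => z - w)%C); [apply Cminus_nz, Hfar, Hz| |];
      apply der_sub. }
  apply Cminus_eq, Cmod_small; intros eps He.
  (* on this radius the kernel differs from 1 by at most [eps / (2 * PI)] *)
  set (s := Rmax r (m + 2 * PI * (m + 1) / eps)).
  assert (Hq : 0 < 2 * PI * (m + 1) / eps) by (apply Rdiv_lt_0_compat; nra).
  assert (Hs : r <= s /\ m + 2 * PI * (m + 1) / eps <= s) by (split; [apply Rmax_l|apply Rmax_r]).
  rewrite (circmean_annulus _ c r s) by (try lra; intros z Hz; apply HD; lra).
  assert (HC : cts_circ (fun z => (z - c) / (z - w))%C c s)
    by (intros z Hz; apply (der_cts (fun z => (z - c) / (z - w))%C), HD; lra).
  assert (Hk := cts_circ_const 1 c s).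
  replace (RtoC (2 * PI)) with (circmean (fun _ => RtoC 1) c s) by (rewrite circmean_const; ring).
  rewrite <- circmean_minus by (lra || assumption).
  replace eps with (2 * PI * (eps / (2 * PI))) by (field; lra).
  apply circmean_bound; [lra|apply cts_circ_minus; assumption|].
  - intros z Hz; assert (Hzw : z <> w) by (apply Hfar; lra).
    replace ((z - c) / (z - w) - 1)%C with ((w - c) / (z - w))%C by (field; apply Cminus_nz, Hzw).
    rewrite Cmod_div by (apply Cminus_nz, Hzw); fold m.
    pose proof (Cmod_tri3 z w c) as T; fold m in T.
    assert (B : 2 * PI * (m + 1) / eps <= Cmod (z - w)) by lra.
    apply Rle_div_l; [apply Rlt_le_trans with (2 * PI * (m + 1) / eps); lra|].
    apply Rle_trans with (eps / (2 * PI) * (2 * PI * (m + 1) / eps)).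
    + replace (eps / (2 * PI) * (2 * PI * (m + 1) / eps)) with (m + 1) by (field; lra); lra.
    + apply Rmult_le_compat_l; [left; apply Rdiv_lt_0_compat; lra|exact B].
Qed.

Lemma cts_kernel c r w : Cmod (w - c) < r -> cts_circ (fun z => (z - c) / (z - w))%C c r.
Proof.
  intros Hw z Hz; apply (der_cts (fun z => (z - c) / (z - w))%C), (der_div (fun z => z - c)%C (fun z => z - w)%C);
    [apply Cminus_nz; intros ->; lra|apply der_sub|apply der_sub].
Qed.

Definition hol (c : C) (r : R) (f : C -> C) : Prop := forall z, disc c r z -> der f z.

(** The difference quotient of [f] at [w] times [z - c] is holomorphic but for
    the point [w] and vanishes at [c]; so its means vanish. *)
Theorem cauchy_formula f c R0 r w : hol c R0 f -> Cmod (w - c) < r -> r < R0 ->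
  circmean (fun z => f z * ((z - c) / (z - w)))%C c r = (RtoC (2 * PI) * f w)%C.
Proof.
  intros H Hw Hr; pose proof (Cmod_ge_0 (w - c)).
  assert (Dw : der f w) by (apply H; unfold disc; lra).
  destruct (proj1 (isd_slope _ _ _) Dw) as [K [K1 [K2 K3]]].
  pose (k := fun z => (K z * (z - c))%C).
  assert (DK : forall z, disc c R0 z -> z <> w -> der K z).
  { intros z Hz Hne; apply der_ext_loc with (fun z => (f z - f w) / (z - w))%C.
    - apply locally_disc; exists (Cmod (z - w)); split; [apply Cmod_pos, Hne|]; intros y Hy.
      assert (Hyw : y <> w) by (intros ->; unfold disc in Hy; rewrite Cmod_sym in Hy; lra).
      rewrite (K3 y); field; apply Cminus_nz, Hyw.
    - apply der_div; [apply Cminus_nz, Hne| |]; apply der_minus;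
        (apply H, Hz || apply der_const || apply der_id). }
  assert (CK : forall z, disc c R0 z -> cts K z).
  { intros z Hz; destruct (classic (z = w)) as [->|Hne]; [rewrite K2; exact K1|apply der_cts, DK; assumption]. }
  assert (Cid : forall z : C, cts (fun z => z - c)%C z) by (intros z; apply (der_cts (fun z => z - c)%C), der_minus; [apply der_id|apply der_const]).
  assert (Ck : forall z, disc c R0 z -> cts k z) by (intros z Hz; refine (clim_mult _ _ _ _ _ _ _); [apply CK, Hz|apply Cid]).
  assert (Dk : forall z, disc c R0 z -> z <> w -> der k z).
  { intros z Hz Hne; apply der_mult; [apply DK; assumption|apply der_sub]. }
  assert (Zero : circmean k c r = 0).
  { apply Cmod_small; intros eps He.
    destruct (circmean_center k c (Ck c ltac:(apply disc_center; lra)) eps He) as [d [Hd L]].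
    pose (s := Rmin r (d / 2)).
    assert (Hs : 0 < s <= r /\ s < d) by (unfold s, Rmin; destruct Rle_dec; lra).
    rewrite <- (circmean_annulus_except k c s r (Cmod (w - c))); [|lra|lra| |].
    - specialize (L s ltac:(lra)).
      replace (circmean k c s) with (circmean k c s - RtoC (2 * PI) * k c)%C by (unfold k; ring).
      apply L; intros z Hz; apply Ck; unfold disc; lra.
    - intros z Hz; apply Ck; unfold disc; lra.
    - intros z Hz Hne; apply Dk; [unfold disc; lra|intros ->; apply Hne; reflexivity]. }
  assert (Hfar : forall z, Cmod (z - c) = r -> z <> w) by (intros z Hz ->; lra).
  assert (Cker := cts_kernel c r w Hw).
  assert (Hrp : 0 < r) by lra.
  assert (E : circmean k c r = (circmean (fun z => f z * ((z - c) / (z - w))) c r -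
    circmean (fun z => f w * ((z - c) / (z - w))) c r)%C).
  { rewrite <- circmean_minus; [|exact Hrp| |].
    - apply circmean_ext; [exact Hrp|]; intros z Hz; unfold k; rewrite (K3 z); field; apply Cminus_nz, Hfar, Hz.
    - apply cts_circ_mult; [|exact Cker]; intros z Hz; apply der_cts, H; unfold disc; lra.
    - apply cts_circ_mult; [apply cts_circ_const|exact Cker]. }
  rewrite circmean_scal, circmean_kernel in E by assumption.
  rewrite Zero in E; symmetry in E; apply Cminus_eq in E; rewrite E; ring.
Qed.

Lemma hol_circ c R0 r f : hol c R0 f -> r < R0 -> cts_circ f c r.
Proof. intros H Hr z Hz; apply der_cts, H; unfold disc; lra. Qed.

(** A weak form of the maximum principle: the kernel of Cauchy's formula has
    modulus at most [r / (r - |w - c|)] on the circle. *)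
Lemma cauchy_bound f c R0 r w M : hol c R0 f -> Cmod (w - c) < r -> r < R0 ->
  (forall t, 0 <= t <= 2 * PI -> Cmod (f (c + circ r t)%C) <= M) -> Cmod (f w) <= M * (r / (r - Cmod (w - c))).
Proof.
  intros H Hw Hr HM; pose proof PI_RGT_0; pose proof (Cmod_ge_0 (w - c)).
  assert (B : Cmod (RtoC (2 * PI) * f w) <= (2 * PI - 0) * (M * (r / (r - Cmod (w - c))))).
  { rewrite <- (cauchy_formula f c R0 r w H Hw Hr); apply CInt_bound_le; [lra| |].
    - apply (cont_circ (fun z => f z * ((z - c) / (z - w)))%C c r 0 (2 * PI) ltac:(lra)).
      apply cts_circ_mult; [eapply hol_circ; eassumption|apply cts_kernel, Hw].
    - intros u Hu; specialize (HM u Hu); set (z := (c + circ r u)%C) in *.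
      assert (Hz : Cmod (z - c) = r) by (unfold z; rewrite add_sub; apply Cmod_circ; lra).
      assert (Hne : z <> w) by (intros E; rewrite E in Hz; lra).
      rewrite Cmod_mult, Cmod_div, Hz by (apply Cminus_nz, Hne).
      apply Rmult_le_compat; [apply Cmod_ge_0|apply Rle_mult_inv_pos; [lra|apply Cmod_pos, Hne]|exact HM|].
      apply Rmult_le_compat_l; [lra|]; apply Rinv_le_contravar; [lra|pose proof (Cmod_tri3 z w c); lra]. }
  rewrite Cmod_mult, Cmod_R, Rabs_pos_eq, Rminus_0_r in B by lra; apply Rmult_le_reg_l in B; lra.
Qed.

(** * Consequences of Cauchy's formula *)

Lemma hol_sub c r c' r' f : (forall z, disc c' r' z -> disc c r z) -> hol c r f -> hol c' r' f.
Proof. intros H Hf z Hz; apply Hf, H, Hz. Qed.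

Lemma hol_le c r s f : s <= r -> hol c r f -> hol c s f.
Proof. intros H; apply hol_sub; intros z; apply disc_le, H. Qed.

Lemma hol_ext c r f g : (forall z, disc c r z -> f z = g z) -> hol c r f -> hol c r g.
Proof.
  intros E H z Hz; apply der_ext_loc with f; [|apply H, Hz].
  generalize (disc_open c r z Hz); apply filter_imp; exact E.
Qed.

Lemma C_derive_ext c r f g z : disc c r z -> (forall z, disc c r z -> f z = g z) -> hol c r f ->
  C_derive g z = C_derive f z.
Proof.
  intros Hz E H; apply C_derive_ext_loc; [|apply H, Hz].
  generalize (disc_open c r z Hz); apply filter_imp; exact E.
Qed.

Lemma circ_bounded f c r : 0 < r -> cts_circ f c r ->
  exists M, 0 < M /\ forall t, 0 <= t <= 2 * PI -> Cmod (f (c + circ r t)%C) <= M.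
Proof.
  intros Hr H; pose proof PI_RGT_0.
  destruct (continuity_ab_maj (fun t => Cmod (f (c + circ r t)%C)) 0 (2 * PI) ltac:(lra)) as [t0 [Ht0 _]].
  - intros t _; apply continuity_pt_filterlim; intros P [e He].
    assert (L := cont_circ f c r t t Hr H t ltac:(rewrite Rmin_left, Rmax_left; lra) e (cond_pos e)).
    unfold filtermap; generalize L; apply filter_imp; intros s Hs; apply He.
    unfold ball; simpl; unfold AbsRing_ball, abs, minus, plus, opp; simpl.
    eapply Rle_lt_trans; [|exact Hs]; apply Rabs_le.
    pose proof (Cmod_ge_sub (f (c + circ r s)%C) (f (c + circ r t)%C)).
    pose proof (Cmod_ge_sub (f (c + circ r t)%C) (f (c + circ r s)%C)) as H'; rewrite Cmod_sym in H'; lra.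
  - exists (1 + Cmod (f (c + circ r t0)%C)); split; [pose proof (Cmod_ge_0 (f (c + circ r t0)%C)); lra|].
    intros t Ht; specialize (Ht0 t Ht); simpl in Ht0; lra.
Qed.

(** Differentiation under the integral sign, by the explicit remainder
    [(v - w)^2 / ((z - w)^2 (z - v))] of the expansion of [1 / (z - v)] at
    [w]. *)
Lemma der_cauchy_type phi c r w : cts_circ phi c r -> Cmod (w - c) < r ->
  der (fun w => circmean (fun z => phi z * ((z - c) / (z - w)))%C c r) w.
Proof.
  intros Hc Hw; pose proof PI_RGT_0; pose proof (Cmod_ge_0 (w - c)).
  assert (Hr : 0 < r) by lra.
  destruct (circ_bounded phi c r Hr Hc) as [M [HM0 HM]].
  set (d := r - Cmod (w - c)); assert (Hd : 0 < d) by (unfold d; lra).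
  assert (Far : forall z, Cmod (z - c) = r -> d <= Cmod (z - w)).
  { intros z Hz; pose proof (Cmod_tri3 z w c); unfold d; lra. }
  assert (Hne : forall z, Cmod (z - c) = r -> z <> w) by (intros z Hz ->; lra).
  assert (Cphi : forall v, Cmod (v - c) < r -> cts_circ (fun z => phi z * ((z - c) / (z - v)))%C c r).
  { intros v Hv; apply cts_circ_mult; [exact Hc|apply cts_kernel, Hv]. }
  assert (C1 : cts_circ (fun z => phi z * ((z - c) / (z - w)) * (/ (z - w)))%C c r).
  { apply cts_circ_mult; [exact (Cphi w Hw)|]; intros z Hz.
    apply (der_cts (fun z => / (z - w))%C), (der_inv (fun z => z - w)%C); [apply Cminus_nz, Hne, Hz|].
    apply der_sub. }
  set (T1 := circmean (fun z => phi z * ((z - c) / (z - w)) * (/ (z - w)))%C c r).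
  apply isd_der with T1; intros eps He.
  set (B := 2 * PI * (M * r / (d * d * (d / 2)))).
  assert (HB : 0 < B).
  { assert (0 < d * d * (d / 2)) by (repeat apply Rmult_lt_0_compat; lra).
    unfold B; apply Rmult_lt_0_compat; [lra|apply Rdiv_lt_0_compat; nra]. }
  assert (Hm : 0 < Rmin (d / 2) (eps / B)) by (pos).
  exists (Rmin (d / 2) (eps / B)); split; [exact Hm|]; intros v Hv; unfold disc in Hv.
  pose proof (Rmin_l (d / 2) (eps / B)); pose proof (Rmin_r (d / 2) (eps / B)).
  assert (Hvr : Cmod (v - c) < r) by (pose proof (Cmod_tri3 v w c); unfold d in *; lra).
  assert (Farv : forall z, Cmod (z - c) = r -> d / 2 <= Cmod (z - v)).
  { intros z Hz; pose proof (Far z Hz); pose proof (Cmod_tri3 z v w); lra. }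
  rewrite <- circmean_minus by (try apply Cphi; assumption).
  unfold T1; rewrite (Cmult_comm _ (v - w)), <- circmean_scal by assumption.
  assert (C2 := cts_circ_minus _ _ _ _ (Cphi v Hvr) (Cphi w Hw)).
  assert (C3 := cts_circ_mult _ _ _ _ (cts_circ_const (v - w) c r) C1).
  rewrite <- circmean_minus by assumption.
  apply Rle_trans with (B * Cmod (v - w) * Cmod (v - w)).
  2:{ apply Rmult_le_compat_r; [apply Cmod_ge_0|].
      apply Rle_trans with (B * (eps / B)); [apply Rmult_le_compat_l; lra|right; field; lra]. }
  unfold circmean.
  replace (B * Cmod (v - w) * Cmod (v - w))
    with ((2 * PI - 0) * (M * (r * (Cmod (v - w) * Cmod (v - w)) / (d * d * (d / 2))))) by (unfold B; field; lra).
  apply CInt_bound_le; [lra| |].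
  - exact (cont_circ _ c r 0 (2 * PI) Hr (cts_circ_minus _ _ _ _ C2 C3)).
  - intros t Ht; set (z := (c + circ r t)%C).
    assert (Hz : Cmod (z - c) = r) by (unfold z; rewrite add_sub; apply Cmod_circ, Hr).
    assert (z <> w) by (apply Hne, Hz).
    assert (z <> v) by (intros E; pose proof (Farv z Hz) as K; rewrite E, Cmod_self in K; lra).
    assert (Nw := Cminus_nz z w ltac:(assumption)); assert (Nv := Cminus_nz z v ltac:(assumption)).
    replace (phi z * ((z - c) / (z - v)) - phi z * ((z - c) / (z - w)) - (v - w) * (phi z * ((z - c) / (z - w)) * / (z - w)))%C
      with (phi z * ((z - c) * ((v - w) * (v - w)) / ((z - w) * (z - w) * (z - v))))%C by (field; auto).
    rewrite Cmod_mult, Cmod_div, !Cmod_mult, Hz by (repeat apply Cmult_neq_0; assumption).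
    pose proof (Far z Hz); pose proof (Farv z Hz); pose proof (Cmod_ge_0 (v - w)).
    apply Rmult_le_compat; [apply Cmod_ge_0| |apply HM, Ht|].
    + apply Rle_mult_inv_pos; [repeat apply Rmult_le_pos; lra|repeat apply Rmult_lt_0_compat; lra].
    + apply Rmult_le_compat_l; [repeat apply Rmult_le_pos; lra|].
      apply Rinv_le_contravar; [repeat apply Rmult_lt_0_compat; lra|].
      apply Rmult_le_compat; [nra|lra|apply Rmult_le_compat; lra|lra].
Qed.

Lemma two_pi_nz : RtoC (2 * PI) <> 0.
Proof. pose proof PI_RGT_0; intros E; apply RtoC_inj in E; lra. Qed.

Lemma hol_of_formula f c r : cts_circ f c r ->
  (forall w, disc c r w -> circmean (fun z => f z * ((z - c) / (z - w)))%C c r = (RtoC (2 * PI) * f w)%C) ->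
  hol c r f.
Proof.
  intros Hc HF.
  apply hol_ext with (fun w => / RtoC (2 * PI) * circmean (fun z => f z * ((z - c) / (z - w)))%C c r)%C.
  - intros w Hw; rewrite HF by exact Hw; field; exact two_pi_nz.
  - intros w Hw; apply der_mult; [apply der_const|apply (der_cauchy_type f c r w Hc Hw)].
Qed.

Definition unif_conv (c : C) (r : R) (F : nat -> C -> C) (f : C -> C) : Prop :=
  forall eps, 0 < eps -> exists N, forall n, (N <= n)%nat -> forall z, disc c r z -> Cmod (F n z - f z) < eps.

Definition ev_hol (c : C) (r : R) (F : nat -> C -> C) : Prop :=
  exists N, forall n, (N <= n)%nat -> hol c r (F n).

(** Weierstrass: Cauchy's formula passes to the limit, and implies
    holomorphy. *)
Theorem hol_limit c r F f : ev_hol c r F -> unif_conv c r F f -> hol c r f.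
Proof.
  intros [N0 HN0] HU z Hz; pose proof PI_RGT_0; pose proof (Cmod_ge_0 (z - c)).
  assert (Cf : forall z, disc c r z -> cts f z).
  { intros w Hw; apply cts_eps; intros e He.
    destruct (HU (e / 3) ltac:(lra)) as [N HN].
    set (n := Nat.max N N0); specialize (HN n ltac:(lia)).
    destruct (proj1 (cts_eps _ _) (der_cts _ _ (HN0 n ltac:(lia) w Hw)) (e / 3) ltac:(lra)) as [d [Hd K]].
    destruct (disc_sub c r w Hw) as [s [Hs Sub]].
    exists (Rmin d s); split; [pos|]; intros v Hv.
    assert (Hv1 := K v (disc_minl Hv)).
    assert (Hv2 := HN v ltac:(apply Sub; exact (disc_minr Hv))).
    specialize (HN w Hw).
    pose proof (Cmod_tri3 (f v) (F n v) (f w)) as T1; pose proof (Cmod_tri3 (F n v) (F n w) (f w)) as T2.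
    rewrite (Cmod_sym (f v) (F n v)) in T1; lra. }
  set (s := (Cmod (z - c) + r) / 2).
  assert (Hs : Cmod (z - c) < s < r) by (unfold disc, s in *; lra).
  assert (Hs0 : 0 < s) by lra.
  assert (Hc : cts_circ f c s) by (intros w Hw; apply Cf; unfold disc; lra).
  apply (hol_of_formula f c s Hc); [|unfold disc; lra].
  intros w Hw; unfold disc in Hw; apply Cminus_eq, Cmod_small; intros eps He.
  set (d := s - Cmod (w - c)); assert (Hd : 0 < d) by (unfold d; lra).
  set (b := 2 * PI * (s / d) + 2 * PI).
  assert (Hsd : 0 < s / d) by (apply Rdiv_lt_0_compat; lra).
  assert (Hb : 0 < b) by (unfold b; apply Rplus_lt_0_compat; [apply Rmult_lt_0_compat|]; lra).
  set (e := eps / b); assert (Heb : 0 < e) by (apply Rdiv_lt_0_compat; lra).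
  destruct (HU e Heb) as [N HN]; set (n := Nat.max N N0); specialize (HN n ltac:(lia)).
  assert (Hol := HN0 n ltac:(lia)).
  pose proof (cauchy_formula (F n) c r s w Hol Hw ltac:(lra)) as CF.
  assert (Ck : forall g, cts_circ g c s -> cts_circ (fun z => g z * ((z - c) / (z - w)))%C c s).
  { intros g Hg; apply cts_circ_mult; [exact Hg|apply cts_kernel, Hw]. }
  assert (HcF : cts_circ (F n) c s) by (eapply hol_circ; [exact Hol|lra]).
  assert (E1 : Cmod (circmean (fun z => f z * ((z - c) / (z - w)))%C c s - circmean (fun z => F n z * ((z - c) / (z - w)))%C c s) <= 2 * PI * (e * (s / d))).
  { rewrite <- circmean_minus by (try apply Ck; assumption).
    apply circmean_bound; [exact Hs0|apply cts_circ_minus; apply Ck; assumption|].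
    - intros x Hx; assert (Hne : x <> w) by (intros ->; lra).
      replace (f x * ((x - c) / (x - w)) - F n x * ((x - c) / (x - w)))%C with ((f x - F n x) * ((x - c) / (x - w)))%C
        by (field; apply Cminus_nz, Hne).
      rewrite Cmod_mult, Cmod_div, Hx, Cmod_sym by (apply Cminus_nz, Hne).
      apply Rmult_le_compat; [apply Cmod_ge_0| |left; apply HN; unfold disc; lra|].
      + apply Rle_mult_inv_pos; [lra|apply Cmod_pos, Hne].
      + apply Rmult_le_compat_l; [lra|]; apply Rinv_le_contravar; [exact Hd|].
        pose proof (Cmod_tri3 x w c); unfold d; lra. }
  rewrite CF in E1.
  replace (circmean (fun z => f z * ((z - c) / (z - w)))%C c s - RtoC (2 * PI) * f w)%C
    with ((circmean (fun z => f z * ((z - c) / (z - w)))%C c s - RtoC (2 * PI) * F n w) + RtoC (2 * PI) * (F n w - f w))%C by ring.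
  eapply Rle_trans; [apply Cmod_triangle|].
  rewrite (Cmod_mult (RtoC (2 * PI))), Cmod_R, Rabs_pos_eq by lra.
  assert (Hwn := HN w ltac:(unfold disc; lra)).
  assert (2 * PI * Cmod (F n w - f w) <= 2 * PI * e) by (apply Rmult_le_compat_l; lra).
  replace eps with (e * b) by (unfold e; field; lra); unfold b; lra.
Qed.

Lemma hol_bounded f c r s : hol c r f -> s < r -> exists M, 0 < M /\ forall z, disc c s z -> Cmod (f z) <= M.
Proof.
  intros H Hs; destruct (Rle_dec s 0) as [L|L].
  { exists 1; split; [lra|]; intros z Hz; unfold disc in Hz; pose proof (Cmod_ge_0 (z - c)); lra. }
  set (t := (s + r) / 2); assert (Ht : s < t < r) by (unfold t; lra).
  destruct (circ_bounded f c t ltac:(lra)) as [M [HM0 HM]]; [eapply hol_circ; [exact H|lra]|].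
  exists (M * (t / (t - s))); split; [apply Rmult_lt_0_compat; pos|]; intros w Hw; unfold disc in Hw.
  eapply Rle_trans; [apply (cauchy_bound f c r t w M H); (lra || exact HM)|].
  apply Rmult_le_compat_l; [lra|]; apply Rmult_le_compat_l; [lra|]; apply Rinv_le_contravar; lra.
Qed.

(** Dividing out a zero. That this quotient is holomorphic at [c] as well is
    the source of higher derivatives, orders of zeros and removable
    singularities. *)
Definition slope (f : C -> C) (c z : C) : C :=
  if excluded_middle_informative (z = c) then C_derive f c else ((f z - f c) / (z - c))%C.

Lemma slope_eq f c z : f z = (f c + (z - c) * slope f c z)%C.
Proof.
  unfold slope; destruct excluded_middle_informative as [->|E]; [ring|field; apply Cminus_nz, E].
Qed.

Lemma slope_center f c : slope f c c = C_derive f c.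
Proof. unfold slope; destruct excluded_middle_informative as [_|E]; [reflexivity|now elim E]. Qed.

(** At [c] the quotient is a Cauchy type integral: subtract the formulas for
    [f w] and [f c] and use [1 / (z - w) - 1 / (z - c) = (w - c) / ((z - w) (z
    - c))]. *)
Lemma hol_slope f c r : hol c r f -> hol c r (slope f c).
Proof.
  intros H z Hz; destruct (classic (z = c)) as [->|Hne].
  2:{ apply der_ext_loc with (fun z => (f z - f c) / (z - c))%C.
      - generalize (punctured_open c r z Hz Hne); apply filter_imp; intros w [_ Hw].
        unfold slope; destruct excluded_middle_informative as [E|_]; [elim Hw; exact E|reflexivity].
      - apply der_div; [apply Cminus_nz, Hne| |]; apply der_minus;
          (apply H, Hz || apply der_const || apply der_id). }
  assert (Hr : 0 < r) by (unfold disc in Hz; rewrite Cmod_self in Hz; exact Hz).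
  set (s := r / 2); assert (Hs : 0 < s < r) by (unfold s; lra).
  pose (g := fun w => (/ RtoC (2 * PI) * circmean (fun z => f z / (z - c) * ((z - c) / (z - w)))%C c s)%C).
  assert (Hc : cts_circ f c s) by (eapply hol_circ; [exact H|lra]).
  assert (Hc1 : cts_circ (fun z => f z / (z - c))%C c s).
  { intros z Hz'; apply (der_cts (fun z => f z / (z - c))%C), (der_div f (fun z => z - c)%C);
      [apply Cminus_nz; intros ->; rewrite Cmod_self in Hz'; lra|apply H; unfold disc; lra|].
    apply der_sub. }
  assert (Hg : hol c s g).
  { intros w Hw; apply der_mult; [apply der_const|].
    apply (der_cauchy_type (fun z => f z / (z - c))%C c s w Hc1 Hw). }
  assert (Eg : forall w, disc c s w -> f w = (f c + (w - c) * g w)%C).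
  { intros w Hw; unfold g.
    assert (Hcc : Cmod (c - c) < s) by (rewrite Cmod_self; lra).
    pose proof (cauchy_formula f c r s w H Hw ltac:(lra)) as A1.
    pose proof (cauchy_formula f c r s c H Hcc ltac:(lra)) as A2.
    assert (Ck : forall g v, cts_circ g c s -> Cmod (v - c) < s -> cts_circ (fun z => g z * ((z - c) / (z - v)))%C c s).
    { intros k v Hk Hv; apply cts_circ_mult; [exact Hk|apply cts_kernel, Hv]. }
    assert (E : ((w - c) * circmean (fun z => f z / (z - c) * ((z - c) / (z - w)))%C c s)%C = (RtoC (2 * PI) * f w - RtoC (2 * PI) * f c)%C).
    { rewrite <- A1, <- A2, <- circmean_scal, <- circmean_minus; try apply Ck; try assumption; try lra.
      apply circmean_ext; [lra|]; intros x Hx.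
      field; split; apply Cminus_nz; intros ->; [rewrite Cmod_self in Hx; lra|unfold disc in Hw; lra]. }
    replace ((w - c) * (/ RtoC (2 * PI) * circmean (fun z => f z / (z - c) * ((z - c) / (z - w)))%C c s))%C
      with (/ RtoC (2 * PI) * ((w - c) * circmean (fun z => f z / (z - c) * ((z - c) / (z - w)))%C c s))%C by ring.
    rewrite E; field; exact two_pi_nz. }
  assert (Gc : g c = C_derive f c).
  { symmetry; apply isd_C_derive.
    assert (I : isd (fun w => f c + (w - c) * g w)%C c (g c)).
    { apply isd_slope; exists g; split; [apply der_cts, Hg, disc_center; lra|split; [reflexivity|]].
      intros w; ring. }
    refine (isd_ext_loc _ _ _ _ _ I); apply locally_disc; exists s; split; [lra|].
    intros w Hw; symmetry; apply Eg, Hw. }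
  apply der_ext_loc with g; [|apply Hg, disc_center; lra].
  apply locally_disc; exists s; split; [lra|]; intros w Hw.
  unfold slope; destruct excluded_middle_informative as [->|E]; [exact Gc|].
  rewrite (Eg w Hw); field; apply Cminus_nz, E.
Qed.

(** The value at [c] of the slope function, which is at most [2 M / s] on the
    circle of radius [s < r]. The factor 2 comes from the difference
    [f z - f c]. *)
Lemma cauchy_estimate f c r M : 0 < r -> hol c r f -> (forall z, disc c r z -> Cmod (f z) <= M) ->
  Cmod (C_derive f c) <= 2 * M / r.
Proof.
  intros Hr H HM.
  assert (K : forall s, 0 < s < r -> Cmod (C_derive f c) <= 2 * M / s).
  { intros s Hs; rewrite <- (slope_center f c); replace (2 * M / s) with (2 * M / s * (s / (s - Cmod (c - c)))) by (rewrite Cmod_self; field; lra).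
    apply (cauchy_bound (slope f c) c r); [apply hol_slope, H|rewrite Cmod_self; lra|lra|]; intros t _.
    assert (E : Cmod (c + circ s t - c) = s) by (rewrite add_sub; apply Cmod_circ; lra); set (z := (c + circ s t)%C) in *.
    assert (Hne : z <> c) by (intros Q; rewrite Q, Cmod_self in E; lra).
    unfold slope; destruct excluded_middle_informative as [Q|_]; [elim Hne; exact Q|].
    rewrite Cmod_div, E by (apply Cminus_nz, Hne); apply Rmult_le_compat_r; [left; apply Rinv_0_lt_compat; lra|].
    pose proof (Cmod_triangle (f z) (- f c)) as T; rewrite Cmod_opp in T.
    pose proof (HM z ltac:(unfold disc; lra)); pose proof (HM c (disc_center c r Hr)); unfold Cminus; lra. }
  pose proof (Cmod_ge_0 (C_derive f c)); apply Rnot_lt_le; intros L; apply Rlt_div_l in L; [|exact Hr].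
  set (d := Cmod (C_derive f c)) in *.
  assert (HM0 : 0 <= 2 * M) by (pose proof (HM c (disc_center c r Hr)); pose proof (Cmod_ge_0 (f c)); lra).
  assert (Hd : 0 < d) by nra.
  assert (Q : 2 * M / d < r) by (apply Rlt_div_l; lra); assert (0 <= 2 * M / d) by (apply Rle_mult_inv_pos; lra).
  specialize (K ((2 * M / d + r) / 2) ltac:(lra)); apply Rle_div_r in K; [|lra].
  assert (d * (2 * M / d) = 2 * M) by (field; lra); nra.
Qed.

Lemma isd_sub c z : isd (fun w => w - c)%C z 1.
Proof. replace (RtoC 1) with (1 + 0)%C by ring; apply isd_plus; [apply isd_id|apply isd_const]. Qed.

Lemma C_derive_slope f c r z : hol c r f -> disc c r z ->
  C_derive f z = (slope f c z + (z - c) * C_derive (slope f c) z)%C.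
Proof.
  intros H Hz; apply isd_C_derive.
  pose proof (isd_mult _ _ _ _ _ (isd_sub c z) (hol_slope f c r H z Hz)) as I.
  pose proof (isd_plus _ _ _ _ _ (isd_const (f c) z) I) as J; cbv beta in J.
  replace (slope f c z + (z - c) * C_derive (slope f c) z)%C
    with (0 + (1 * slope f c z + (z - c) * C_derive (slope f c) z))%C by ring.
  refine (isd_ext _ _ _ _ _ J); intros w; symmetry; apply slope_eq.
Qed.

(** From [f' = f1 + (z - c) f1'] for the slope [f1], as [f1'] is bounded near
    [c]. *)
Lemma derive_cts f c r : 0 < r -> hol c r f -> cts (C_derive f) c.
Proof.
  intros Hr H; set (f1 := slope f c); assert (H1 : hol c r f1) by (apply hol_slope, H).
  destruct (hol_bounded f1 c r (r / 2) H1 ltac:(lra)) as [M [HM0 HM]].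
  assert (Bd : forall z, disc c (r / 4) z -> Cmod (C_derive f1 z) <= 2 * M / (r / 4)).
  { intros z Hz; assert (Sub : forall w, disc z (r / 4) w -> disc c (r / 2) w).
    { intros w Hw; unfold disc in *; pose proof (Cmod_tri3 w z c); lra. }
    apply cauchy_estimate; [lra| |].
    - apply hol_sub with c r; [|exact H1]; intros w Hw; apply (disc_le c (r / 2) r); [lra|apply Sub, Hw].
    - intros w Hw; apply HM, Sub, Hw. }
  refine (clim_ext _ (fun z => f1 z + (z - c) * C_derive f1 z)%C _ _ _ _).
  - apply locally_disc; exists r; split; [exact Hr|]; intros w Hw; symmetry; apply C_derive_slope with r; assumption.
  - apply clim_eq with (f1 c + 0)%C; [|unfold f1; rewrite slope_center; ring].
    refine (clim_plus _ _ _ _ _ _ _); [apply der_cts, H1, disc_center, Hr|].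
    intros e He; apply locally_disc.
    set (B := 2 * M / (r / 4)) in *; assert (HB : 0 < B) by (apply Rdiv_lt_0_compat; lra).
    exists (Rmin (r / 4) (e / B)); split; [pos|].
    intros w Hw; replace ((w - c) * C_derive f1 w - 0)%C with ((w - c) * C_derive f1 w)%C by ring.
    rewrite Cmod_mult.
    assert (Bw := Bd w (disc_minl Hw)).
    assert (W : disc c (e / B) w) by exact (disc_minr Hw); unfold disc in W.
    apply Rle_lt_trans with (Cmod (w - c) * B).
    + apply Rmult_le_compat_l; [apply Cmod_ge_0|exact Bw].
    + apply Rlt_div_r in W; lra.
Qed.

(** The same identity, with [f1'] now known to be continuous, exhibits a slope
    of [f']. *)
Theorem hol_derive f c r : hol c r f -> hol c r (C_derive f).
Proof.
  intros H z Hz; destruct (disc_sub c r z Hz) as [s [Hs Sub]].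
  assert (Hf : hol z s f) by (intros w Hw; apply H, Sub, Hw).
  set (f1 := slope f z); assert (H1 : hol z s f1) by (apply hol_slope, Hf).
  apply der_ext_loc with (fun w => f1 w + (w - z) * C_derive f1 w)%C.
  - apply locally_disc; exists s; split; [exact Hs|]; intros w Hw; symmetry; apply C_derive_slope with s; assumption.
  - apply der_plus; [apply H1, disc_center, Hs|].
    apply isd_der with (C_derive f1 z), isd_slope; exists (C_derive f1).
    split; [apply derive_cts with s; assumption|split; [reflexivity|intros; ring]].
Qed.

Lemma hol_derive_n f c r n : hol c r f -> hol c r (C_derive_n n f).
Proof. intros H; induction n as [|n IH]; [exact H|apply (hol_derive (C_derive_n n f)), IH]. Qed.

Lemma hol_plus c r f g : hol c r f -> hol c r g -> hol c r (fun z => f z + g z)%C.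
Proof. intros A B z Hz; apply der_plus; auto. Qed.

Lemma hol_mult c r f g : hol c r f -> hol c r g -> hol c r (fun z => f z * g z)%C.
Proof. intros A B z Hz; apply der_mult; auto. Qed.

Lemma hol_const c r a : hol c r (fun _ => a).
Proof. intros z _; apply der_const. Qed.

Lemma hol_minus c r f g : hol c r f -> hol c r g -> hol c r (fun z => f z - g z)%C.
Proof. intros A B z Hz; apply der_minus; auto. Qed.

Lemma hol_sub_pow c r a n : hol c r (fun z => (z - a) ^ n)%C.
Proof. intros z _; apply (der_pow (fun z => z - a)%C), der_minus; [apply der_id|apply der_const]. Qed.

(** If [f = (z - c)^n g] then Cauchy's formula for [g] bounds [f] at [w] by a
    multiple of the [n]-th power of [|w - c| / s < 1]. *)
Lemma zero_of_infinite_order f c r : hol c r f ->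
  (forall n, exists g, hol c r g /\ forall z, disc c r z -> f z = ((z - c) ^ n * g z)%C) ->
  forall w, disc c r w -> f w = 0.
Proof.
  intros H HO w Hw; pose proof PI_RGT_0; pose proof (Cmod_ge_0 (w - c)) as Hge; unfold disc in Hw.
  set (s := (Cmod (w - c) + r) / 2); assert (Hs : Cmod (w - c) < s < r) by (unfold s; lra).
  assert (Hc : cts_circ f c s) by (eapply hol_circ; [exact H|lra]).
  destruct (circ_bounded f c s ltac:(lra) Hc) as [M [HM0 HM]].
  set (q := Cmod (w - c) / s).
  assert (Hq : 0 <= q < 1) by (unfold q; split; [apply Rle_mult_inv_pos; lra|apply Rlt_div_l; lra]).
  set (B := M * (s / (s - Cmod (w - c)))).
  assert (HB : 0 < B) by (unfold B; apply Rmult_lt_0_compat; [lra|apply Rdiv_lt_0_compat; lra]).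
  assert (K : forall n, Cmod (f w) <= q ^ n * B).
  { intros n; destruct (HO n) as [g [Hg E]].
    assert (Sn : 0 < s ^ n) by (apply pow_lt; lra).
    assert (L : Cmod (g w) <= M / s ^ n * (s / (s - Cmod (w - c)))).
    { apply (cauchy_bound g c r s w _ Hg); [lra|lra|]; intros u Hu; specialize (HM u Hu); set (z := (c + circ s u)%C) in *.
      assert (Hz : Cmod (z - c) = s) by (unfold z; rewrite add_sub; apply Cmod_circ; lra).
      rewrite (E z), Cmod_mult, Cmod_pow, Hz in HM by (unfold disc; lra); apply Rle_div_r; lra. }
    rewrite (E w), Cmod_mult, Cmod_pow by exact Hw.
    apply Rle_trans with (Cmod (w - c) ^ n * (M / s ^ n * (s / (s - Cmod (w - c))))).
    - apply Rmult_le_compat_l; [apply pow_le; lra|exact L].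
    - right; unfold q, B, Rdiv; rewrite Rpow_mult_distr, pow_inv; ring. }
  apply Cmod_small; intros e He.
  destruct (pow_lt_1_zero q ltac:(rewrite Rabs_pos_eq; lra) (e / B) ltac:(apply Rdiv_lt_0_compat; lra)) as [N HN].
  specialize (HN N (le_n N)); rewrite Rabs_pos_eq in HN by (apply pow_le; lra).
  apply Rlt_div_r in HN; [|lra]; specialize (K N); lra.
Qed.

(** Zeros are divided out one by one; [zero_of_infinite_order] excludes that
    this never ends. *)
Theorem zero_order f c r : 0 < r -> hol c r f ->
  (forall z, disc c r z -> f z = 0) \/
  exists n g, hol c r g /\ g c <> 0 /\ forall z, disc c r z -> f z = ((z - c) ^ n * g z)%C.
Proof.
  intros Hr H; destruct (classic (exists n g, hol c r g /\ g c <> 0 /\ forall z, disc c r z -> f z = ((z - c) ^ n * g z)%C))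
    as [K|K]; [right; exact K|left].
  apply zero_of_infinite_order; [exact H|].
  induction n as [|n [g [Hg E]]]; [exists f; split; [exact H|intros; simpl; ring]|].
  assert (G0 : g c = 0) by (apply NNPP; intros N; apply K; exists n, g; auto).
  exists (slope g c); split; [apply hol_slope, Hg|].
  intros z Hz; rewrite (E z Hz), (slope_eq g c z), G0; simpl; ring.
Qed.

Lemma nonzero_near f c : cts f c -> f c <> RtoC 0 -> exists r, 0 < r /\ forall z, disc c r z -> f z <> 0.
Proof.
  intros H Hc; destruct (proj1 (cts_eps _ _) H (Cmod (f c)) ltac:(apply Cmod_gt_0, Hc)) as [d [Hd K]].
  exists d; split; [exact Hd|]; intros z Hz E; specialize (K z Hz); rewrite E, Cmod_sym in K.
  replace (f c - 0)%C with (f c) in K by ring; lra.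
Qed.

Lemma isolated_zero f c r : 0 < r -> hol c r f ->
  (forall z, disc c r z -> f z = 0) \/ exists s, 0 < s <= r /\ forall z, disc c s z -> z <> c -> f z <> 0.
Proof.
  intros Hr H; destruct (zero_order f c r Hr H) as [K|[n [g [Hg [Hgc E]]]]]; [left; exact K|right].
  destruct (nonzero_near g c) as [s [Hs Hn]]; [apply der_cts, Hg, disc_center, Hr|exact Hgc|].
  exists (Rmin r s); split; [split; [pos|apply Rmin_l]|].
  intros z Hz Hne; rewrite E by exact (disc_minl Hz).
  apply Cmult_neq_0; [apply Cpow_nz, Cminus_nz, Hne|apply Hn; exact (disc_minr Hz)].
Qed.

(** Riemann: [(z - c)^2 f] is differentiable at [c], with a double zero. *)
Lemma removable f c r : (forall z, disc c r z -> z <> c -> der f z) -> cts f c -> hol c r f.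
Proof.
  intros H Hc z Hz; destruct (classic (z = c)) as [->|Hne]; [|apply H; assumption].
  assert (Hr : 0 < r) by (unfold disc in Hz; rewrite Cmod_self in Hz; exact Hz).
  pose (k := fun z => ((z - c) * ((z - c) * f z))%C).
  assert (Hsub : forall z, der (fun z => z - c)%C z) by (intros y; apply der_sub).
  assert (Dc : isd k c 0).
  { apply isd_slope; exists (fun z => (z - c) * f z)%C; split; [|split; [ring|intros; unfold k; ring]].
    apply clim_eq with ((c - c) * f c)%C; [|ring].
    refine (clim_mult _ _ _ _ _ _ _); [apply (der_cts (fun z => z - c)%C), Hsub|exact Hc]. }
  assert (Hk : hol c r k).
  { intros y Hy; destruct (classic (y = c)) as [->|N]; [apply (isd_der _ _ _ Dc)|].
    apply der_mult; [apply Hsub|apply der_mult; [apply Hsub|apply H; assumption]]. }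
  set (k1 := slope k c); assert (Hk1 : hol c r k1) by (apply hol_slope, Hk).
  set (k2 := slope k1 c); assert (Hk2 : hol c r k2) by (apply hol_slope, Hk1).
  assert (K1 : k1 c = 0) by (unfold k1; rewrite slope_center; apply isd_C_derive, Dc).
  assert (E : forall z, z <> c -> k2 z = f z).
  { intros y Hy; pose proof (slope_eq k c y) as E1; pose proof (slope_eq k1 c y) as E2.
    fold k1 in E1; fold k2 in E2; rewrite E2, K1 in E1; unfold k in E1.
    replace (k2 y) with (((c - c) * ((c - c) * f c) + (y - c) * (0 + (y - c) * k2 y)) / ((y - c) * (y - c)))%C
      by (field; apply Cminus_nz, Hy).
    rewrite <- E1; field; apply Cminus_nz, Hy. }
  assert (Ec : k2 c = f c).
  { apply Cminus_eq, Cmod_small; intros e He.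
    assert (Hcc : cts k2 c) by (apply der_cts, Hk2, disc_center, Hr).
    destruct (proj1 (cts_eps _ _) Hcc (e / 2) ltac:(lra)) as [d1 [D1 L1]].
    destruct (proj1 (cts_eps _ _) Hc (e / 2) ltac:(lra)) as [d2 [D2 L2]].
    destruct (near_point c d1 d2 D1 D2) as [y [Ny [Y1 Y2]]]; specialize (L1 y Y1); specialize (L2 y Y2); rewrite (E y Ny) in L1.
    pose proof (Cmod_tri3 (k2 c) (f y) (f c)) as T; rewrite (Cmod_sym (k2 c) (f y)) in T; lra. }
  apply der_ext_loc with k2; [|apply Hk2, disc_center, Hr].
  apply filter_forall; intros y; destruct (classic (y = c)) as [->|N]; [exact Ec|apply E, N].
Qed.

Definition entire (f : C -> C) : Prop := forall z, der f z.

Lemma entire_hol f c r : entire f -> hol c r f.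
Proof. intros H z _; apply H. Qed.

(** A zero of order [n] of [f - f c] would be one of order [n - 1] of its
    derivative. *)
Lemma zero_derive_const f c r : hol c r f -> (forall z, disc c r z -> C_derive f z = 0) ->
  forall z, disc c r z -> f z = f c.
Proof.
  intros H HD w Hw.
  assert (Hr : 0 < r) by (unfold disc in Hw; pose proof (Cmod_ge_0 (w - c)); lra).
  destruct (zero_order (fun z => f z - f c)%C c r Hr (hol_minus _ _ _ _ H (hol_const _ _ _))) as [K|[n [g [Hg [Hgc E]]]]].
  { apply Cminus_eq, K, Hw. }
  exfalso; destruct n as [|n].
  { specialize (E c (disc_center c r Hr)); simpl in E; apply Hgc.
    replace (g c) with (1 * g c)%C by ring; rewrite <- E; ring. }
  assert (D : forall z, disc c r z -> z <> c -> (RtoC (INR (S n)) * g z + (z - c) * C_derive g z)%C = 0).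
  { intros z Hz Hne.
    pose proof (isd_mult _ _ _ _ _ (isd_pow c z n) (Hg z Hz)) as I1.
    assert (I2 : isd (fun w => (w - c) ^ S n * g w)%C z 0).
    { apply isd_ext_loc with (fun z => f z - f c)%C.
      - generalize (disc_open c r z Hz); apply filter_imp; exact E.
      - replace (RtoC 0) with (C_derive f z + 0)%C by (rewrite HD by exact Hz; ring).
        apply (isd_plus f (fun _ => - f c)%C); [apply H, Hz|apply isd_const]. }
    apply isd_C_derive in I1; apply isd_C_derive in I2; rewrite I1 in I2.
    assert (Q : ((z - c) ^ n * (RtoC (INR (S n)) * g z + (z - c) * C_derive g z))%C = 0).
    { rewrite <- I2; simpl; ring. }
    apply NNPP; intros N; apply (Cmult_neq_0 ((z - c) ^ n)%C _ (Cpow_nz _ _ (Cminus_nz _ _ Hne)) N), Q. }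
  assert (Hk : hol c r (fun z => RtoC (INR (S n)) * g z + (z - c) * C_derive g z)%C).
  { apply hol_plus; apply hol_mult; [apply hol_const|exact Hg| |apply hol_derive, Hg].
    intros z _; apply der_sub. }
  destruct (nonzero_near _ c (der_cts _ _ (Hk c (disc_center c r Hr)))) as [s [Hs N]].
  { replace (RtoC (INR (S n)) * g c + (c - c) * C_derive g c)%C with (RtoC (INR (S n)) * g c)%C by ring.
    apply Cmult_neq_0; [|exact Hgc]; intros Q; apply RtoC_inj in Q; pose proof (pos_INR n); rewrite S_INR in Q; lra. }
  destruct (near_point c r s Hr Hs) as [z [Nz [Z1 Z2]]]; apply (N z Z2), D; assumption.
Qed.

(** Cauchy's estimate on discs of growing radius makes the derivative
    vanish. *)
Theorem liouville f M : entire f -> (forall z, Cmod (f z) <= M) -> forall z w, f z = f w.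
Proof.
  intros H HM z w; rewrite (zero_derive_const f w (Cmod (z - w) + 1)); [reflexivity|apply entire_hol, H| |unfold disc; lra].
  intros x _; apply Cmod_small; intros e He.
  assert (HM0 : 0 <= M) by (eapply Rle_trans; [apply Cmod_ge_0|apply (HM 0)]).
  eapply Rle_trans; [apply (cauchy_estimate f x ((2 * M + 1) / e) M); [pos|apply entire_hol, H|intros; apply HM]|].
  apply Rle_div_l; [pos|]; replace (e * ((2 * M + 1) / e)) with (2 * M + 1) by (field; lra); lra.
Qed.

(** Were [F n] without zeros in the disc, the mean value property of [1 / F n]
    would bound [1 / |F n c|], although [F n c] tends to [0]. *)
Theorem hurwitz c r F f : 0 < r -> ev_hol c r F -> unif_conv c r F f -> f c = 0 ->
  (exists z, disc c r z /\ f z <> 0) ->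
  forall s, 0 < s -> exists N, forall n, (N <= n)%nat -> exists z, disc c s z /\ disc c r z /\ F n z = 0.
Proof.
  intros Hr EH HU Hfc Hnz s Hs; pose proof PI_RGT_0.
  assert (Hf : hol c r f) by (eapply hol_limit; eassumption).
  destruct (isolated_zero f c r Hr Hf) as [K|[d [Hd K]]].
  { destruct Hnz as [z [Hz N]]; elim N; apply K, Hz. }
  set (q := Rmin d s / 2); assert (Hq : 0 < q < d /\ q < s) by (unfold q, Rmin; destruct Rle_dec; lra).
  assert (Hc : cts_circ (fun z => / f z)%C c q).
  { intros z Hz; apply (der_cts (fun z => / f z)%C), der_inv; [|apply Hf; unfold disc; lra].
    apply K; [unfold disc; lra|intros ->; rewrite Cmod_self in Hz; lra]. }
  destruct (circ_bounded _ c q ltac:(lra) Hc) as [M [HM0 HM]].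
  assert (HMi : 0 < / (4 * M)) by (apply Rinv_0_lt_compat; lra).
  destruct EH as [N0 EH]; destruct (HU (/ (4 * M)) HMi) as [N1 HN1].
  exists (Nat.max N0 N1); intros n Hn; specialize (EH n ltac:(lia)); specialize (HN1 n ltac:(lia)).
  apply NNPP; intros HNo.
  assert (Nz : forall z, disc c s z -> disc c r z -> F n z <> 0) by (intros z h1 h2 E; apply HNo; exists z; auto).
  set (t := Rmin d s); assert (Ht : q < t) by (unfold t, q, Rmin in *; destruct Rle_dec; lra).
  assert (Hi : hol c t (fun z => / F n z)%C).
  { intros z Hz; assert (disc c r z) by (eapply disc_le; [|exact Hz]; unfold t; pose proof (Rmin_l d s); lra).
    apply der_inv; [apply Nz; [eapply disc_le; [|exact Hz]; apply Rmin_r|assumption]|apply EH; assumption]. }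
  assert (Fc := HN1 c ltac:(apply disc_center; lra)); rewrite Hfc in Fc; replace (F n c - 0)%C with (F n c) in Fc by ring.
  assert (Nc : F n c <> 0) by (apply Nz; apply disc_center; lra).
  assert (B : Cmod (/ F n c) <= 2 * M * (q / (q - Cmod (c - c)))).
  { apply (cauchy_bound (fun z => / F n z)%C c t q c _ Hi ltac:(rewrite Cmod_self; lra) Ht).
    intros u Hu; specialize (HM u Hu); set (z := (c + circ q u)%C) in *.
    assert (Hz : Cmod (z - c) = q) by (unfold z; rewrite add_sub; apply Cmod_circ; lra).
    assert (Hne : z <> c) by (intros Ez; rewrite Ez, Cmod_self in Hz; lra).
    assert (Nfz : f z <> 0) by (apply K; [unfold disc; lra|exact Hne]).
    assert (NF : F n z <> 0) by (apply Nz; unfold disc; lra).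
    rewrite Cmod_inv in HM |- * by assumption.
    assert (Pf : 0 < Cmod (f z)) by (apply Cmod_gt_0; exact Nfz).
    assert (L1 : / M <= Cmod (f z)).
    { rewrite <- (Rinv_inv (Cmod (f z))); apply Rinv_le_contravar; [apply Rinv_0_lt_compat; exact Pf|exact HM]. }
    specialize (HN1 z ltac:(unfold disc; lra)).
    pose proof (Cmod_ge_sub (f z) (F n z)) as T; rewrite Cmod_sym in T.
    assert (E4 : / (4 * M) = / M / 4) by (field; lra).
    rewrite <- (Rinv_inv (2 * M)); apply Rinv_le_contravar; [apply Rinv_0_lt_compat; lra|].
    replace (/ (2 * M)) with (/ M / 2) by (field; lra); lra. }
  rewrite Cmod_self, Cmod_inv in B by exact Nc; replace (2 * M * (q / (q - 0))) with (2 * M) in B by (field; lra).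
  assert (P : 0 < Cmod (F n c)) by (apply Cmod_gt_0; exact Nc).
  assert (L : / / (4 * M) < / Cmod (F n c)) by (apply Rinv_lt_contravar; [apply Rmult_lt_0_compat; lra|exact Fc]).
  rewrite Rinv_inv in L; lra.
Qed.

(** * Locally uniform convergence near a point *)

(** Holomorphy is required only from some index on, since the [n]-th rescaled
    function is defined on a disc that depends on [n]. *)
Definition conv_at (c : C) (F : nat -> C -> C) (f : C -> C) : Prop :=
  exists r, 0 < r /\ ev_hol c r F /\ unif_conv c r F f.

Definition vanishes_near (f : C -> C) (c : C) : Prop := exists s, 0 < s /\ forall z, disc c s z -> f z = 0.

Lemma unif_conv_le c r s F f : s <= r -> unif_conv c r F f -> unif_conv c s F f.
Proof.
  intros Hs H e He; destruct (H e He) as [N HN]; exists N; intros n Hn z Hz.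
  apply HN; [exact Hn|eapply disc_le; eassumption].
Qed.

Lemma ev_hol_le c r s F : s <= r -> ev_hol c r F -> ev_hol c s F.
Proof. intros Hs [N H]; exists N; intros n Hn; eapply hol_le; [exact Hs|apply H, Hn]. Qed.

Lemma conv_at_hol c F f : conv_at c F f -> exists r, 0 < r /\ hol c r f.
Proof. intros [r [Hr [A B]]]; exists r; split; [exact Hr|eapply hol_limit; eassumption]. Qed.

Lemma conv_at_pair c F f G g : conv_at c F f -> conv_at c G g -> exists r, 0 < r /\
  (ev_hol c r F /\ unif_conv c r F f) /\ (ev_hol c r G /\ unif_conv c r G g).
Proof.
  intros [r [Hr [A B]]] [s [Hs [A' B']]]; exists (Rmin r s).
  pose proof (Rmin_l r s); pose proof (Rmin_r r s).
  split; [pos|]; repeat split;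
    eauto using unif_conv_le, ev_hol_le.
Qed.

Lemma conv_at_ext c F G f g : (exists r N, 0 < r /\ forall z, disc c r z -> f z = g z /\ forall n, (N <= n)%nat -> F n z = G n z) ->
  conv_at c F f -> conv_at c G g.
Proof.
  intros [s [N [Hs E]]] [r [Hr [[N0 A] B]]]; exists (Rmin r s).
  pose proof (Rmin_l r s); pose proof (Rmin_r r s).
  split; [pos|split].
  - exists (Nat.max N N0); intros n Hn.
    apply hol_ext with (F n); [intros z Hz; apply E; [eapply disc_le; eauto|lia]|].
    eapply hol_le; [|apply A; lia]; assumption.
  - intros e He; destruct (B e He) as [N1 HN1]; exists (Nat.max N N1); intros n Hn z Hz.
    destruct (E z ltac:(eapply disc_le; eauto)) as [<- E2]; rewrite <- E2 by lia.
    apply HN1; [lia|eapply disc_le; eauto].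
Qed.

Lemma conv_at_const c (a : nat -> C) l : (forall eps, 0 < eps -> exists N, forall n, (N <= n)%nat -> Cmod (a n - l) < eps) ->
  conv_at c (fun n _ => a n) (fun _ => l).
Proof.
  intros H; exists 1; split; [lra|split].
  - exists 0%nat; intros n _; apply hol_const.
  - intros e He; destruct (H e He) as [N HN]; exists N; intros n Hn z _; apply HN, Hn.
Qed.

Lemma conv_at_cst c l : conv_at c (fun _ _ => l) (fun _ => l).
Proof. apply (conv_at_const c (fun _ => l)); intros e He; exists 0%nat; intros; rewrite Cmod_self; exact He. Qed.

Lemma conv_at_plus c F f G g : conv_at c F f -> conv_at c G g ->
  conv_at c (fun n z => F n z + G n z)%C (fun z => f z + g z)%C.
Proof.
  intros HF HG; destruct (conv_at_pair _ _ _ _ _ HF HG) as [r [Hr [[[N A] B] [[N' A'] B']]]].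
  exists r; split; [exact Hr|split].
  - exists (Nat.max N N'); intros n Hn; apply hol_plus; [apply A|apply A']; lia.
  - intros e He; destruct (B (e / 2) ltac:(lra)) as [M HM]; destruct (B' (e / 2) ltac:(lra)) as [M' HM'].
    exists (Nat.max M M'); intros n Hn z Hz.
    replace (F n z + G n z - (f z + g z))%C with ((F n z - f z) + (G n z - g z))%C by ring.
    pose proof (Cmod_triangle (F n z - f z) (G n z - g z)).
    specialize (HM n ltac:(lia) z Hz); specialize (HM' n ltac:(lia) z Hz); lra.
Qed.

Lemma conv_at_mult c F f G g : conv_at c F f -> conv_at c G g ->
  conv_at c (fun n z => F n z * G n z)%C (fun z => f z * g z)%C.
Proof.
  intros HF HG; destruct (conv_at_pair _ _ _ _ _ HF HG) as [r0 [Hr0 [[E1 U1] [E2 U2]]]].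
  assert (Hf := hol_limit _ _ _ _ E1 U1); assert (Hg := hol_limit _ _ _ _ E2 U2).
  destruct (hol_bounded f c r0 (r0 / 2) Hf ltac:(lra)) as [Mf [PMf HMf]].
  destruct (hol_bounded g c r0 (r0 / 2) Hg ltac:(lra)) as [Mg [PMg HMg]].
  destruct E1 as [N A]; destruct E2 as [N' A'].
  assert (Sub : forall z, disc c (r0 / 2) z -> disc c r0 z) by (intros z; apply disc_le; lra).
  exists (r0 / 2); split; [lra|split].
  - exists (Nat.max N N'); intros n Hn; apply hol_mult; (eapply hol_sub; [exact Sub|]); [apply A|apply A']; lia.
  - intros e He; set (d := Rmin 1 (e / (1 + Mf + Mg))).
    assert (Hq : 0 < e / (1 + Mf + Mg)) by (apply Rdiv_lt_0_compat; lra).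
    assert (Hd : 0 < d) by pos.
    assert (D1 : d <= 1) by apply Rmin_l.
    assert (D2 : d * (1 + Mf + Mg) <= e).
    { apply Rle_trans with (e / (1 + Mf + Mg) * (1 + Mf + Mg)); [apply Rmult_le_compat_r; [lra|apply Rmin_r]|right; field; lra]. }
    destruct (U1 d Hd) as [M HM]; destruct (U2 d Hd) as [M' HM'].
    exists (Nat.max M M'); intros n Hn z Hz.
    specialize (HM n ltac:(lia) z (Sub z Hz)); specialize (HM' n ltac:(lia) z (Sub z Hz)).
    specialize (HMf z Hz); specialize (HMg z Hz).
    replace (F n z * G n z - f z * g z)%C
      with ((F n z - f z) * (G n z - g z) + ((F n z - f z) * g z + f z * (G n z - g z)))%C by ring.
    eapply Rle_lt_trans; [apply Cmod_triangle|]; eapply Rle_lt_trans; [apply Rplus_le_compat_l, Cmod_triangle|].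
    rewrite !Cmod_mult.
    pose proof (Cmod_ge_0 (F n z - f z)); pose proof (Cmod_ge_0 (G n z - g z)).
    pose proof (Cmod_ge_0 (f z)); pose proof (Cmod_ge_0 (g z)).
    assert (Cmod (F n z - f z) * Cmod (G n z - g z) <= Cmod (F n z - f z) * 1) by (apply Rmult_le_compat_l; lra).
    assert (Cmod (F n z - f z) * Cmod (g z) <= d * Mg) by (apply Rmult_le_compat; lra).
    assert (Cmod (f z) * Cmod (G n z - g z) <= Mf * d) by (apply Rmult_le_compat; lra).
    lra.
Qed.

Lemma conv_at_pow c F f k : conv_at c F f -> conv_at c (fun n z => F n z ^ k)%C (fun z => f z ^ k)%C.
Proof.
  intros H; induction k as [|k IH]; [apply (conv_at_cst c 1)|apply (conv_at_mult _ _ _ _ _ H IH)].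
Qed.

Lemma conv_at_minus_cst c F f a : conv_at c F f -> conv_at c (fun n z => F n z - a)%C (fun z => f z - a)%C.
Proof. intros H; apply (conv_at_plus _ _ _ _ _ H (conv_at_cst c (- a))). Qed.

(** Cauchy's estimate for [F n - f] on discs of half the radius. *)
Lemma conv_at_derive c F f : conv_at c F f -> conv_at c (fun n => C_derive (F n)) (C_derive f).
Proof.
  intros [r [Hr [A B]]]; assert (Hf := hol_limit _ _ _ _ A B); destruct A as [N A].
  exists (r / 2); split; [lra|split].
  - exists N; intros n Hn; apply hol_derive; eapply hol_le; [|apply A, Hn]; lra.
  - intros e He; destruct (B (e * r / 8) ltac:(nra)) as [M HM]; exists (Nat.max N M); intros n Hn z Hz.
    assert (Sub : forall w, disc z (r / 2) w -> disc c r w).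
    { intros w Hw; unfold disc in *; pose proof (Cmod_tri3 w z c); lra. }
    assert (H1 : hol z (r / 2) (F n)) by (eapply hol_sub; [exact Sub|apply A; lia]).
    assert (H2 : hol z (r / 2) f) by (eapply hol_sub; [exact Sub|exact Hf]).
    assert (E : C_derive (fun w => F n w - f w)%C z = (C_derive (F n) z - C_derive f z)%C).
    { apply isd_C_derive; assert (Cz := disc_center z (r / 2) ltac:(lra)).
      replace (C_derive (F n) z - C_derive f z)%C with (C_derive (F n) z + (0 * f z + RtoC (-1) * C_derive f z))%C by ring.
      apply isd_ext with (fun w => F n w + RtoC (-1) * f w)%C; [intros; ring|].
      apply isd_plus; [apply H1, Cz|apply isd_mult; [apply isd_const|apply H2, Cz]]. }
    rewrite <- E; apply Rle_lt_trans with (2 * (e * r / 8) / (r / 2)).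
    + apply cauchy_estimate; [lra|apply hol_minus; assumption|].
      intros w Hw; left; apply HM; [lia|apply Sub, Hw].
    + replace (2 * (e * r / 8) / (r / 2)) with (e / 2) by (field; lra); lra.
Qed.

Lemma conv_at_derive_n c F f k : conv_at c F f -> conv_at c (fun n => C_derive_n k (F n)) (C_derive_n k f).
Proof.
  intros H; induction k as [|k IH]; [exact H|].
  apply (conv_at_derive c (fun n => C_derive_n k (F n)) (C_derive_n k f) IH).
Qed.

Definition cvg (u : nat -> C) (l : C) : Prop :=
  forall eps, 0 < eps -> exists N, forall n, (N <= n)%nat -> Cmod (u n - l) < eps.

Lemma cvg_unique u l m : cvg u l -> cvg u m -> l = m.
Proof.
  intros A B; apply Cminus_eq, Cmod_small; intros e He.
  destruct (A (e / 2) ltac:(lra)) as [N HN]; destruct (B (e / 2) ltac:(lra)) as [M HM].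
  specialize (HN (Nat.max N M) ltac:(lia)); specialize (HM (Nat.max N M) ltac:(lia)).
  pose proof (Cmod_tri3 l (u (Nat.max N M)) m) as T; rewrite (Cmod_sym l (u (Nat.max N M))) in T; lra.
Qed.

Lemma conv_at_moving c F f u : conv_at c F f -> cvg u c -> cvg (fun n => F n (u n)) (f c).
Proof.
  intros [r [Hr [A B]]] Hu e He; assert (Hf := hol_limit _ _ _ _ A B).
  destruct (proj1 (cts_eps _ _) (der_cts _ _ (Hf c (disc_center c r Hr))) (e / 2) ltac:(lra)) as [d [Hd K]].
  destruct (Hu (Rmin r d) ltac:(pos)) as [N HN].
  destruct (B (e / 2) ltac:(lra)) as [M HM].
  exists (Nat.max N M); intros n Hn; specialize (HN n ltac:(lia)).
  pose proof (Rmin_l r d); pose proof (Rmin_r r d).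
  specialize (HM n ltac:(lia) (u n) ltac:(unfold disc; lra)); specialize (K (u n) ltac:(unfold disc; lra)).
  pose proof (Cmod_tri3 (F n (u n)) (f (u n)) (f c)); lra.
Qed.

Lemma conv_at_pt c F f : conv_at c F f -> cvg (fun n => F n c) (f c).
Proof. intros H; apply (conv_at_moving c F f (fun _ => c) H); intros e He; exists 0%nat; intros; rewrite Cmod_self; exact He. Qed.

Lemma hurwitz_at c F f : conv_at c F f -> f c = 0 -> ~ vanishes_near f c ->
  forall s, 0 < s -> exists N, forall n, (N <= n)%nat -> exists z, disc c s z /\ F n z = 0.
Proof.
  intros [r [Hr [A B]]] H0 Hn s Hs.
  destruct (hurwitz c r F f Hr A B H0) with (s := s) as [N HN]; [|exact Hs|].
  - apply NNPP; intros K; apply Hn; exists r; split; [exact Hr|]; intros z Hz; apply NNPP; intros E; apply K; exists z; auto.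
  - exists N; intros n Hn'; destruct (HN n Hn') as [z [Z1 [_ Z2]]]; exists z; auto.
Qed.

(** Hurwitz's theorem at the radii [1 / m]; for each [n] the zero is taken in
    the smallest of the first [n] discs that contains one. *)
Lemma hurwitz_seq c F f : conv_at c F f -> f c = 0 -> ~ vanishes_near f c ->
  exists u N, cvg u c /\ forall n, (N <= n)%nat -> F n (u n) = 0.
Proof.
  intros H H0 Hn.
  assert (P : forall n, exists z, forall m, (exists w, disc c (/ INR (S m)) w /\ F n w = 0) ->
     (m <= n)%nat -> disc c (/ INR (S m)) z /\ F n z = 0).
  { intros n.
    assert (Q : forall k, exists z, forall m, (exists w, disc c (/ INR (S m)) w /\ F n w = 0) ->
     (m < k)%nat -> disc c (/ INR (S m)) z /\ F n z = 0).
    { induction k as [|k [z IH]]; [exists c; intros; lia|].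
      destruct (classic (exists w, disc c (/ INR (S k)) w /\ F n w = 0)) as [[w [W1 W2]]|K].
      - exists w; intros m _ Hm; split; [|exact W2]; eapply disc_le; [|exact W1].
        apply Rinv_le_contravar; [apply lt_0_INR; lia|apply le_INR; lia].
      - exists z; intros m Hm1 Hm2; destruct (Nat.eq_dec m k) as [->|Ne]; [elim K; exact Hm1|].
        apply IH; [exact Hm1|lia]. }
    destruct (Q (S n)) as [z Hz]; exists z; intros m M1 M2; apply Hz; [exact M1|lia]. }
  pose (u := fun n => proj1_sig (constructive_indefinite_description _ (P n))).
  assert (Hu : forall n m, (exists w, disc c (/ INR (S m)) w /\ F n w = 0) -> (m <= n)%nat -> disc c (/ INR (S m)) (u n) /\ F n (u n) = 0).
  { intros n m Hw Hm; unfold u; destruct constructive_indefinite_description as [z Hz]; simpl; apply Hz; [exact Hw|exact Hm]. }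
  assert (Pos : forall m, 0 < / INR (S m)) by (intros m; apply Rinv_0_lt_compat, lt_0_INR; lia).
  destruct (hurwitz_at c F f H H0 Hn (/ INR 1) (Pos 0%nat)) as [N0 HN0].
  exists u, N0; split.
  - intros e He; destruct (archimed_cor1 e He) as [m [M1 M2]]; destruct m as [|m]; [lia|].
    destruct (hurwitz_at c F f H H0 Hn (/ INR (S m)) (Pos m)) as [N HN].
    exists (Nat.max m N); intros n Hn'; destruct (Hu n m (HN n ltac:(lia)) ltac:(lia)) as [D _]; unfold disc in D; lra.
  - intros n Hn'; apply (Hu n 0%nat); [apply HN0, Hn'|lia].
Qed.

(** * Polynomials and the fundamental theorem of algebra *)

Fixpoint psum (a : nat -> C) (n : nat) (z : C) : C :=
  match n with O => 0 | S n => (psum a n z + a n * z ^ n)%C end.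

Lemma isd_psum a c n z :
  isd (fun z => psum a (S n) (z - c)%C) z (psum (fun j => RtoC (INR (S j)) * a (S j))%C n (z - c)).
Proof.
  induction n as [|n IH].
  - simpl; apply isd_ext with (fun _ => a 0%nat); [intros; simpl; ring|apply isd_const].
  - change (isd (fun z => psum a (S n) (z - c) + a (S n) * (z - c) ^ S n)%C z
      (psum (fun j => RtoC (INR (S j)) * a (S j))%C n (z - c) + RtoC (INR (S n)) * a (S n) * (z - c) ^ n)%C).
    apply isd_plus; [exact IH|].
    replace (RtoC (INR (S n)) * a (S n) * (z - c) ^ n)%C
      with (0 * (z - c) ^ S n + a (S n) * (RtoC (INR (S n)) * (z - c) ^ n))%C by ring.
    apply (isd_mult (fun _ => a (S n)) (fun z => (z - c) ^ S n)%C); [apply isd_const|apply isd_pow].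
Qed.

Lemma entire_psum a c n : entire (fun z => psum a n (z - c)%C).
Proof.
  intros z; destruct n as [|n]; [apply (der_const 0)|eapply isd_der, isd_psum].
Qed.

(** The top coefficient [a n] dominates: the lower ones contribute at most a
    multiple of [|z|^(n-1)] when [|z| >= 1]. *)
Lemma psum_growth a n : (exists j, (1 <= j < n)%nat /\ a j <> RtoC 0) ->
  forall M, exists R0, forall z, R0 <= Cmod z -> M <= Cmod (psum a n z).
Proof.
  induction n as [|n IH]; [intros [j [Hj _]]; lia|].
  intros [j [Hj Nj]] M; destruct (classic (a n = RtoC 0)) as [E|E].
  - destruct (IH) with (M := M) as [R0 HR].
    + exists j; split; [|exact Nj]; assert (j <> n) by (intros ->; auto); lia.
    + exists R0; intros z Hz; simpl; rewrite E; replace (psum a n z + 0 * z ^ n)%C with (psum a n z) by ring; apply HR, Hz.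
  - destruct n as [|n]; [lia|].
    assert (B : forall m, exists K, 0 <= K /\ forall z, 1 <= Cmod z -> Cmod (psum a (S m) z) <= K * Cmod z ^ m).
    { induction m as [|m [K [HK IHm]]].
      - exists (Cmod (a 0%nat)); split; [apply Cmod_ge_0|]; intros z _; simpl.
        replace (0 + a 0%nat * 1)%C with (a 0%nat) by ring; lra.
      - exists (K + Cmod (a (S m))); pose proof (Cmod_ge_0 (a (S m))); split; [lra|]; intros z Hz.
        change (psum a (S (S m)) z) with (psum a (S m) z + a (S m) * z ^ S m)%C.
        eapply Rle_trans; [apply Cmod_triangle|]; rewrite Cmod_mult, Cmod_pow.
        specialize (IHm z Hz); cbn [pow].
        assert (0 <= Cmod z ^ m) by (apply pow_le; lra).
        assert (K * Cmod z ^ m <= K * (Cmod z * Cmod z ^ m)) by (apply Rmult_le_compat_l; [lra|]; nra).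
        lra. }
    destruct (B n) as [K [HK HB]].
    assert (Pa : 0 < Cmod (a (S n))) by (apply Cmod_gt_0; exact E).
    exists (Rmax 1 ((Rabs M + K) / Cmod (a (S n)))); intros z Hz.
    pose proof (Rmax_l 1 ((Rabs M + K) / Cmod (a (S n)))) as L1; pose proof (Rmax_r 1 ((Rabs M + K) / Cmod (a (S n)))) as L2.
    assert (Z : Rabs M + K <= Cmod z * Cmod (a (S n))) by (apply Rle_div_l; lra).
    specialize (HB z ltac:(lra)).
    change (psum a (S (S n)) z) with (psum a (S n) z + a (S n) * z ^ S n)%C.
    pose proof (Cmod_ge_sub (a (S n) * z ^ S n) (- psum a (S n) z)) as T; rewrite Cmod_opp in T.
    replace (a (S n) * z ^ S n - - psum a (S n) z)%C with (psum a (S n) z + a (S n) * z ^ S n)%C in T by ring.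
    rewrite Cmod_mult, Cmod_pow in T; cbn [pow] in T.
    assert (P : 1 <= Cmod z ^ n) by (apply pow_R1_Rle; lra).
    pose proof (Rle_abs M); pose proof (Rabs_pos M).
    assert ((Rabs M + K) * Cmod z ^ n <= Cmod z * Cmod (a (S n)) * Cmod z ^ n) by (apply Rmult_le_compat_r; lra).
    assert (Rabs M * 1 <= Rabs M * Cmod z ^ n) by (apply Rmult_le_compat_l; lra).
    lra.
Qed.

(** If [psum a n] omits [b], then [1 / (psum a n - b)] is entire and, by
    [psum_growth], bounded; Liouville's theorem makes [psum a n] constant,
    against its growth. *)
Theorem psum_surjective a n : (exists j, (1 <= j < n)%nat /\ a j <> RtoC 0) -> forall b, exists z, psum a n z = b.
Proof.
  intros H b; apply NNPP; intros K.
  assert (Hp : entire (psum a n)).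
  { intros z; apply der_ext_loc with (fun z => psum a n (z - 0)%C); [|apply entire_psum].
    apply filter_forall; intros w; f_equal; ring. }
  assert (Nz : forall z, (psum a n z - b)%C <> 0) by (intros z E; apply K; exists z; apply Cminus_eq, E).
  assert (He : entire (fun z => / (psum a n z - b))%C).
  { intros z; apply (der_inv (fun z => psum a n z - b)%C); [apply Nz|apply der_minus; [apply Hp|apply der_const]]. }
  destruct (psum_growth a n H (Cmod b + 1)) as [R0 HR].
  destruct (hol_bounded _ 0 (Rabs R0 + 2) (Rabs R0 + 1) (entire_hol _ _ _ He) ltac:(lra)) as [M [HM0 HM]].
  assert (Const := liouville _ (Rmax 1 M) He).
  assert (Big : forall z, R0 <= Cmod z -> Cmod (/ (psum a n z - b)) <= 1).
  { intros z Hz; specialize (HR z Hz); rewrite Cmod_inv by apply Nz.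
    pose proof (Cmod_ge_sub (psum a n z) b).
    rewrite <- Rinv_1; apply Rinv_le_contravar; lra. }
  assert (C1 : forall z w, (/ (psum a n z - b))%C = (/ (psum a n w - b))%C).
  { apply Const; intros z; destruct (Rle_dec R0 (Cmod z)) as [L|L].
    - eapply Rle_trans; [apply Big, L|apply Rmax_l].
    - eapply Rle_trans; [apply HM|apply Rmax_r]; unfold disc; replace (z - 0)%C with z by ring.
      pose proof (Rle_abs R0); lra. }
  assert (C2 : forall z w, psum a n z = psum a n w).
  { intros z w; apply Cminus_eq.
    replace (psum a n z - psum a n w)%C with ((psum a n z - b) * (psum a n w - b) * (/ (psum a n w - b) - / (psum a n z - b)))%C
      by (field; split; apply Nz).
    rewrite (C1 w z); ring. }
  destruct (psum_growth a n H (Cmod (psum a n 0) + 1)) as [R1 HR1].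
  specialize (HR1 (RtoC (Rabs R1)) ltac:(rewrite Cmod_R, Rabs_Rabsolu; apply Rle_abs)).
  rewrite (C2 (RtoC (Rabs R1)) 0) in HR1; lra.
Qed.

Lemma C_derive_n_S k f : C_derive_n (S k) f = C_derive_n k (C_derive f).
Proof. unfold C_derive_n; apply Nat.iter_succ_r. Qed.

(** Integrating [k] times, starting from the constant [b]. *)
Lemma derive_n_const_psum k : forall f c r b, 0 < r -> hol c r f -> (forall z, disc c r z -> C_derive_n k f z = b) ->
  exists a, (forall z, disc c r z -> f z = psum a (S k) (z - c)) /\
    forall z, C_derive_n k (fun z => psum a (S k) (z - c)%C) z = b.
Proof.
  induction k as [|k IH]; intros f c r b Hr H E.
  - exists (fun _ => b); split; [intros z Hz; rewrite <- (E z Hz); simpl; ring|intros z; simpl; ring].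
  - rewrite C_derive_n_S in E.
    destruct (IH (C_derive f) c r b Hr (hol_derive _ _ _ H) E) as [a [A1 A2]].
    exists (fun j => match j with O => f c | S j => (a j / RtoC (INR (S j)))%C end).
    set (a' := fun j => match j with O => f c | S j => (a j / RtoC (INR (S j)))%C end).
    assert (Hn : forall j, RtoC (INR (S j)) <> 0).
    { intros j Q; apply RtoC_inj in Q; pose proof (pos_INR j); rewrite S_INR in Q; lra. }
    assert (Ea : forall z, psum (fun j => RtoC (INR (S j)) * a' (S j))%C (S k) z = psum a (S k) z).
    { intros z; generalize (S k); intros m; induction m as [|m IHm]; [reflexivity|].
      cbn [psum]; rewrite IHm; f_equal; f_equal; cbn [a']; field; apply Hn. }
    assert (D : forall z, isd (fun z => psum a' (S (S k)) (z - c)%C) z (psum a (S k) (z - c))).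
    { intros z; rewrite <- Ea; apply isd_psum. }
    split.
    + intros z Hz.
      assert (Hd : hol c r (fun z => f z - psum a' (S (S k)) (z - c))%C).
      { apply hol_minus; [exact H|intros w _; eapply isd_der, D]. }
      assert (Z : forall z, disc c r z -> C_derive (fun z => f z - psum a' (S (S k)) (z - c))%C z = 0).
      { intros w Hw; apply isd_C_derive.
        replace (RtoC 0) with (C_derive f w + (0 * psum a' (S (S k)) (w - c) + RtoC (-1) * psum a (S k) (w - c)))%C
          by (rewrite (A1 w Hw); ring).
        apply isd_ext with (fun z => f z + RtoC (-1) * psum a' (S (S k)) (z - c))%C; [intros; ring|].
        apply isd_plus; [apply H, Hw|].
        apply (isd_mult (fun _ => RtoC (-1)) (fun z => psum a' (S (S k)) (z - c)%C)); [apply isd_const|apply D]. }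
      pose proof (zero_derive_const _ c r Hd Z z Hz) as Q; cbv beta in Q.
      assert (P0 : psum a' (S (S k)) (c - c) = f c).
      { replace (c - c)%C with (RtoC 0) by ring; generalize (S k); intros m; induction m as [|m IHm]; [simpl; ring|].
        change (psum a' (S (S m)) 0) with (psum a' (S m) 0 + a' (S m) * 0 ^ S m)%C; rewrite IHm; simpl; ring. }
      rewrite P0 in Q; apply Cminus_eq; rewrite Q; ring.
    + intros z; rewrite C_derive_n_S, <- (A2 z); f_equal.
      apply functional_extensionality; intros w; apply isd_C_derive, D.
Qed.

(** If the [k]-th derivative is constant and derivatives up to order [k] vanish
    at [c], they vanish near [c], in decreasing order. *)
Lemma derive_n_const_zero k f c r b : 0 < r -> hol c r f -> (forall z, disc c r z -> C_derive_n k f z = b) ->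
  (forall j, (j <= k)%nat -> C_derive_n j f c = 0) -> forall z, disc c r z -> f z = 0.
Proof.
  intros Hr H E Z.
  assert (K : forall i, (i <= k)%nat -> forall z, disc c r z -> C_derive_n (k - i) f z = 0).
  { induction i as [|i IH]; intros Hi.
    - rewrite Nat.sub_0_r; intros z Hz; rewrite (E z Hz), <- (E c (disc_center c r Hr)); apply Z; lia.
    - intros z Hz; rewrite <- (Z (k - S i)%nat ltac:(lia)).
      apply zero_derive_const with r; [apply hol_derive_n, H| |exact Hz].
      intros w Hw; change (C_derive (C_derive_n (k - S i) f) w) with (C_derive_n (S (k - S i)) f w).
      replace (S (k - S i)) with (k - i)%nat by lia; apply IH; [lia|exact Hw]. }
  intros z Hz; specialize (K k (le_n k) z Hz); rewrite Nat.sub_diag in K; exact K.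
Qed.

(** * Primitives and logarithms *)

(** Reversing the sides of a rectangle changes the sign of the integral. *)
Lemma goursat_signed f a b c d : entire f -> bdint f a b c d = 0.
Proof.
  intros H.
  assert (Ch : forall y u v, cont_on (fun t => f (t, y)) u v) by (intros y u v t _; apply clim_horizontal, der_cts, H).
  assert (Cv : forall x u v, cont_on (fun s => f (x, s)) u v) by (intros y u v t _; apply clim_vertical, der_cts, H).
  assert (S1 : forall a b c d, bdint f b a c d = (- bdint f a b c d)%C).
  { intros a1 b1 c1 d1; unfold bdint; rewrite (CInt_swap (fun t => f (t, c1)) a1 b1), (CInt_swap (fun t => f (t, d1)) a1 b1) by apply Ch; ring. }
  assert (S2 : forall a b c d, bdint f a b d c = (- bdint f a b c d)%C).
  { intros a1 b1 c1 d1; unfold bdint; rewrite (CInt_swap (fun t => f (a1, t)) c1 d1), (CInt_swap (fun t => f (b1, t)) c1 d1) by apply Cv; ring. }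
  assert (G : forall a b c d, a <= b -> c <= d -> bdint f a b c d = 0) by (intros; apply goursat; auto).
  assert (Z : (- RtoC 0)%C = 0) by ring.
  destruct (Rle_dec a b) as [h|h]; destruct (Rle_dec c d) as [k|k].
  - apply G; assumption.
  - rewrite S2, G by lra; exact Z.
  - rewrite S1, G by lra; exact Z.
  - rewrite S1, S2, G by lra; rewrite Z; exact Z.
Qed.

(** Integrate from [0] along the real axis and then vertically. By Goursat's
    theorem the increment is an integral along a broken line near the point. *)
Lemma primitive f : entire f -> exists g, forall z, isd g z (f z).
Proof.
  intros H.
  assert (Ch : forall y u v, cont_on (fun t => f (t, y)) u v) by (intros y u v t _; apply clim_horizontal, der_cts, H).
  assert (Cv : forall x u v, cont_on (fun s => f (x, s)) u v) by (intros y u v t _; apply clim_vertical, der_cts, H).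
  pose (g := fun z : C => (CInt (fun t => f (t, 0)) 0 (fst z) + Ci * CInt (fun s => f (fst z, s)) 0 (snd z))%C).
  exists g; intros [x y] e He.
  destruct (proj1 (cts_eps _ _) (der_cts _ _ (H (x, y))) (e / 2) ltac:(lra)) as [d [Hd K]].
  exists (d / 2); split; [lra|]; intros [x' y'] Hw; unfold disc in Hw.
  set (m := Cmod ((x', y') - (x, y))) in *.
  assert (Hx : Rabs (x' - x) <= m) by apply (re_le_Cmod ((x', y') - (x, y))%C).
  assert (Hy : Rabs (y' - y) <= m) by (eapply Rle_trans; [apply Rmax_r|apply (Rmax_Cmod ((x', y') - (x, y))%C)]).
  assert (E : (g (x', y') - g (x, y))%C = (CInt (fun t => f (t, y)) x x' + Ci * CInt (fun s => f (x', s)) y y')%C).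
  { pose proof (goursat_signed f x x' 0 y H) as G; unfold bdint in G; unfold g; simpl.
    rewrite <- (CInt_chasles (fun t => f (t, 0)) 0 x x'), <- (CInt_chasles (fun s => f (x', s)) 0 y y') by (apply Ch || apply Cv).
    apply Cminus_eq; rewrite <- G; ring. }
  rewrite E.
  assert (E2 : (CInt (fun t => f (t, y)) x x' + Ci * CInt (fun s => f (x', s)) y y' - f (x, y) * ((x', y') - (x, y)))%C
    = (CInt (fun t => f (t, y) - f (x, y)) x x' + Ci * CInt (fun s => f (x', s) - f (x, y)) y y')%C).
  { assert (Cc : forall u v, cont_on (fun _ => f (x, y)) u v) by (intros u v t _; exact (clim_const _ _)).
    rewrite !CInt_minus by (apply Ch || apply Cv || apply Cc).
    rewrite !(isI_unique _ _ _ _ (isI_const (f (x, y)) _ _)).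
    replace ((x', y') - (x, y))%C with (RtoC (x' - x) + Ci * RtoC (y' - y))%C by (apply injective_projections; simpl; ring).
    ring. }
  rewrite E2; eapply Rle_trans; [apply Cmod_triangle|]; rewrite Cmod_mult, Cmod_Ci, Rmult_1_l.
  assert (B1 : Cmod (CInt (fun t => f (t, y) - f (x, y))%C x x') <= Rabs (x' - x) * (e / 2)).
  { apply CInt_bound.
    - intros t Ht; refine (clim_minus _ _ _ _ _ _ _); [apply (Ch y x x' t Ht)|exact (clim_const _ _)].
    - intros t Ht; left; apply K; unfold disc.
      replace ((t, y) - (x, y))%C with (RtoC (t - x)) by (apply injective_projections; simpl; ring).
      rewrite Cmod_R; apply Rle_lt_trans with (Rabs (x' - x)); [|lra].
      revert Ht; unfold Rmin, Rmax, Rabs; destruct Rle_dec; repeat destruct Rcase_abs; lra. }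
  assert (B2 : Cmod (CInt (fun s => f (x', s) - f (x, y))%C y y') <= Rabs (y' - y) * (e / 2)).
  { apply CInt_bound.
    - intros t Ht; refine (clim_minus _ _ _ _ _ _ _); [apply (Cv x' y y' t Ht)|exact (clim_const _ _)].
    - intros t Ht; left; apply K; unfold disc.
      replace ((x', t) - (x, y))%C with (RtoC (x' - x) + Ci * RtoC (t - y))%C by (apply injective_projections; simpl; ring).
      eapply Rle_lt_trans; [apply Cmod_triangle|]; rewrite Cmod_mult, Cmod_Ci, !Cmod_R.
      assert (Rabs (t - y) <= Rabs (y' - y)); [|lra].
      revert Ht; unfold Rmin, Rmax, Rabs; destruct Rle_dec; repeat destruct Rcase_abs; lra. }
  assert (Rabs (x' - x) * (e / 2) <= m * (e / 2)) by (apply Rmult_le_compat_r; lra).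
  assert (Rabs (y' - y) * (e / 2) <= m * (e / 2)) by (apply Rmult_le_compat_r; lra).
  lra.
Qed.

(** For a primitive [g] of [u' / u] the derivative of [u e^(-g)] vanishes. *)
Theorem entire_log u : entire u -> (forall z, u z <> RtoC 0) -> exists v, entire v /\ forall z, u z = Cexp (v z).
Proof.
  intros H Hnz.
  assert (Hq : entire (fun z => C_derive u z / u z)%C).
  { intros z; apply der_div; [apply Hnz| |apply H].
    apply (hol_derive u z 1); [apply entire_hol, H|apply disc_center; lra]. }
  destruct (primitive _ Hq) as [g Hg].
  assert (Eg : entire (fun z => u z * Cexp (- g z))%C).
  { intros z; apply der_mult; [apply H|].
    apply (der_comp Cexp (fun z => - g z)%C); [apply der_opp; eapply isd_der, Hg|apply der_Cexp]. }
  assert (Dz : forall z, C_derive (fun z => u z * Cexp (- g z))%C z = 0).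
  { intros z; apply isd_C_derive.
    assert (N : isd (fun z => - g z)%C z (- (C_derive u z / u z))%C).
    { apply isd_ext with (fun z => RtoC (-1) * g z)%C; [intros; ring|].
      replace (- (C_derive u z / u z))%C with (0 * g z + RtoC (-1) * (C_derive u z / u z))%C by ring.
      apply isd_mult; [apply isd_const|apply Hg]. }
    pose proof (isd_mult _ _ _ _ _ (H z) (isd_comp _ _ _ _ _ N (isd_Cexp (- g z)))) as I; cbv beta in I.
    replace (RtoC 0) with (C_derive u z * Cexp (- g z) + u z * (Cexp (- g z) * - (C_derive u z / u z)))%C
      by (field; apply Hnz).
    exact I. }
  destruct (Cexp_surj (u 0 * Cexp (- g 0))%C) as [k Hk].
  { apply Cmult_neq_0; [apply Hnz|apply Cexp_nz]. }
  exists (fun z => k + g z)%C; split.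
  - intros z; apply der_plus; [apply der_const|eapply isd_der, Hg].
  - intros z; rewrite Cexp_add, Hk.
    rewrite <- (zero_derive_const _ 0 (Cmod (z - 0) + 1) (entire_hol _ _ _ Eg) ltac:(intros; apply Dz) z) by (unfold disc; lra).
    rewrite Cexp_opp; field; apply Cexp_nz.
Qed.

(** * Connectedness *)

Lemma clopen (D A : C -> Prop) : connected D ->
  (forall z, D z -> A z -> exists r, 0 < r /\ forall w, disc z r w -> A w) ->
  (forall z, D z -> ~ A z -> exists r, 0 < r /\ forall w, disc z r w -> ~ A w) ->
  (exists z, D z /\ A z) -> forall z, D z -> A z.
Proof.
  intros HD H1 H2 [z0 [D0 A0]] z Hz; apply NNPP; intros Hn.
  pose (U := fun (P : C -> Prop) z => exists r, 0 < r /\ forall w, disc z r w -> P w).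
  assert (OU : forall P, open (U P)).
  { intros P; apply open_disc; intros w [r [Hr K]].
    exists (r / 2); split; [lra|]; intros v Hv; exists (r / 2); split; [lra|]; intros x Hx; apply K.
    unfold disc in *; pose proof (Cmod_tri3 x v w); lra. }
  destruct (HD (U A) (U (fun w => ~ A w)) (OU _) (OU _)) as [w [_ [[r [Hr K]] [s [Hs L]]]]].
  - intros w Hw; destruct (classic (A w)); [left; apply H1|right; apply H2]; assumption.
  - exists z0; split; [exact D0|apply H1; assumption].
  - exists z; split; [exact Hz|apply H2; assumption].
  - apply (L w (disc_center w s Hs)), K, disc_center, Hr.
Qed.

Lemma connected_C : connected (fun _ => True).
Proof.
  intros U V OU OV Cov [x [_ Ux]] [y [_ Vy]]; apply NNPP; intros N.
  assert (Dj : forall z, U z -> V z -> False) by (intros z a b; apply N; exists z; auto).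
  rewrite open_disc in OU, OV.
  pose (p := fun t : R => (x + RtoC t * (y - x))%C).
  assert (Lip : forall s t, Cmod (p s - p t) = Rabs (s - t) * Cmod (y - x)).
  { intros s t; unfold p; replace (x + RtoC s * (y - x) - (x + RtoC t * (y - x)))%C with (RtoC (s - t) * (y - x))%C by (rewrite RtoC_minus; ring).
    rewrite Cmod_mult, Cmod_R; reflexivity. }
  assert (Near : forall W, (forall z, W z -> exists d, 0 < d /\ forall w, disc z d w -> W w) ->
    forall t, W (p t) -> exists d, 0 < d /\ forall s, Rabs (s - t) < d -> W (p s)).
  { intros W HW t Ht; destruct (HW _ Ht) as [d [Hd K]]; pose proof (Cmod_ge_0 (y - x)).
    exists (d / (1 + Cmod (y - x))); split; [apply Rdiv_lt_0_compat; lra|]; intros s Hs; apply K.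
    unfold disc; rewrite Lip; apply Rlt_div_r in Hs; [|lra]; pose proof (Rabs_pos (s - t)); nra. }
  pose (E := fun t => 0 <= t <= 1 /\ forall s, 0 <= s <= t -> U (p s)).
  assert (P0 : p 0 = x) by (unfold p; ring).
  assert (P1 : p 1 = y) by (unfold p; ring).
  assert (E0 : E 0) by (split; [lra|]; intros s Hs; replace s with 0 by lra; rewrite P0; exact Ux).
  destruct (completeness E) as [t [T1 T2]].
  { exists 1; intros s [Hs _]; lra. }
  { exists 0; exact E0. }
  assert (Ht : 0 <= t <= 1) by (split; [apply T1, E0|apply T2; intros s [Hs _]; lra]).
  assert (Below : forall s, 0 <= s < t -> U (p s)).
  { intros s Hs; apply NNPP; intros K; assert (t <= s); [|lra].
    apply T2; intros s' [h1 h2]; apply Rnot_lt_le; intros L; apply K, h2; lra. }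
  destruct (Cov (p t) I) as [Ut|Vt].
  - destruct (Near U OU t Ut) as [d [Hd K]].
    destruct (Rlt_dec t 1) as [L|L].
    + assert (Q : E (Rmin 1 (t + d / 2))).
      { split; [unfold Rmin; destruct Rle_dec; lra|]; intros s Hs.
        pose proof (Rmin_r 1 (t + d / 2)).
        destruct (Rlt_dec s t); [apply Below; lra|apply K, Rabs_def1; lra]. }
      specialize (T1 _ Q); revert T1; unfold Rmin; destruct Rle_dec; lra.
    + apply (Dj y); [|exact Vy]; rewrite <- P1; replace 1 with t by lra; exact Ut.
  - destruct (Near V OV t Vt) as [d [Hd K]].
    destruct (Rlt_dec 0 t) as [L|L].
    + set (s := Rmax 0 (t - d / 2)); assert (Hs : 0 <= s < t /\ t - d < s) by (unfold s, Rmax; destruct Rle_dec; lra).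
      apply (Dj (p s)); [apply Below; lra|apply K, Rabs_def1; lra].
    + apply (Dj x); [exact Ux|]; rewrite <- P0; replace 0 with t by lra; exact Vt.
Qed.

(** * The chordal metric *)

(** Homogeneous coordinates make the point at infinity unexceptional. *)
Definition hnum (p : Csph) : C := match p with Fin z => z | Inf => 1 end.
Definition hden (p : Csph) : C := match p with Fin _ => 1 | Inf => 0 end.
Definition hnorm (p : Csph) : R := sqrt (Cmod (hnum p) ^ 2 + Cmod (hden p) ^ 2).

Lemma hnorm_pos p : 0 < hnorm p.
Proof.
  apply sqrt_lt_R0; destruct p as [z|]; simpl; rewrite ?Cmod_1, ?Cmod_0; [pose proof (Cmod_ge_0 z)|]; nra.
Qed.

Lemma hnorm_sqr p : hnorm p * hnorm p = Cmod (hnum p) ^ 2 + Cmod (hden p) ^ 2.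
Proof. apply sqrt_sqrt; pose proof (pow2_ge_0 (Cmod (hnum p))); pose proof (pow2_ge_0 (Cmod (hden p))); lra. Qed.

Lemma hc_hom p q : half_chord p q = Cmod (hnum p * hden q - hnum q * hden p) / (hnorm p * hnorm q).
Proof.
  destruct p as [z|]; destruct q as [w|]; unfold half_chord, hnorm, hnum, hden; rewrite ?Cmod_1, ?Cmod_0, ?pow1.
  - rewrite (Rplus_comm (Cmod z ^ 2)), (Rplus_comm (Cmod w ^ 2)); f_equal; f_equal; ring.
  - replace (z * 0 - 1 * 1)%C with (- (1))%C by ring; rewrite Cmod_opp, Cmod_1, pow_i, Rplus_0_r, sqrt_1, Rmult_1_r by lia.
    rewrite (Rplus_comm (Cmod z ^ 2)); reflexivity.
  - replace (1 * 1 - w * 0)%C with (RtoC 1) by ring; rewrite Cmod_1, pow_i, Rplus_0_r, sqrt_1, Rmult_1_l by lia.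
    rewrite (Rplus_comm (Cmod w ^ 2)); reflexivity.
  - replace (1 * 0 - 1 * 0)%C with (RtoC 0) by ring; rewrite Cmod_0; unfold Rdiv; ring.
Qed.

Lemma hc_ge0 p q : 0 <= half_chord p q.
Proof. rewrite hc_hom; apply Rle_mult_inv_pos; [apply Cmod_ge_0|apply Rmult_lt_0_compat; apply hnorm_pos]. Qed.

Lemma hc_sym p q : half_chord p q = half_chord q p.
Proof. rewrite !hc_hom, Cmod_sym, (Rmult_comm (hnorm q)); reflexivity. Qed.

Lemma hc_refl p : half_chord p p = 0.
Proof. rewrite hc_hom, Cmod_self; unfold Rdiv; ring. Qed.

Lemma cauchy_schwarz a b c d : a * c + b * d <= sqrt (a ^ 2 + b ^ 2) * sqrt (c ^ 2 + d ^ 2).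
Proof.
  rewrite <- sqrt_mult by nra; eapply Rle_trans; [apply Rle_abs|]; rewrite <- sqrt_Rsqr_abs.
  apply sqrt_le_1_alt; unfold Rsqr; pose proof (pow2_ge_0 (a * d - b * c)); nra.
Qed.

Lemma hc_le1 p q : half_chord p q <= 1.
Proof.
  rewrite hc_hom; apply Rle_div_l; [apply Rmult_lt_0_compat; apply hnorm_pos|]; rewrite Rmult_1_l.
  eapply Rle_trans; [apply Cmod_triangle|]; rewrite Cmod_opp, !Cmod_mult, (Rmult_comm (Cmod (hnum q))).
  unfold hnorm; rewrite (Rplus_comm (Cmod (hnum q) ^ 2)); apply cauchy_schwarz.
Qed.

(** Lagrange's identity
    [(u x v) |t|^2 = (u x t) <v, t> + (t x v) <u, t>] in [C^2] and the
    Cauchy-Schwarz inequality. *)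
Lemma hc_tri p q t : half_chord p q <= half_chord p t + half_chord t q.
Proof.
  rewrite !hc_hom; pose proof (hnorm_pos p) as Np; pose proof (hnorm_pos q) as Nq; pose proof (hnorm_pos t) as Nt.
  pose proof (hnorm_sqr t) as St; rewrite !Cmod2_alt in St.
  assert (CS : forall s, Cmod (hnum s * Cconj (hnum t) + hden s * Cconj (hden t)) <= hnorm s * hnorm t).
  { intros s; eapply Rle_trans; [apply Cmod_triangle|]; rewrite !Cmod_mult, !Cmod_conj; apply cauchy_schwarz. }
  set (a := hnum p) in *; set (b := hden p) in *; set (c := hnum q) in *; set (d := hden q) in *.
  set (e := hnum t) in *; set (f := hden t) in *.
  assert (I : ((a * d - c * b) * RtoC (hnorm t * hnorm t))%C =
    ((a * f - e * b) * (c * Cconj e + d * Cconj f) + (e * d - c * f) * (a * Cconj e + b * Cconj f))%C).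
  { rewrite St; apply injective_projections; unfold Re, Im; simpl; ring. }
  apply (f_equal Cmod) in I; rewrite Cmod_mult, Cmod_R, Rabs_pos_eq in I by nra.
  assert (J : Cmod (a * d - c * b) * (hnorm t * hnorm t) <=
    Cmod (a * f - e * b) * (hnorm q * hnorm t) + Cmod (e * d - c * f) * (hnorm p * hnorm t)).
  { rewrite I; eapply Rle_trans; [apply Cmod_triangle|]; rewrite !Cmod_mult.
    apply Rplus_le_compat; apply Rmult_le_compat_l; try apply Cmod_ge_0; apply CS. }
  apply Rmult_le_reg_r with (hnorm p * hnorm q * (hnorm t * hnorm t)).
  { repeat apply Rmult_lt_0_compat; assumption. }
  replace (Cmod (a * d - c * b) / (hnorm p * hnorm q) * (hnorm p * hnorm q * (hnorm t * hnorm t)))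
    with (Cmod (a * d - c * b) * (hnorm t * hnorm t)) by (field; lra).
  eapply Rle_trans; [exact J|right; field; lra].
Qed.

(** The involution [1 / p] of the sphere, an isometry by [hc_sinv]. It
    transfers every statement about finite values to one about [Inf]. *)
Definition sinv (p : Csph) : Csph :=
  match p with
  | Fin z => if excluded_middle_informative (z = 0) then Inf else Fin (/ z)
  | Inf => Fin 0
  end.

Lemma sinv_Fin (z : C) : z <> RtoC 0 -> sinv (Fin z) = Fin (/ z).
Proof. intros H; simpl; destruct excluded_middle_informative as [E|E]; [now elim H|reflexivity]. Qed.

Lemma sinv_0 : sinv (Fin 0) = Inf.
Proof. simpl; destruct excluded_middle_informative as [E|E]; [reflexivity|now elim E]. Qed.

Lemma Cinv_nz (z : C) : z <> RtoC 0 -> (/ z)%C <> RtoC 0.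
Proof. intros H E; assert (Q : (/ z * z)%C = 1) by (field; exact H); rewrite E in Q; apply C1_nz; rewrite <- Q; ring. Qed.

Lemma sinv_sinv p : sinv (sinv p) = p.
Proof.
  destruct p as [z|]; [|apply sinv_0].
  destruct (classic (z = 0)) as [->|H]; [rewrite sinv_0; reflexivity|].
  rewrite sinv_Fin, sinv_Fin by (try apply Cinv_nz; exact H); f_equal; field; exact H.
Qed.

(** In homogeneous coordinates the involution exchanges the two entries, up to
    a common factor. *)
Lemma hc_sinv p q : half_chord (sinv p) (sinv q) = half_chord p q.
Proof.
  assert (K : forall p, exists k, k <> RtoC 0 /\ hnum (sinv p) = (k * hden p)%C /\ hden (sinv p) = (k * hnum p)%C).
  { intros [z|].
    - destruct (classic (z = 0)) as [->|H].
      + exists (RtoC 1); rewrite sinv_0; simpl; repeat split; [exact C1_nz|ring|ring].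
      + exists (/ z)%C; rewrite sinv_Fin by exact H; simpl; repeat split; [apply Cinv_nz, H|ring|field; exact H].
    - exists (RtoC 1); simpl; repeat split; [exact C1_nz|ring|ring]. }
  rewrite !hc_hom; unfold hnorm.
  destruct (K p) as [k [Nk [-> ->]]]; destruct (K q) as [l [Nl [-> ->]]].
  replace (k * hden p * (l * hnum q) - l * hden q * (k * hnum p))%C
    with (- (k * l) * (hnum p * hden q - hnum q * hden p))%C by ring.
  rewrite !Cmod_mult, Cmod_opp, Cmod_mult.
  assert (Pk : 0 < Cmod k) by (apply Cmod_gt_0; exact Nk); assert (Pl : 0 < Cmod l) by (apply Cmod_gt_0; exact Nl).
  assert (S : forall m a b, 0 < m -> sqrt ((m * a) ^ 2 + (m * b) ^ 2) = m * sqrt (b ^ 2 + a ^ 2)).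
  { intros m a b Hm; replace ((m * a) ^ 2 + (m * b) ^ 2) with (m * m * (b ^ 2 + a ^ 2)) by ring.
    rewrite sqrt_mult by nra; rewrite sqrt_square by lra; reflexivity. }
  rewrite !S by assumption; fold (hnorm p) (hnorm q).
  pose proof (hnorm_pos p); pose proof (hnorm_pos q); unfold hnorm in *; field; lra.
Qed.

Lemma hnorm_Fin_ge1 z : 1 <= hnorm (Fin z).
Proof.
  rewrite <- sqrt_1; apply sqrt_le_1_alt; simpl; rewrite Cmod_1; pose proof (pow2_ge_0 (Cmod z)) as H; simpl in H; lra.
Qed.

Lemma hc_Fin z w : half_chord (Fin z) (Fin w) * (hnorm (Fin z) * hnorm (Fin w)) = Cmod (z - w).
Proof.
  rewrite hc_hom; simpl hnum; simpl hden; replace (z * 1 - w * 1)%C with (z - w)%C by ring.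
  pose proof (hnorm_pos (Fin z)); pose proof (hnorm_pos (Fin w)); field; lra.
Qed.

Lemma hnorm_Fin_le z B : Cmod z <= B -> hnorm (Fin z) <= 1 + B.
Proof.
  intros H; pose proof (Cmod_ge_0 z); rewrite <- (sqrt_square (1 + B)) by lra; apply sqrt_le_1_alt; simpl; rewrite Cmod_1; nra.
Qed.

Lemma hc_le_Cmod z w : half_chord (Fin z) (Fin w) <= Cmod (z - w).
Proof.
  rewrite <- hc_Fin; pose proof (hc_ge0 (Fin z) (Fin w)); pose proof (hnorm_Fin_ge1 z); pose proof (hnorm_Fin_ge1 w).
  assert (1 * 1 <= hnorm (Fin z) * hnorm (Fin w)) by (apply Rmult_le_compat; lra); nra.
Qed.

Lemma Cmod_le_hc z w B : Cmod z <= B -> Cmod w <= B -> Cmod (z - w) <= half_chord (Fin z) (Fin w) * ((1 + B) * (1 + B)).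
Proof.
  intros Hz Hw; rewrite <- hc_Fin; apply Rmult_le_compat_l; [apply hc_ge0|].
  pose proof (hnorm_pos (Fin z)); pose proof (hnorm_pos (Fin w)).
  apply Rmult_le_compat; try lra; apply hnorm_Fin_le; assumption.
Qed.

(** The chordal distance to [Inf] decreases with the modulus; [d] is the
    difference of these distances for moduli [|w|] and [|w| + 1]. *)
Lemma hc_near_Fin w : exists d, 0 < d /\ forall p, half_chord p (Fin w) < d ->
  exists v, p = Fin v /\ Cmod v <= Cmod w + 1.
Proof.
  pose proof (Cmod_ge_0 w) as Hw.
  exists (half_chord (Fin w) Inf - half_chord (Fin (RtoC (Cmod w + 1))) Inf); split.
  - simpl; rewrite !Cmod_R, !Rmult_1_r, Rabs_pos_eq by lra.
    assert (sqrt (1 + Cmod w * Cmod w) < sqrt (1 + (Cmod w + 1) * (Cmod w + 1))) by (apply sqrt_lt_1_alt; nra).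
    assert (0 < sqrt (1 + Cmod w * Cmod w)) by (apply sqrt_lt_R0; nra).
    unfold Rdiv; rewrite !Rmult_1_l; assert (/ sqrt (1 + (Cmod w + 1) * (Cmod w + 1)) < / sqrt (1 + Cmod w * Cmod w)); [|lra].
    apply Rinv_lt_contravar; nra.
  - intros p Hp; pose proof (hc_tri (Fin w) Inf p) as T; rewrite (hc_sym (Fin w) p) in T.
    destruct p as [v|].
    + exists v; split; [reflexivity|]; apply Rnot_lt_le; intros L.
      assert (half_chord (Fin v) Inf <= half_chord (Fin (RtoC (Cmod w + 1))) Inf); [|lra].
      simpl; rewrite !Cmod_R, !Rmult_1_r, Rabs_pos_eq by lra; unfold Rdiv; rewrite !Rmult_1_l.
      apply Rinv_le_contravar; [apply sqrt_lt_R0; nra|apply sqrt_le_1_alt; nra].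
    + rewrite hc_refl in T; exfalso.
      pose proof (hc_ge0 (Fin (RtoC (Cmod w + 1))) Inf); lra.
Qed.

(** * Compactness of the sphere and the theorem of Ascoli *)

Definition extr (phi : nat -> nat) : Prop := forall n, (phi n < phi (S n))%nat.

Lemma extr_ge phi n : extr phi -> (n <= phi n)%nat.
Proof. intros H; induction n as [|n IH]; [lia|specialize (H n); lia]. Qed.

Lemma extr_mono phi n m : extr phi -> (n <= m)%nat -> (phi n <= phi m)%nat.
Proof. intros H; induction 1 as [|m _ IH]; [lia|specialize (H m); lia]. Qed.

Lemma extr_comp phi psi : extr phi -> extr psi -> extr (fun n => phi (psi n)).
Proof.
  intros H K n; apply Nat.lt_le_trans with (phi (S (psi n))); [apply H|apply extr_mono; [exact H|apply K]].
Qed.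

Lemma extraction (P : nat -> nat -> Prop) : (forall k N, exists p, (N <= p)%nat /\ P k p) ->
  exists phi, extr phi /\ forall k, P k (phi k).
Proof.
  intros H; pose (f := fun k N => proj1_sig (constructive_indefinite_description _ (H k N))).
  assert (Hf : forall k N, (N <= f k N)%nat /\ P k (f k N)) by (intros k N; unfold f; destruct constructive_indefinite_description; assumption).
  pose (phi := fix phi n := match n with O => f O O | S n => f (S n) (S (phi n)) end).
  exists phi; split; [intros n; apply (Hf (S n) (S (phi n)))|intros [|k]; apply Hf].
Qed.

Definition hcvg (u : nat -> Csph) (l : Csph) : Prop :=
  forall eps, 0 < eps -> exists N, forall n, (N <= n)%nat -> half_chord (u n) l < eps.

Lemma inv_S_small e : 0 < e -> exists N, forall n, (N <= n)%nat -> / INR (S n) < e.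
Proof.
  intros He; destruct (archimed_cor1 e He) as [m [M1 M2]]; exists m; intros n Hn.
  eapply Rle_lt_trans; [|exact M1]; apply Rinv_le_contravar; [apply lt_0_INR; lia|apply le_INR; lia].
Qed.

Lemma inv_S_pos n : 0 < / INR (S n).
Proof. apply Rinv_0_lt_compat, lt_0_INR; lia. Qed.

Lemma bw_R (u : nat -> R) B : (forall n, Rabs (u n) <= B) ->
  exists phi l, extr phi /\ forall eps, 0 < eps -> exists N, forall n, (N <= n)%nat -> Rabs (u (phi n) - l) < eps.
Proof.
  intros HB; destruct (Bolzano_Weierstrass u (fun c => - B <= c <= B) (compact_P3 (- B) B)) as [l Hl].
  - intros n; specialize (HB n); apply Rabs_le_between in HB; exact HB.
  - destruct (extraction (fun k p => Rabs (u p - l) < / INR (S k))) as [phi [H1 H2]].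
    + intros k N; destruct (Hl (Rtopology.disc l (mkposreal _ (inv_S_pos k))) N) as [p [P1 P2]].
      * exists (mkposreal _ (inv_S_pos k)); intros x Hx; exact Hx.
      * exists p; split; [exact P1|exact P2].
    + exists phi, l; split; [exact H1|]; intros e He; destruct (inv_S_small e He) as [N HN].
      exists N; intros n Hn; specialize (H2 n); specialize (HN n Hn); lra.
Qed.

Lemma bw_C (u : nat -> C) B : (forall n, Cmod (u n) <= B) -> exists phi l, extr phi /\ cvg (fun n => u (phi n)) l.
Proof.
  intros HB.
  destruct (bw_R (fun n => fst (u n)) B) as [phi [x [P1 P2]]].
  { intros n; eapply Rle_trans; [apply re_le_Cmod|apply HB]. }
  destruct (bw_R (fun n => snd (u (phi n))) B) as [psi [y [Q1 Q2]]].
  { intros n; eapply Rle_trans; [eapply Rle_trans; [apply Rmax_r|apply Rmax_Cmod]|apply HB]. }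
  exists (fun n => phi (psi n)), (x, y); split; [apply extr_comp; assumption|].
  intros e He; destruct (P2 (e / 2) ltac:(lra)) as [N HN]; destruct (Q2 (e / 2) ltac:(lra)) as [M HM].
  exists (Nat.max N M); intros n Hn; specialize (HM n ltac:(lia)).
  specialize (HN (psi n) ltac:(pose proof (extr_ge psi n Q1); lia)).
  replace (u (phi (psi n)) - (x, y))%C with (RtoC (fst (u (phi (psi n))) - x) + Ci * RtoC (snd (u (phi (psi n))) - y))%C
    by (apply injective_projections; simpl; ring).
  eapply Rle_lt_trans; [apply Cmod_triangle|]; rewrite Cmod_mult, Cmod_Ci, !Cmod_R; lra.
Qed.

(** One of the two unit discs around 0 and infinity contains infinitely many
    terms. *)
Lemma bw_sphere (u : nat -> Csph) : exists phi l, extr phi /\ hcvg (fun n => u (phi n)) l.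
Proof.
  assert (K : forall v : nat -> Csph, (forall N, exists p, (N <= p)%nat /\ exists z, v p = Fin z /\ Cmod z <= 1) ->
    exists phi l, extr phi /\ hcvg (fun n => v (phi n)) l).
  { intros v Hv; destruct (extraction (fun _ p => exists z, v p = Fin z /\ Cmod z <= 1)) as [phi [P1 P2]].
    { intros _ N; apply Hv. }
    pose (z := fun n => finval (v (phi n))).
    assert (Ez : forall n, v (phi n) = Fin (z n) /\ Cmod (z n) <= 1).
    { intros n; destruct (P2 n) as [w [E W]]; unfold z; rewrite E; auto. }
    destruct (bw_C z 1 (fun n => proj2 (Ez n))) as [psi [l [Q1 Q2]]].
    exists (fun n => phi (psi n)), (Fin l); split; [apply extr_comp; assumption|].
    intros e He; destruct (Q2 e He) as [N HN]; exists N; intros n Hn.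
    rewrite (proj1 (Ez (psi n))); eapply Rle_lt_trans; [apply hc_le_Cmod|apply HN, Hn]. }
  destruct (classic (forall N, exists p, (N <= p)%nat /\ exists z, u p = Fin z /\ Cmod z <= 1)) as [H|H]; [apply K, H|].
  destruct (K (fun n => sinv (u n))) as [phi [l [P1 P2]]].
  - apply not_all_ex_not in H; destruct H as [N0 H]; intros N.
    exists (Nat.max N N0); split; [lia|].
    destruct (u (Nat.max N N0)) as [z|] eqn:E.
    + assert (Z : 1 < Cmod z).
      { apply Rnot_le_lt; intros L; apply H; exists (Nat.max N N0); split; [lia|]; exists z; auto. }
      assert (Nz : z <> RtoC 0) by (apply Cmod_gt_0; lra).
      exists (/ z)%C; split; [apply sinv_Fin, Nz|rewrite Cmod_inv by exact Nz].
      rewrite <- Rinv_1; apply Rinv_le_contravar; lra.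
    + exists (RtoC 0); split; [reflexivity|rewrite Cmod_0; lra].
  - exists phi, (sinv l); split; [exact P1|]; intros e He; destruct (P2 e He) as [N HN]; exists N; intros n Hn.
    rewrite <- hc_sinv, sinv_sinv; apply HN, Hn.
Qed.

(** Cantor's diagonal sequence. *)
Lemma diagonal (x : nat -> nat -> Csph) : exists phi, extr phi /\ forall j, exists l, hcvg (fun n => x j (phi n)) l.
Proof.
  assert (St : forall j (s : {s | extr s}), exists t : {t | extr t}, exists l,
     hcvg (fun n => x j (proj1_sig s (proj1_sig t n))) l).
  { intros j [s Hs]; destruct (bw_sphere (fun n => x j (s n))) as [t [l [Ht Hl]]].
    exists (exist _ t Ht), l; exact Hl. }
  pose (tau := fun j s => proj1_sig (constructive_indefinite_description _ (St j s))).
  assert (Htau : forall j s, exists l, hcvg (fun n => x j (proj1_sig s (proj1_sig (tau j s) n))) l).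
  { intros j s; unfold tau; destruct constructive_indefinite_description as [t [l Hl]]; exists l; exact Hl. }
  pose (nx := fun j (s : {s | extr s}) =>
    exist extr (fun n => proj1_sig s (proj1_sig (tau j s) n)) (extr_comp _ _ (proj2_sig s) (proj2_sig (tau j s)))).
  pose (sg := fix sg j := match j with O => exist extr (fun n => n) (fun n => Nat.lt_succ_diag_r n) | S j => nx j (sg j) end).
  exists (fun n => proj1_sig (sg n) n); split.
  - intros n; change (proj1_sig (sg (S n)) (S n)) with (proj1_sig (sg n) (proj1_sig (tau n (sg n)) (S n))).
    apply Nat.lt_le_trans with (proj1_sig (sg n) (S n)); [apply (proj2_sig (sg n))|].
    apply extr_mono; [apply (proj2_sig (sg n))|apply extr_ge, (proj2_sig (tau n (sg n)))].
  - intros j; destruct (Htau j (sg j)) as [l Hl]; exists l.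
    assert (Q : forall d n, exists m, (n <= m)%nat /\ proj1_sig (sg (d + S j)%nat) n = proj1_sig (sg (S j)) m).
    { induction d as [|d IH]; intros n; [exists n; split; [lia|reflexivity]|].
      destruct (IH (proj1_sig (tau (d + S j)%nat (sg (d + S j)%nat)) n)) as [m [M1 M2]].
      exists m; split; [|exact M2].
      pose proof (extr_ge _ n (proj2_sig (tau (d + S j)%nat (sg (d + S j)%nat)))); lia. }
    intros e He; destruct (Hl e He) as [N HN]; exists (Nat.max N (S j)); intros n Hn.
    destruct (Q (n - S j)%nat n) as [m [M1 M2]]; replace (n - S j + S j)%nat with n in M2 by lia.
    rewrite M2; apply (HN m); lia.
Qed.

Definition ratseq (n : nat) : R :=
  let (a, b) := of_nat n in let (c, d) := of_nat a in (INR c - INR d) / INR (S b).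
(** The rational points, enumerated by means of the pairing function. *)
Definition denseq (n : nat) : C := let (a, b) := of_nat n in (ratseq a, ratseq b).

Lemma ratseq_dense x e : 0 < e -> exists n, Rabs (ratseq n - x) < e.
Proof.
  intros He; destruct (inv_S_small e He) as [b Hb]; specialize (Hb b (le_n b)).
  set (y := x * INR (S b)); pose proof (archimed y) as [A1 A2].
  assert (Z : exists c d, IZR (up y) = INR c - INR d).
  { destruct (Z_le_dec 0 (up y)).
    - exists (Z.to_nat (up y)), 0%nat; rewrite INR_IZR_INZ, Z2Nat.id by assumption; simpl; ring.
    - exists 0%nat, (Z.to_nat (- up y)); rewrite (INR_IZR_INZ (Z.to_nat (- up y))), Z2Nat.id, opp_IZR by lia; simpl; ring. }
  destruct Z as [c [d E]]; exists (to_nat (to_nat (c, d), b)).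
  unfold ratseq; rewrite !cancel_of_to, <- E.
  assert (P : 0 < INR (S b)) by (apply lt_0_INR; lia).
  replace (IZR (up y) / INR (S b) - x) with ((IZR (up y) - y) * / INR (S b)) by (unfold y; field; lra).
  rewrite Rabs_mult, (Rabs_pos_eq (/ _)) by (left; apply inv_S_pos).
  pose proof (inv_S_pos b); apply Rle_lt_trans with (1 * / INR (S b)); [|lra].
  apply Rmult_le_compat_r; [lra|apply Rabs_le; lra].
Qed.

Lemma denseq_dense z e : 0 < e -> exists n, disc z e (denseq n).
Proof.
  intros He; destruct (ratseq_dense (fst z) (e / 2) ltac:(lra)) as [a Ha].
  destruct (ratseq_dense (snd z) (e / 2) ltac:(lra)) as [b Hb].
  exists (to_nat (a, b)); unfold denseq; rewrite cancel_of_to; unfold disc.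
  replace ((ratseq a, ratseq b) - z)%C with (RtoC (ratseq a - fst z) + Ci * RtoC (ratseq b - snd z))%C
    by (apply injective_projections; simpl; ring).
  eapply Rle_lt_trans; [apply Cmod_triangle|]; rewrite Cmod_mult, Cmod_Ci, !Cmod_R; lra.
Qed.

Lemma hc_complete u : (forall eps, 0 < eps -> exists N, forall n m, (N <= n)%nat -> (N <= m)%nat -> half_chord (u n) (u m) < eps) ->
  exists l, hcvg u l.
Proof.
  intros H; destruct (bw_sphere u) as [phi [l [P1 P2]]]; exists l; intros e He.
  destruct (H (e / 2) ltac:(lra)) as [N HN]; destruct (P2 (e / 2) ltac:(lra)) as [M HM].
  exists N; intros n Hn; set (k := Nat.max N M).
  specialize (HM k ltac:(lia)); specialize (HN n (phi k) Hn ltac:(pose proof (extr_ge phi k P1); lia)).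
  pose proof (hc_tri (u n) l (u (phi k))); lra.
Qed.

(** The quantitative equicontinuity that a bound for the spherical derivatives
    yields. *)
Definition equi_lip (u : nat -> C -> Csph) (z : C) (d : R) : Prop :=
  exists L N, 0 <= L /\ forall n, (N <= n)%nat -> forall x y, disc z d x -> disc z d y -> half_chord (u n x) (u n y) <= L * Cmod (x - y).

Definition hunif (u : nat -> C -> Csph) (g : C -> Csph) (z : C) (d : R) : Prop :=
  forall eps, 0 < eps -> exists N, forall n, (N <= n)%nat -> forall w, disc z d w -> half_chord (u n w) (g w) < eps.

Definition hcts (g : C -> Csph) (z : C) : Prop :=
  forall eps, 0 < eps -> exists d, 0 < d /\ forall w, disc z d w -> half_chord (g w) (g z) < eps.

(** A subsequence that converges on a countable dense set converges at every
    point of equicontinuity, and uniformly nearby. One subsequence serves all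
    these points at once, so that no exhaustion of the domain by compact sets
    is needed. *)
Theorem ascoli (u : nat -> C -> Csph) : exists phi g, extr phi /\
  forall z, (exists d, 0 < d /\ equi_lip u z d) -> hcts g z /\ exists d, 0 < d /\ hunif (fun n => u (phi n)) g z d.
Proof.
  destruct (diagonal (fun j n => u n (denseq j))) as [phi [Hphi Hd]].
  assert (Pt : forall z, exists l, (exists d, 0 < d /\ equi_lip u z d) -> hcvg (fun n => u (phi n) z) l).
  { intros z; destruct (classic (exists d, 0 < d /\ equi_lip u z d)) as [[d [Pd [L [N [PL H]]]]]|K].
    2:{ exists Inf; intros Q; elim K; exact Q. }
    assert (Q : exists l, hcvg (fun n => u (phi n) z) l).
    { apply hc_complete; intros e He.
      destruct (denseq_dense z (Rmin d (e / (4 * (L + 1))))) as [j Hj].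
      { apply Rmin_glb_lt; [exact Pd|apply Rdiv_lt_0_compat; lra]. }
      assert (D1 : disc z d (denseq j)) by exact (disc_minl Hj).
      assert (D2 : disc z (e / (4 * (L + 1))) (denseq j)) by exact (disc_minr Hj).
      unfold disc in D2; apply Rlt_div_r in D2; [|lra].
      destruct (Hd j) as [l Hl]; destruct (Hl (e / 4) ltac:(lra)) as [M HM].
      exists (Nat.max N M); intros n m Hn Hm.
      assert (G : forall k, (Nat.max N M <= k)%nat -> half_chord (u (phi k) z) l < e / 2).
      { intros k Hk; specialize (HM k ltac:(lia)).
        specialize (H (phi k) ltac:(pose proof (extr_ge phi k Hphi); lia) z (denseq j) (disc_center z d Pd) D1).
        pose proof (hc_tri (u (phi k) z) l (u (phi k) (denseq j))); rewrite Cmod_sym in H.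
        pose proof (Cmod_ge_0 (denseq j - z)); nra. }
      pose proof (G n Hn); pose proof (G m Hm) as Gm; rewrite hc_sym in Gm.
      pose proof (hc_tri (u (phi n) z) (u (phi m) z) l); lra. }
    destruct Q as [l Hl]; exists l; intros _; exact Hl. }
  pose (g := fun z => proj1_sig (constructive_indefinite_description _ (Pt z))).
  assert (Hg : forall z, (exists d, 0 < d /\ equi_lip u z d) -> hcvg (fun n => u (phi n) z) (g z)).
  { intros z; unfold g; destruct constructive_indefinite_description; assumption. }
  exists phi, g; split; [exact Hphi|]; intros z [d [Pd EL]].
  assert (Good : forall w, disc z d w -> exists d, 0 < d /\ equi_lip u w d).
  { intros w Hw; destruct (disc_sub z d w Hw) as [s [Ps Sub]]; exists s; split; [exact Ps|].
    destruct EL as [L [N [PL H]]]; exists L, N; split; [exact PL|]; intros n Hn x y Hx Hy; apply H; auto. }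
  destruct EL as [L [N [PL H]]].
  assert (GL : forall x y, disc z d x -> disc z d y -> half_chord (g x) (g y) <= L * Cmod (x - y)).
  { intros x y Hx Hy; apply Rnot_lt_le; intros Lt.
    set (e := (half_chord (g x) (g y) - L * Cmod (x - y)) / 2); assert (He : 0 < e) by (unfold e; lra).
    destruct (Hg x (Good x Hx) e He) as [N1 H1]; destruct (Hg y (Good y Hy) e He) as [N2 H2].
    set (k := Nat.max N (Nat.max N1 N2)); specialize (H1 k ltac:(lia)); specialize (H2 k ltac:(lia)).
    specialize (H (phi k) ltac:(pose proof (extr_ge phi k Hphi); lia) x y Hx Hy).
    pose proof (hc_tri (g x) (g y) (u (phi k) x)) as T1; pose proof (hc_tri (u (phi k) x) (g y) (u (phi k) y)).
    rewrite (hc_sym (g x) (u (phi k) x)) in T1; unfold e in *; lra. }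
  split.
  - intros e He; exists (Rmin d (e / (L + 1))); split; [apply Rmin_glb_lt; [exact Pd|apply Rdiv_lt_0_compat; lra]|].
    intros w Hw; assert (W1 : disc z d w) by exact (disc_minl Hw).
    assert (W2 : disc z (e / (L + 1)) w) by exact (disc_minr Hw).
    unfold disc in W2; apply Rlt_div_r in W2; [|lra].
    pose proof (GL w z W1 (disc_center z d Pd)); pose proof (Cmod_ge_0 (w - z)); nra.
  - exists (d / 2); split; [lra|]; intros e He; apply NNPP; intros HN.
    destruct (extraction (fun _ n => exists w, disc z (d / 2) w /\ e <= half_chord (u (phi n) w) (g w))) as [psi [P1 P2]].
    { intros _ M; apply NNPP; intros K; apply HN; exists M; intros n Hn w Hw; apply Rnot_le_lt; intros Le; apply K.
      exists n; split; [exact Hn|exists w; auto]. }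
    pose (w := fun n => proj1_sig (constructive_indefinite_description _ (P2 n))).
    assert (Hw : forall n, disc z (d / 2) (w n) /\ e <= half_chord (u (phi (psi n)) (w n)) (g (w n))).
    { intros n; unfold w; destruct constructive_indefinite_description; assumption. }
    destruct (bw_C w (Cmod z + d)) as [chi [w0 [C1 C2]]].
    { intros n; destruct (Hw n) as [Hd' _]; unfold disc in Hd'; pose proof (Cmod_ge_sub (w n) z); lra. }
    assert (D0 : disc z d w0).
    { destruct (C2 (d / 4) ltac:(lra)) as [M HM]; specialize (HM M (le_n M)); destruct (Hw (chi M)) as [Hd' _].
      unfold disc in *; pose proof (Cmod_tri3 w0 (w (chi M)) z) as T; rewrite (Cmod_sym w0 (w (chi M))) in T; lra. }
    destruct (C2 (e / (4 * (L + 1))) ltac:(apply Rdiv_lt_0_compat; lra)) as [M1 HM1].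
    destruct (Hg w0 (Good w0 D0) (e / 4) ltac:(lra)) as [M2 HM2].
    set (k := Nat.max N (Nat.max M1 M2)); specialize (HM1 k ltac:(lia)).
    assert (Hck : (k <= psi (chi k))%nat) by (pose proof (extr_ge chi k C1); pose proof (extr_ge psi (chi k) P1); lia).
    specialize (HM2 (psi (chi k)) ltac:(lia)).
    destruct (Hw (chi k)) as [W1 W2].
    assert (W1' : disc z d (w (chi k))) by (eapply disc_le; [|exact W1]; lra).
    specialize (H (phi (psi (chi k))) ltac:(pose proof (extr_ge phi (psi (chi k)) Hphi); lia) (w (chi k)) w0 W1' D0).
    pose proof (GL w0 (w (chi k)) D0 W1') as G2; rewrite Cmod_sym in G2.
    pose proof (hc_tri (u (phi (psi (chi k))) (w (chi k))) (g (w (chi k))) (u (phi (psi (chi k))) w0)).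
    pose proof (hc_tri (u (phi (psi (chi k))) w0) (g (w (chi k))) (g w0)).
    apply Rlt_div_r in HM1; [|lra]; pose proof (Cmod_ge_0 (w (chi k) - w0)); nra.
Qed.

(** * Holomorphic maps to the sphere *)

Definition fin_on (f : C -> Csph) (c : C) (r : R) (h : C -> C) : Prop :=
  hol c r h /\ forall z, disc c r z -> f z = Fin (h z).

Definition sinvf (f : C -> Csph) : C -> Csph := fun z => sinv (f z).

(** A holomorphic map to the sphere. Unlike meromorphy this is closed under
    locally uniform limits, since the constant [Inf] is allowed. *)
Definition sph (f : C -> Csph) (c : C) : Prop :=
  exists r, 0 < r /\ ((exists h, fin_on f c r h) \/ (exists h, fin_on (sinvf f) c r h)).

Lemma sinvf_sinvf f : sinvf (sinvf f) = f.
Proof. apply functional_extensionality; intros z; apply sinv_sinv. Qed.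

Lemma sinv_sinvf f z : f z = sinv (sinvf f z).
Proof. symmetry; apply sinv_sinv. Qed.

Lemma sph_sinvf f c : sph f c -> sph (sinvf f) c.
Proof.
  intros [r [Hr [H|H]]]; exists r; (split; [exact Hr|]); [right; rewrite sinvf_sinvf|left]; exact H.
Qed.

Lemma fin_on_finpart f c r h : fin_on f c r h -> fin_on f c r (finpart f).
Proof.
  intros [H E]; split.
  - apply hol_ext with h; [|exact H]; intros z Hz; unfold finpart; rewrite (E z Hz); reflexivity.
  - intros z Hz; unfold finpart; rewrite (E z Hz); reflexivity.
Qed.

Lemma fin_on_sub f c r h c' r' : (forall z, disc c' r' z -> disc c r z) -> fin_on f c r h -> fin_on f c' r' h.
Proof. intros S [H E]; split; [eapply hol_sub; eassumption|auto]. Qed.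

Lemma finpart_Fin f z w : f z = Fin w -> finpart f z = w.
Proof. unfold finpart; intros ->; reflexivity. Qed.

Lemma not_Inf_Fin f z : f z <> Inf -> f z = Fin (finpart f z).
Proof. unfold finpart; destruct (f z); [reflexivity|intros H; now elim H]. Qed.

Lemma sph_finite f c : sph f c -> f c <> Inf -> exists r, 0 < r /\ fin_on f c r (finpart f).
Proof.
  intros [r [Hr [[h H]|[h [H E]]]]] Hc; [exists r; split; [exact Hr|eapply fin_on_finpart, H]|].
  assert (Nc : h c <> RtoC 0).
  { intros Z; apply Hc; rewrite sinv_sinvf, (E c (disc_center c r Hr)), Z; apply sinv_0. }
  destruct (nonzero_near h c (der_cts _ _ (H c (disc_center c r Hr))) Nc) as [s [Hs N]].
  exists (Rmin r s); split; [pos|].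
  apply fin_on_finpart with (fun z => / h z)%C; split.
  - intros z Hz; apply der_inv; [apply N; exact (disc_minr Hz)|].
    apply H; exact (disc_minl Hz).
  - intros z Hz; rewrite (sinv_sinvf f z).
    rewrite E by exact (disc_minl Hz).
    apply sinv_Fin, N; exact (disc_minr Hz).
Qed.

Lemma sinvf_nonzero f z : f z <> Fin 0 -> sinvf f z <> Inf.
Proof.
  unfold sinvf; destruct (f z) as [w|]; [|intros _; discriminate].
  intros H; rewrite sinv_Fin; [discriminate|intros E; apply H; rewrite E; reflexivity].
Qed.

(** Reduces a statement about the sphere to the case of holomorphic functions,
    if need be after inversion. *)
Lemma sph_cases f c : sph f c -> (f c <> Inf /\ exists r, 0 < r /\ fin_on f c r (finpart f)) \/
  (f c = Inf /\ exists r, 0 < r /\ fin_on (sinvf f) c r (finpart (sinvf f))).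
Proof.
  intros H; destruct (classic (f c = Inf)) as [E|E]; [right|left]; (split; [exact E|]).
  - apply sph_finite; [apply sph_sinvf, H|apply sinvf_nonzero; rewrite E; discriminate].
  - apply sph_finite; assumption.
Qed.

Lemma regular_fin_on f c : regular_point f c <-> exists r, 0 < r /\ fin_on f c r (finpart f).
Proof.
  unfold regular_point; rewrite locally_disc; split; intros [r [Hr H]]; exists r; (split; [exact Hr|]).
  - split; [intros z Hz; apply ex_derive_isd, H, Hz|intros z Hz; apply not_Inf_Fin, H, Hz].
  - intros z Hz; destruct H as [H E]; split; [rewrite (E z Hz); discriminate|apply ex_derive_isd, H, Hz].
Qed.

Lemma regular_sph f c : regular_point f c -> sph f c.
Proof. rewrite regular_fin_on; intros [r [Hr H]]; exists r; split; [exact Hr|left; eexists; exact H]. Qed.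

(** The inverse of [f] is continuous at the pole, so the singularity is
    removable. *)
Lemma pole_sph f c : pole f c -> sph f c.
Proof.
  intros [E [H1 H2]]; apply locally_disc' in H1; destruct H1 as [r [Hr H1]].
  destruct (proj1 (locally_disc' _ _) (H2 0)) as [s [Hs H3]].
  set (t := Rmin r s); assert (Ht : 0 < t) by pos.
  pose (G := finpart (sinvf f)).
  assert (EG : forall z, disc c t z -> z <> c -> f z = Fin (finpart f z) /\ finpart f z <> 0 /\ der (finpart f) z /\ sinvf f z = Fin (/ finpart f z)).
  { intros z Hz Hne; destruct (H1 z) as [A B]; [exact (disc_minl Hz)|exact Hne|].
    assert (N : finpart f z <> 0) by (apply Cmod_gt_0, H3; [exact (disc_minr Hz)|exact Hne]).
    assert (F := not_Inf_Fin f z A).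
    split; [exact F|split; [exact N|split; [apply ex_derive_isd, B|]]].
    unfold sinvf; rewrite F; apply sinv_Fin, N. }
  assert (Gc : G c = 0) by (unfold G, finpart, sinvf; rewrite E; reflexivity).
  assert (Gz : forall z, disc c t z -> z <> c -> G z = (/ finpart f z)%C).
  { intros z Hz Hne; apply finpart_Fin, EG; assumption. }
  exists t; split; [exact Ht|right; exists G; split].
  - apply removable.
    + intros z Hz Hne; apply der_ext_loc with (fun z => / finpart f z)%C.
      * generalize (punctured_open c t z Hz Hne); apply filter_imp; intros w [W1 W2]; symmetry; apply Gz; assumption.
      * destruct (EG z Hz Hne) as [_ [N [Dz _]]]; apply der_inv; assumption.
    + apply cts_eps; intros e He; destruct (proj1 (locally_disc' _ _) (H2 (/ e))) as [q [Hq H4]].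
      exists (Rmin q t); split; [pos|]; intros w Hw; rewrite Gc.
      destruct (classic (w = c)) as [->|Hne]; [rewrite Gc, Cmod_self; exact He|].
      rewrite Gz by first [exact Hne|exact (disc_minr Hw)].
      assert (L := H4 w (disc_minl Hw) Hne).
      assert (Pe : 0 < / e) by (apply Rinv_0_lt_compat, He).
      replace (/ finpart f w - 0)%C with (/ finpart f w)%C by ring; rewrite Cmod_inv by (apply Cmod_gt_0; lra).
      rewrite <- (Rinv_inv e); apply Rinv_lt_contravar; [apply Rmult_lt_0_compat|]; lra.
  - intros z Hz; apply not_Inf_Fin; destruct (classic (z = c)) as [->|Hne].
    + unfold sinvf; rewrite E; discriminate.
    + rewrite (proj2 (proj2 (proj2 (EG z Hz Hne)))); discriminate.
Qed.

(** Where the value is [Inf], the inverse has an isolated zero. *)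
Lemma sph_mero f c : sph f c -> ~ (exists s, 0 < s /\ forall z, disc c s z -> f z = Inf) -> regular_point f c \/ pole f c.
Proof.
  intros H HI; destruct (sph_cases f c H) as [[_ K]|[E [r [Hr [K1 K2]]]]]; [left; apply regular_fin_on, K|right].
  set (G := finpart (sinvf f)) in *.
  assert (Inv : forall z, disc c r z -> f z = sinv (Fin (G z))).
  { intros z Hz; rewrite <- (K2 z Hz); symmetry; apply sinv_sinv. }
  destruct (isolated_zero G c r Hr K1) as [Z|[s [Hs N]]].
  { elim HI; exists r; split; [exact Hr|]; intros z Hz; rewrite (Inv z Hz), (Z z Hz); apply sinv_0. }
  assert (Fz : forall z, disc c s z -> z <> c -> f z = Fin (/ G z)).
  { intros z Hz Hne; rewrite Inv by (eapply disc_le; [|exact Hz]; lra); apply sinv_Fin, N; assumption. }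
  assert (Gc : G c = 0) by (unfold G, finpart, sinvf; rewrite E; reflexivity).
  split; [exact E|split].
  - apply locally_disc'; exists s; split; [lra|]; intros z Hz Hne.
    split; [rewrite Fz by assumption; discriminate|].
    apply ex_derive_isd, der_ext_loc with (fun z => / G z)%C.
    + generalize (punctured_open c s z Hz Hne); apply filter_imp; intros w [W1 W2]; symmetry; apply finpart_Fin, Fz; assumption.
    + apply der_inv; [apply N; assumption|apply K1; eapply disc_le; [|exact Hz]; lra].
  - intros A; apply locally_disc'.
    assert (Pa : 0 < / (1 + Rabs A)) by (apply Rinv_0_lt_compat; pose proof (Rabs_pos A); lra).
    destruct (proj1 (cts_eps _ _) (der_cts _ _ (K1 c (disc_center c r Hr))) _ Pa) as [d [Hd L]].
    exists (Rmin d s); split; [pos|]; intros z Hz Hne.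
    assert (Hzs : disc c s z) by exact (disc_minr Hz).
    rewrite (finpart_Fin f z _ (Fz z Hzs Hne)), Cmod_inv by (apply N; assumption).
    specialize (L z (disc_minl Hz)); rewrite Gc in L.
    replace (G z - 0)%C with (G z) in L by ring.
    assert (P : 0 < Cmod (G z)) by (apply Cmod_gt_0, N; assumption).
    apply Rle_lt_trans with (Rabs A); [apply Rle_abs|].
    apply Rlt_trans with (1 + Rabs A); [lra|]; rewrite <- (Rinv_inv (1 + Rabs A)).
    apply Rinv_lt_contravar; [apply Rmult_lt_0_compat; assumption|exact L].
Qed.

(** * The spherical derivative *)

(** The spherical derivative [|f'| / (1 + |f|^2)] is at most [L]. No condition
    is put at the points where the value is [Inf]; there [sharp_at_zero]
    recovers the bound by continuity. *)
Definition sharp (f : C -> Csph) (L : R) (z : C) : Prop :=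
  forall w, f z = Fin w -> Cmod (C_derive (finpart f) z) <= L * (1 + Cmod w ^ 2).

Lemma derive_sinvf f z w : sph f z -> f z = Fin w -> w <> RtoC 0 ->
  C_derive (finpart (sinvf f)) z = (- C_derive (finpart f) z / (w * w))%C.
Proof.
  intros H E Nw; destruct (sph_finite f z H ltac:(rewrite E; discriminate)) as [r [Hr [H1 H2]]].
  assert (Ew := finpart_Fin f z w E).
  destruct (nonzero_near (finpart f) z (der_cts _ _ (H1 z (disc_center z r Hr))) ltac:(rewrite Ew; exact Nw)) as [s [Hs N]].
  apply isd_C_derive, isd_ext_loc with (fun z => / finpart f z)%C.
  - apply locally_disc; exists (Rmin r s); split; [pos|]; intros y Hy.
    symmetry; apply finpart_Fin; unfold sinvf; rewrite H2 by exact (disc_minl Hy).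
    apply sinv_Fin, N; exact (disc_minr Hy).
  - rewrite <- Ew; apply isd_inv; [rewrite Ew; exact Nw|apply H1, disc_center, Hr].
Qed.

(** The spherical derivative is invariant under inversion, as
    [(1 / f)' = - f' / f^2]. *)
Lemma sharp_sinvf f L z : sph f z -> f z <> Inf -> f z <> Fin 0 -> sharp f L z -> sharp (sinvf f) L z.
Proof.
  intros H Hi H0 Hs v Ev; assert (E := not_Inf_Fin f z Hi); set (w := finpart f z) in *.
  assert (Nw : w <> RtoC 0) by (intros Z; apply H0; rewrite E, Z; reflexivity).
  unfold sinvf in Ev; rewrite E, sinv_Fin in Ev by exact Nw; injection Ev as <-.
  rewrite (derive_sinvf f z w H E Nw), Cmod_div, Cmod_opp, Cmod_mult, Cmod_inv by (try apply Cmult_neq_0; exact Nw).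
  specialize (Hs w E); assert (P : 0 < Cmod w) by (apply Cmod_gt_0; exact Nw).
  apply Rle_div_l; [nra|].
  replace (L * (1 + (/ Cmod w) ^ 2) * (Cmod w * Cmod w)) with (L * (1 + Cmod w ^ 2)) by (field; lra); exact Hs.
Qed.

(** Applied to the inverse of a map with a pole at [c]: the bound holds at the
    points near [c], which are not poles, and passes to the limit. *)
Lemma sharp_at_zero (G : C -> C) c r L : 0 < r -> hol c r G -> G c = 0 -> 0 <= L ->
  (forall z, disc c r z -> G z <> RtoC 0 -> Cmod (C_derive G z) <= L * (1 + Cmod (G z) ^ 2)) -> Cmod (C_derive G c) <= L.
Proof.
  intros Hr H Gc HL HS; destruct (isolated_zero G c r Hr H) as [Z|[s [Hs N]]].
  - rewrite (C_derive_ext c r (fun _ => RtoC 0) G c (disc_center c r Hr) (fun z Hz => eq_sym (Z z Hz)) (hol_const c r 0)).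
    rewrite (isd_C_derive _ _ _ (isd_const 0 c)), Cmod_0; exact HL.
  - apply Rnot_lt_le; intros Hlt; set (e := (Cmod (C_derive G c) - L) / 3).
    assert (He : 0 < e) by (unfold e; lra).
    destruct (proj1 (cts_eps _ _) (derive_cts G c r Hr H) e He) as [d1 [D1 K1]].
    assert (Pm : 0 < Rmin 1 (e / (L + 1))) by (pos).
    destruct (proj1 (cts_eps _ _) (der_cts _ _ (H c (disc_center c r Hr))) _ Pm) as [d2 [D2 K2]].
    destruct (near_point c s (Rmin d1 d2)) as [z [Nzc [Z1 Z2]]]; [lra|pos|].
    assert (Nz : G z <> 0) by (apply N; assumption).
    specialize (HS z (disc_le _ _ _ _ (proj2 Hs) Z1) Nz); specialize (K1 z (disc_minl Z2)); specialize (K2 z (disc_minr Z2)).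
    rewrite Gc in K2; replace (G z - 0)%C with (G z) in K2 by ring.
    pose proof (Rmin_l 1 (e / (L + 1))); pose proof (Rmin_r 1 (e / (L + 1))).
    pose proof (Cmod_ge_0 (G z)).
    assert (Q : L * Cmod (G z) ^ 2 <= e).
    { apply Rle_trans with ((L + 1) * (e / (L + 1))); [|right; field; lra].
      apply Rmult_le_compat; try lra; simpl; nra. }
    pose proof (Cmod_ge_sub (C_derive G c) (C_derive G z)) as T; rewrite Cmod_sym in T; unfold e in *; lra.
Qed.

Lemma hnorm_lip a b : hnorm (Fin a) <= hnorm (Fin b) + Cmod (a - b).
Proof.
  pose proof (hnorm_pos (Fin a)); pose proof (hnorm_pos (Fin b)).
  pose proof (hnorm_sqr (Fin a)) as Sa; pose proof (hnorm_sqr (Fin b)) as Sb; simpl hnum in *; simpl hden in *; rewrite Cmod_1 in *.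
  pose proof (Cmod_ge_0 a); pose proof (Cmod_ge_0 b); pose proof (Cmod_ge_0 (a - b)).
  pose proof (Cmod_triangle b (a - b)) as T; replace (b + (a - b))%C with a in T by ring.
  assert (Cmod b <= hnorm (Fin b)) by (simpl in Sb; nra).
  assert (S1 : hnorm (Fin a) * hnorm (Fin a) <= (hnorm (Fin b) + Cmod (a - b)) * (hnorm (Fin b) + Cmod (a - b))) by (simpl in *; nra).
  apply Rnot_lt_le; intros Lt; nra.
Qed.

(** By definition of the derivative, since [hnorm] is continuous and the
    derivative satisfies the bound [L hnorm^2] at [c]. *)
Lemma local_lip_fin f c r h L : 0 < r -> fin_on f c r h -> 0 <= L -> Cmod (C_derive h c) <= L * (1 + Cmod (h c) ^ 2) ->
  forall e, 0 < e -> exists d, 0 < d /\ forall w, disc c d w -> half_chord (f w) (f c) <= (L + e) * Cmod (w - c).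
Proof.
  intros Hr [H E] HL HS e He; set (eta := e / (1 + L + e)).
  assert (Hm : 0 < eta) by (apply Rdiv_lt_0_compat; lra).
  assert (Hm2 : eta * (1 + L + e) = e) by (unfold eta; field; lra).
  assert (Hm1 : eta < 1) by nra.
  assert (Dc := H c (disc_center c r Hr)).
  destruct (Dc eta Hm) as [d1 [D1 K1]]; destruct (proj1 (cts_eps _ _) (der_cts _ _ Dc) eta Hm) as [d2 [D2 K2]].
  exists (Rmin r (Rmin d1 d2)); split; [pos|]; intros w Hw.
  pose proof (Rmin_l r (Rmin d1 d2)); pose proof (Rmin_r r (Rmin d1 d2)); pose proof (Rmin_l d1 d2); pose proof (Rmin_r d1 d2).
  unfold disc in Hw; specialize (K1 w ltac:(unfold disc; lra)); specialize (K2 w ltac:(unfold disc; lra)).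
  rewrite (E w), (E c) by (unfold disc; rewrite ?Cmod_self; lra).
  pose proof (hc_Fin (h w) (h c)) as X; pose proof (hnorm_lip (h c) (h w)) as Y; rewrite Cmod_sym in Y.
  pose proof (hnorm_Fin_ge1 (h c)) as N1; pose proof (hnorm_sqr (Fin (h c))) as S; simpl hnum in S; simpl hden in S.
  rewrite Cmod_1, pow1 in S.
  set (n := hnorm (Fin (h c))) in *; set (m := hnorm (Fin (h w))) in *; set (q := half_chord (Fin (h w)) (Fin (h c))) in *.
  assert (Hq : 0 <= q) by apply hc_ge0.
  set (t := Cmod (w - c)) in *; assert (Ht : 0 <= t) by apply Cmod_ge_0.
  pose proof (Cmod_triangle (h w - h c - C_derive h c * (w - c)) (C_derive h c * (w - c))) as T.
  replace (h w - h c - C_derive h c * (w - c) + C_derive h c * (w - c))%C with (h w - h c)%C in T by ring.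
  rewrite Cmod_mult in T; fold t in T.
  assert (A1 : Cmod (C_derive h c) * t <= L * (n * n) * t) by (apply Rmult_le_compat_r; [exact Ht|]; rewrite S, Rplus_comm; exact HS).
  assert (A2 : n * (1 - eta) <= m) by nra.
  assert (A3 : q * (n * (1 - eta) * n) <= q * (m * n)) by (apply Rmult_le_compat_l; [exact Hq|apply Rmult_le_compat_r; lra]).
  assert (A4 : eta * t <= eta * t * (n * n)) by (rewrite <- (Rmult_1_r (eta * t)) at 1; apply Rmult_le_compat_l; nra).
  assert (A5 : q * (1 - eta) * (n * n) <= (L + eta) * t * (n * n)) by nra.
  apply Rmult_le_reg_r in A5; [|nra].
  apply Rmult_le_reg_r with (1 - eta); [lra|]; eapply Rle_trans; [exact A5|].
  replace ((L + e) * t * (1 - eta)) with ((L + e - eta * (L + e)) * t) by ring; apply Rmult_le_compat_r; lra.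
Qed.

(** At a pole the inverse is used, the chordal distance being invariant. *)
Lemma local_lip f c r L : 0 <= L -> (forall z, disc c r z -> sph f z /\ sharp f L z) -> forall z, disc c r z ->
  forall e, 0 < e -> exists d, 0 < d /\ forall w, disc z d w -> half_chord (f w) (f z) <= (L + e) * Cmod (w - z).
Proof.
  intros HL H z Hz; destruct (H z Hz) as [Sz Shz].
  destruct (sph_cases f z Sz) as [[Ni [s [Hs K]]]|[Ei [s [Hs K]]]].
  - apply local_lip_fin with s (finpart f); [exact Hs|exact K|exact HL|].
    apply Shz, (proj2 K), disc_center, Hs.
  - destruct (disc_sub c r z Hz) as [t [Ht Sub]]; set (G := finpart (sinvf f)) in *; destruct K as [K1 K2].
    assert (Gz : G z = 0) by (unfold G, finpart, sinvf; rewrite Ei; reflexivity).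
    assert (Q : Cmod (C_derive G z) <= L).
    { apply sharp_at_zero with (Rmin s t); [pos|exact (hol_le z s _ G (Rmin_l s t) K1)|exact Gz|exact HL|].
      intros w Hw Nw; assert (Hws : disc z s w) by exact (disc_minl Hw).
      assert (Hwt : disc z t w) by exact (disc_minr Hw).
      assert (Ew : f w = Fin (/ G w)).
      { rewrite (sinv_sinvf f w); rewrite (K2 w Hws); apply sinv_Fin, Nw. }
      destruct (H w (Sub w Hwt)) as [S1 S2].
      apply (sharp_sinvf f L w S1); [rewrite Ew; discriminate| |exact S2|apply K2, Hws].
      rewrite Ew; intros Z; apply (f_equal finval) in Z; revert Z; apply Cinv_nz, Nw. }
    intros e He; destruct (local_lip_fin (sinvf f) z s G L Hs (conj K1 K2) HL) with (e := e) as [d [Hd D]]; [|exact He|].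
    + rewrite Gz, Cmod_0, pow_i by lia; lra.
    + exists d; split; [exact Hd|]; intros w Hw; rewrite <- hc_sinv; apply D, Hw.
Qed.

(** Subdividing the segment, with the second coordinate of [quartering]
    idle. *)
Lemma lip_of_local (f : C -> Csph) c r L : 0 <= L ->
  (forall z, disc c r z -> forall e, 0 < e -> exists d, 0 < d /\ forall w, disc z d w -> half_chord (f w) (f z) <= (L + e) * Cmod (w - z)) ->
  forall x y, disc c r x -> disc c r y -> half_chord (f x) (f y) <= L * Cmod (x - y).
Proof.
  intros HL H x y Hx Hy; pose proof (Cmod_ge_0 (x - y)) as Hxy.
  assert (K : forall e, 0 < e -> half_chord (f x) (f y) <= (L + e) * Cmod (x - y)).
  { intros e He; pose (p := fun t : R => (x + RtoC t * (y - x))%C).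
    assert (Lip : forall s t, Cmod (p s - p t) = Rabs (s - t) * Cmod (x - y)).
    { intros s t; unfold p; replace (x + RtoC s * (y - x) - (x + RtoC t * (y - x)))%C with (RtoC (s - t) * (y - x))%C by (rewrite RtoC_minus; ring).
      rewrite Cmod_mult, Cmod_R, (Cmod_sym y x); reflexivity. }
    assert (In : forall t, 0 <= t <= 1 -> disc c r (p t)).
    { intros t Ht; unfold disc in *; replace (p t - c)%C with (RtoC (1 - t) * (x - c) + RtoC t * (y - c))%C by (unfold p; rewrite RtoC_minus; ring).
      eapply Rle_lt_trans; [apply Cmod_triangle|]; rewrite !Cmod_mult, !Cmod_R, !Rabs_pos_eq by lra.
      destruct (Req_dec t 0) as [->|]; [lra|]; nra. }
    assert (Q : half_chord (f (p 0)) (f (p 1)) <= (L + e) * ((1 - 0) * Cmod (x - y))).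
    { apply (quartering (fun a b _ _ => half_chord (f (p a)) (f (p b)) <= (L + e) * ((b - a) * Cmod (x - y))) 0 1 0 0); [lra|lra| |].
      - intros a b c' d' _ _ _ _ _ _ Q1 Q2 _ _; pose proof (hc_tri (f (p a)) (f (p b)) (f (p ((a + b) / 2)))) as T.
        replace ((b - a) * Cmod (x - y)) with (((a + b) / 2 - a) * Cmod (x - y) + (b - (a + b) / 2) * Cmod (x - y)) by field.
        rewrite Rmult_plus_distr_l; lra.
      - intros s s' Hs _; destruct (H (p s) (In s Hs) e He) as [d [Hd D]].
        exists (d / (1 + Cmod (x - y))); split; [apply Rdiv_lt_0_compat; lra|].
        intros a b c' d' _ Hab _ _ _ _ Hd1 _; apply Rlt_div_r in Hd1; [|lra].
        assert (Da := D (p a) ltac:(unfold disc; rewrite Lip, Rabs_left1 by lra; nra)).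
        assert (Db := D (p b) ltac:(unfold disc; rewrite Lip, Rabs_pos_eq by lra; nra)).
        rewrite Lip, Rabs_left1 in Da by lra; rewrite Lip, Rabs_pos_eq in Db by lra.
        pose proof (hc_tri (f (p a)) (f (p b)) (f (p s))) as T; rewrite (hc_sym (f (p s))) in T; nra. }
    unfold p in Q; replace (x + RtoC 0 * (y - x))%C with x in Q by ring; replace (x + RtoC 1 * (y - x))%C with y in Q by ring; lra. }
  apply Rnot_lt_le; intros Lt; set (e := (half_chord (f x) (f y) - L * Cmod (x - y)) / (2 * (1 + Cmod (x - y)))).
  assert (He : 0 < e) by (apply Rdiv_lt_0_compat; lra).
  specialize (K e He); assert (E : e * (2 * (1 + Cmod (x - y))) = half_chord (f x) (f y) - L * Cmod (x - y)) by (unfold e; field; lra).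
  nra.
Qed.

(** * Normal families and limits *)

(** The hypothesis of Marty's criterion at the point [z], up to finitely many
    members of the sequence. *)
Definition marty_at (u : nat -> C -> Csph) (z : C) : Prop :=
  exists d L N, 0 < d /\ 0 <= L /\ forall n, (N <= n)%nat -> forall w, disc z d w -> sph (u n) w /\ sharp (u n) L w.

Lemma marty_equi_lip u z : marty_at u z -> exists d, 0 < d /\ equi_lip u z d.
Proof.
  intros [d [L [N [Hd [HL H]]]]]; exists d; split; [exact Hd|]; exists L, N; split; [exact HL|]; intros n Hn.
  apply lip_of_local; [exact HL|]; apply local_lip; [exact HL|apply H, Hn].
Qed.

Definition ev_sph (u : nat -> C -> Csph) (z : C) : Prop :=
  exists d N, 0 < d /\ forall n, (N <= n)%nat -> forall w, disc z d w -> sph (u n) w.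

Definition conv_sph (u : nat -> C -> Csph) (g : C -> Csph) (z : C) : Prop :=
  ev_sph u z /\ hcts g z /\ exists d, 0 < d /\ hunif u g z d.

Lemma conv_sph_sinvf u g z : conv_sph u g z -> conv_sph (fun n => sinvf (u n)) (sinvf g) z.
Proof.
  intros [[d [N [Hd H]]] [Hc [s [Hs HU]]]]; split; [|split].
  - exists d, N; split; [exact Hd|]; intros n Hn w Hw; apply sph_sinvf, H; assumption.
  - intros e He; destruct (Hc e He) as [q [Hq K]]; exists q; split; [exact Hq|]; intros w Hw; unfold sinvf; rewrite hc_sinv; apply K, Hw.
  - exists s; split; [exact Hs|]; intros e He; destruct (HU e He) as [M HM]; exists M; intros n Hn w Hw; unfold sinvf; rewrite hc_sinv; apply HM; assumption.
Qed.

(** Near a point where the limit is finite, spherical convergence is the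
    uniform convergence of holomorphic functions. *)
Lemma conv_sph_fin u g z : conv_sph u g z -> g z <> Inf ->
  conv_at z (fun n => finpart (u n)) (finpart g) /\
  exists r N, 0 < r /\ forall n w, (N <= n)%nat -> disc z r w -> u n w = Fin (finpart (u n) w) /\ g w = Fin (finpart g w).
Proof.
  intros [[d [N [Hd H]]] [Hc [s [Hs HU]]]] Hg; assert (Eg := not_Inf_Fin g z Hg); set (b := finpart g z) in *.
  destruct (hc_near_Fin b) as [q [Hq Near]]; unfold hcts in Hc; rewrite Eg in Hc.
  assert (Hc' : exists r, 0 < r /\ forall w, disc z r w -> half_chord (g w) (Fin b) < q / 2).
  { destruct (Hc (q / 2) ltac:(lra)) as [r [Hr K]]; exists r; split; [exact Hr|]; exact K. }
  destruct Hc' as [r1 [Hr1 K1]]; destruct (HU (q / 2) ltac:(lra)) as [M HM].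
  set (r := Rmin d (Rmin s r1)).
  assert (Hr : 0 < r) by (unfold r; pos).
  assert (R1 : r <= d /\ r <= s /\ r <= r1).
  { unfold r; pose proof (Rmin_l d (Rmin s r1)); pose proof (Rmin_r d (Rmin s r1)); pose proof (Rmin_l s r1); pose proof (Rmin_r s r1); lra. }
  set (B := Cmod b + 1); assert (HB : 0 < B) by (unfold B; pose proof (Cmod_ge_0 b); lra).
  assert (Gb : forall w, disc z r w -> g w = Fin (finpart g w) /\ Cmod (finpart g w) <= B).
  { intros w Hw; destruct (Near (g w)) as [v [E V]].
    - specialize (K1 w ltac:(eapply disc_le; [|exact Hw]; lra)); lra.
    - rewrite (finpart_Fin g w v E); auto. }
  assert (Ub : forall n w, (M <= n)%nat -> disc z r w -> u n w = Fin (finpart (u n) w) /\ Cmod (finpart (u n) w) <= B).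
  { intros n w Hn Hw; destruct (Near (u n w)) as [v [E V]].
    - specialize (K1 w ltac:(eapply disc_le; [|exact Hw]; lra)); specialize (HM n Hn w ltac:(eapply disc_le; [|exact Hw]; lra)).
      pose proof (hc_tri (u n w) (Fin b) (g w)); lra.
    - rewrite (finpart_Fin (u n) w v E); auto. }
  split.
  - exists r; split; [exact Hr|split].
    + exists (Nat.max N M); intros n Hn w Hw.
      destruct (sph_finite (u n) w) as [t [Ht [T _]]].
      * apply H; [lia|eapply disc_le; [|exact Hw]; lra].
      * rewrite (proj1 (Ub n w ltac:(lia) Hw)); discriminate.
      * apply T, disc_center, Ht.
    + intros e He; assert (P : 0 < (1 + B) * (1 + B)) by nra.
      destruct (HU (e / ((1 + B) * (1 + B))) ltac:(apply Rdiv_lt_0_compat; lra)) as [M2 HM2].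
      exists (Nat.max M M2); intros n Hn w Hw; specialize (HM2 n ltac:(lia) w ltac:(eapply disc_le; [|exact Hw]; lra)).
      destruct (Gb w Hw) as [G1 G2]; destruct (Ub n w ltac:(lia) Hw) as [U1 U2]; rewrite G1, U1 in HM2.
      eapply Rle_lt_trans; [apply Cmod_le_hc with (B := B); assumption|apply Rlt_div_r; assumption].
  - exists r, M; split; [exact Hr|]; intros n w Hn Hw; split; [apply (Ub n w Hn Hw)|apply (Gb w Hw)].
Qed.

(** Near a finite point this is Weierstrass' theorem; the other points are
    treated by inversion. *)
Lemma conv_sph_limit u g z : conv_sph u g z -> sph g z.
Proof.
  assert (K : forall u g z, conv_sph u g z -> g z <> Inf -> exists r, 0 < r /\ fin_on g z r (finpart g)).
  { intros u0 g0 z0 H Hg; destruct (conv_sph_fin u0 g0 z0 H Hg) as [A [r [N [Hr B]]]].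
    destruct (conv_at_hol _ _ _ A) as [s [Hs Hh]]; exists (Rmin r s); split; [pos|split].
    - eapply hol_le; [apply Rmin_r|exact Hh].
    - intros w Hw; apply (B N w (le_n N)); exact (disc_minl Hw). }
  intros H; destruct (classic (g z = Inf)) as [E|E].
  - destruct (K _ _ z (conv_sph_sinvf u g z H)) as [r [Hr F]]; [unfold sinvf; rewrite E; discriminate|].
    exists r; split; [exact Hr|right; eexists; exact F].
  - destruct (K u g z H E) as [r [Hr F]]; exists r; split; [exact Hr|left; eexists; exact F].
Qed.

(** The sufficient half of Marty's criterion: bounds for the spherical
    derivatives are Lipschitz bounds for the chordal distance, so that Ascoli's
    theorem applies. *)
Theorem marty u : exists phi g, extr phi /\ forall z, marty_at u z -> conv_sph (fun n => u (phi n)) g z /\ sph g z.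
Proof.
  destruct (ascoli u) as [phi [g [Hphi H]]]; exists phi, g; split; [exact Hphi|]; intros z Hz.
  destruct (H z (marty_equi_lip u z Hz)) as [Hc HU].
  assert (Cv : conv_sph (fun n => u (phi n)) g z).
  { split; [|split; assumption]; destruct Hz as [d [L [N [Hd [_ K]]]]]; exists d, N; split; [exact Hd|].
    intros n Hn w Hw; apply (K (phi n)); [pose proof (extr_ge phi n Hphi); lia|exact Hw]. }
  split; [exact Cv|eapply conv_sph_limit, Cv].
Qed.

(** * Identity theorems *)

Lemma punctured_point w s v t : disc w s v -> 0 < t -> exists x, disc v t x /\ disc w s x /\ x <> w.
Proof.
  intros Hv Ht; destruct (disc_sub w s v Hv) as [q [Hq Sub]].
  destruct (classic (v = w)) as [->|Ne].
  - destruct (near_point w t q Ht Hq) as [x [X1 [X2 X3]]]; exists x; auto.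
  - exists v; repeat split; [apply disc_center, Ht|exact Hv|exact Ne].
Qed.

(** The interior of the set of points with value [Inf] is relatively closed:
    elsewhere such points are isolated zeros of the inverse. *)
Lemma inf_dichotomy D g : connected D -> (forall z, D z -> sph g z) -> meromorphic D g \/ forall z, D z -> g z = Inf.
Proof.
  intros HD HS; pose (A := fun z => exists s, 0 < s /\ forall w, disc z s w -> g w = Inf).
  destruct (classic (exists z, D z /\ A z)) as [K|K]; [right|left].
  - intros z Hz; assert (Az : A z).
    { apply (clopen D A HD); [| |exact K|exact Hz].
      - intros w _ [s [Hs E]]; exists s; split; [exact Hs|]; intros v Hv.
        destruct (disc_sub w s v Hv) as [t [Ht Sub]]; exists t; split; [exact Ht|]; intros x Hx; apply E, Sub, Hx.
      - intros w Hw Nw; destruct (sph_cases g w (HS w Hw)) as [[_ [r [Hr [_ E]]]]|[Ew [r [Hr [H1 E]]]]].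
        + exists r; split; [exact Hr|]; intros v Hv [s [Hs F]]; specialize (F v (disc_center v s Hs)); rewrite (E v Hv) in F; discriminate.
        + destruct (isolated_zero _ w r Hr H1) as [Z|[s [Hs N]]].
          * elim Nw; exists r; split; [exact Hr|]; intros v Hv; rewrite (sinv_sinvf g v); rewrite (E v Hv), (Z v Hv); apply sinv_0.
          * exists s; split; [lra|]; intros v Hv [t [Ht F]].
            destruct (punctured_point w s v t Hv Ht) as [x [X1 [X2 X3]]]; apply (N x X2 X3); unfold finpart, sinvf; rewrite (F x X1); reflexivity. }
    destruct Az as [s [Hs E]]; apply E, disc_center, Hs.
  - intros z Hz; apply sph_mero; [apply HS, Hz|]; intros Az; apply K; exists z; auto.
Qed.

Definition agree_near (g : C -> Csph) (T : C -> C) (z : C) : Prop := exists s, 0 < s /\ forall w, disc z s w -> g w = Fin (T w).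

Lemma agree_near_open g T z : agree_near g T z -> exists r, 0 < r /\ forall w, disc z r w -> agree_near g T w.
Proof.
  intros [s [Hs E]]; exists s; split; [exact Hs|]; intros v Hv.
  destruct (disc_sub z s v Hv) as [t [Ht Sub]]; exists t; split; [exact Ht|]; intros x Hx; apply E, Sub, Hx.
Qed.

(** The set of points near which [g] agrees with [T] is open and closed. Near a
    point with value [Inf] the zeros of [T / g - 1] are considered instead of
    those of [g - T]. *)
Theorem identity_sph g T : (forall z, sph g z) -> entire T -> (exists z, agree_near g T z) -> forall z, g z = Fin (T z).
Proof.
  intros HS HT [z0 H0] z; assert (Az : agree_near g T z).
  { apply (clopen (fun _ => True) (agree_near g T) connected_C); [|clear z| |exact I].
    - intros w _; apply agree_near_open.
    - intros w _ Nw.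
      assert (Iso : forall k r, 0 < r -> hol w r k -> (forall v, disc w r v -> g v = Fin (T v) -> k v = 0) ->
         ((forall v, disc w r v -> k v = 0) -> agree_near g T w) -> exists r, 0 < r /\ forall v, disc w r v -> ~ agree_near g T v).
      { intros k r Hr Hk K1 K2; destruct (isolated_zero k w r Hr Hk) as [Z|[s [Hs N]]]; [elim Nw; apply K2, Z|].
        exists s; split; [lra|]; intros v Hv [t [Ht F]].
        destruct (punctured_point w s v t Hv Ht) as [x [X1 [X2 X3]]]; apply (N x X2 X3), K1; [|apply F, X1].
        eapply disc_le; [|exact X2]; lra. }
      destruct (sph_cases g w (HS w)) as [[_ [r [Hr [H1 E]]]]|[Ew [r [Hr [H1 E]]]]].
      + apply (Iso (fun v => finpart g v - T v)%C r Hr).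
        * apply hol_minus; [exact H1|apply entire_hol, HT].
        * intros v _ Ev; rewrite (finpart_Fin g v _ Ev); ring.
        * intros Z; exists r; split; [exact Hr|]; intros v Hv; rewrite (E v Hv); f_equal; apply Cminus_eq, Z, Hv.
      + apply (Iso (fun v => finpart (sinvf g) v * T v - 1)%C r Hr).
        * apply hol_minus; [apply hol_mult; [exact H1|apply entire_hol, HT]|apply hol_const].
        * intros v Hv Ev; assert (Nz : T v <> 0).
          { intros Z; specialize (E v Hv); unfold sinvf in E; rewrite Ev, Z, sinv_0 in E; discriminate. }
          assert (Ei : sinvf g v = Fin (/ T v)) by (unfold sinvf; rewrite Ev; apply sinv_Fin, Nz).
          rewrite (finpart_Fin _ v _ Ei); field; exact Nz.
        * intros Z; exists r; split; [exact Hr|]; intros v Hv.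
          assert (Q : (finpart (sinvf g) v * T v)%C = 1) by (apply Cminus_eq, Z, Hv).
          assert (Nz : finpart (sinvf g) v <> 0) by (intros Y; rewrite Y in Q; apply C1_nz; rewrite <- Q; ring).
          rewrite (sinv_sinvf g v); rewrite (E v Hv), sinv_Fin by exact Nz.
          f_equal; replace (T v) with (/ finpart (sinvf g) v * (finpart (sinvf g) v * T v))%C by (field; exact Nz); rewrite Q; ring.
    - exists z0; split; [exact I|exact H0]. }
  destruct Az as [s [Hs E]]; apply E, disc_center, Hs.
Qed.

Corollary constant_near g b x d : (forall z, sph g z) -> 0 < d -> (forall w, disc x d w -> g w = Fin b) -> forall z, g z = Fin b.
Proof.
  intros HS Hd H; apply (identity_sph g (fun _ => b) HS (fun z => der_const b z)); exists x, d; auto.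
Qed.

Definition nonconstant (g : C -> Csph) : Prop := ~ exists p, forall z, g z = p.

(** Spherical derivatives at least 1 at a point forbid a constant limit, since
    derivatives converge at the points with finite limit. *)
Lemma nonconstant_limit u g z : conv_sph u g z ->
  (forall n, exists w, u n z = Fin w /\ 1 + Cmod w ^ 2 <= Cmod (C_derive (finpart (u n)) z)) -> nonconstant g.
Proof.
  assert (K : forall u g, conv_sph u g z -> (exists N, forall n, (N <= n)%nat -> 1 <= Cmod (C_derive (finpart (u n)) z)) ->
     ~ exists b, forall z, g z = Fin b).
  { intros u0 g0 H [N HN] [b E]; destruct (conv_sph_fin u0 g0 z H ltac:(rewrite E; discriminate)) as [A _].
    assert (D : C_derive (finpart g0) z = 0).
    { apply isd_C_derive, isd_ext with (fun _ => b); [|apply isd_const].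
      intros w; unfold finpart; rewrite E; reflexivity. }
    destruct (conv_at_pt _ _ _ (conv_at_derive _ _ _ A) (1 / 2) ltac:(lra)) as [M HM].
    specialize (HM (Nat.max N M) ltac:(lia)); specialize (HN (Nat.max N M) ltac:(lia)); rewrite D in HM.
    replace (C_derive (finpart (u0 (Nat.max N M))) z - 0)%C with (C_derive (finpart (u0 (Nat.max N M))) z) in HM by ring; lra. }
  intros H Hu [[b|] E].
  - apply (K u g H); [|exists b; exact E]; exists 0%nat; intros n _; destruct (Hu n) as [w [_ Hw]].
    pose proof (pow2_ge_0 (Cmod w)); lra.
  - assert (H' := conv_sph_sinvf u g z H).
    assert (Ei : forall z, sinvf g z = Fin 0) by (intros w; unfold sinvf; rewrite E; reflexivity).
    apply (K _ _ H'); [|exists (RtoC 0); exact Ei].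
    destruct (conv_sph_fin _ _ z H' ltac:(rewrite Ei; discriminate)) as [_ [r [N [Hr B]]]].
    destruct H as [[d [M [Hd HM]]] _]; exists (Nat.max N M); intros n Hn; destruct (Hu n) as [w [Ew Hw]].
    assert (Nw : w <> RtoC 0).
    { intros Z; destruct (B n z ltac:(lia) (disc_center z r Hr)) as [B1 _]; unfold sinvf in B1 at 1; rewrite Ew, Z, sinv_0 in B1; discriminate. }
    rewrite (derive_sinvf (u n) z w (HM n ltac:(lia) z (disc_center z d Hd)) Ew Nw), Cmod_div, Cmod_opp, Cmod_mult
      by (apply Cmult_neq_0; exact Nw).
    assert (P : 0 < Cmod w) by (apply Cmod_gt_0; exact Nw).
    apply Rle_div_r; [nra|simpl in Hw; lra].
Qed.

(** * Rescaling *)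

(** Otherwise one would move repeatedly to a bad pair of at most half the size,
    at a distance controlled by the size, and converge to a point near which
    there are no bad pairs of small size. The bound [2 rho s0] sums the
    geometric series of the moves. *)
Lemma doubling (B : C -> R -> Prop) rho z0 s0 : 0 < rho -> 0 < s0 -> B z0 s0 ->
  (forall z, Cmod (z - z0) <= 2 * rho * s0 -> exists d, 0 < d /\ forall z' s', disc z d z' -> 0 < s' < d -> ~ B z' s') ->
  exists z1 s1, 0 < s1 <= s0 /\ Cmod (z1 - z0) <= 2 * rho * s0 /\ B z1 s1 /\
    forall z' s', Cmod (z' - z1) <= rho * s1 -> 0 < s' <= s1 / 2 -> ~ B z' s'.
Proof.
  intros Hrho Hs0 HB Hloc; apply NNPP; intros HN.
  pose (Q := fun x : C * R => B (fst x) (snd x) /\ 0 < snd x /\ Cmod (fst x - z0) <= 2 * rho * (s0 - snd x)).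
  assert (St : forall x : {x | Q x}, exists y : {y | Q y}, snd (proj1_sig y) <= snd (proj1_sig x) / 2).
  { intros [[z s] [Q1 [Q2 Q3]]]; simpl in Q1, Q2, Q3; apply NNPP; intros K; apply HN; exists z, s.
    assert (Hss : s <= s0) by (pose proof (Cmod_ge_0 (z - z0)); nra).
    split; [lra|split; [nra|split; [exact Q1|]]]; intros z' s' H1 H2 H3; apply K.
    assert (H : Q (z', s')).
    { split; [exact H3|split; [exact (proj1 H2)|]]; simpl; pose proof (Cmod_tri3 z' z z0); nra. }
    exists (exist _ _ H); simpl; lra. }
  pose (nx := fun x => proj1_sig (constructive_indefinite_description _ (St x))).
  assert (Hnx : forall x, snd (proj1_sig (nx x)) <= snd (proj1_sig x) / 2).
  { intros x; unfold nx; destruct constructive_indefinite_description; assumption. }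
  assert (H0 : Q (z0, s0)) by (split; [exact HB|split; [exact Hs0|simpl; rewrite Cmod_self; lra]]).
  pose (sq := fun n => proj1_sig (Nat.iter n nx (exist _ _ H0))).
  assert (HQ : forall n, Q (sq n)) by (intros n; apply proj2_sig).
  assert (Hs : forall n, snd (sq n) <= s0 * (/ 2) ^ n).
  { induction n as [|n IH]; [simpl; lra|].
    pose proof (Hnx (Nat.iter n nx (exist _ _ H0))) as K.
    change (snd (sq (S n)) <= snd (sq n) / 2) in K; simpl pow; lra. }
  destruct (bw_C (fun n => fst (sq n)) (Cmod z0 + 2 * rho * s0)) as [phi [l [P1 P2]]].
  { intros n; destruct (HQ n) as [_ [Q2 Q3]]; pose proof (Cmod_ge_sub (fst (sq n)) z0); nra. }
  destruct (Hloc l) as [d [Hd K]].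
  { apply Rnot_lt_le; intros Lt; destruct (P2 (Cmod (l - z0) - 2 * rho * s0) ltac:(lra)) as [N HN'].
    specialize (HN' N (le_n N)); destruct (HQ (phi N)) as [_ [Q2 Q3]].
    pose proof (Cmod_tri3 l (fst (sq (phi N))) z0) as T; rewrite (Cmod_sym l (fst (sq (phi N)))) in T; nra. }
  destruct (P2 d Hd) as [N1 HN1].
  destruct (pow_lt_1_zero (/ 2) ltac:(rewrite Rabs_pos_eq; lra) (d / s0) ltac:(apply Rdiv_lt_0_compat; lra)) as [N2 HN2].
  set (n := Nat.max N1 N2); specialize (HN1 n ltac:(lia)); specialize (HN2 (phi n) ltac:(pose proof (extr_ge phi n P1); lia)).
  rewrite Rabs_pos_eq in HN2 by (apply pow_le; lra); apply Rlt_div_r in HN2; [|exact Hs0].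
  destruct (HQ (phi n)) as [Q1 [Q2 _]]; apply (K _ (snd (sq (phi n))) HN1); [|exact Q1].
  specialize (Hs (phi n)); lra.
Qed.

(** The pair [(z, s)] is bad when [(f (z + s .) - a) / s^k] has spherical
    derivative greater than 1 at [0]. *)
Definition bad (k : nat) (a : C) (f : C -> Csph) (z : C) (s : R) : Prop :=
  exists w, f z = Fin w /\ s ^ (2 * k) + Cmod (w - a) ^ 2 < s ^ S k * Cmod (C_derive (finpart f) z).

Lemma zero_structure f c a : sph f c -> f c = Fin a ->
  (exists r, 0 < r /\ forall z, disc c r z -> f z = Fin a) \/
  exists p r H, zero_multiplicity f a c (S p) /\ 0 < r /\ hol c r H /\ H c <> 0 /\
    forall z, disc c r z -> f z = Fin (a + (z - c) ^ S p * H z).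
Proof.
  intros Hs E; destruct (sph_finite f c Hs ltac:(rewrite E; discriminate)) as [r [Hr [K1 K2]]].
  assert (Ec := finpart_Fin f c a E).
  destruct (zero_order (fun z => finpart f z - a)%C c r Hr (hol_minus _ _ _ _ K1 (hol_const _ _ _))) as [Z|[p [H [H1 [H2 H3]]]]].
  - left; exists r; split; [exact Hr|]; intros z Hz; rewrite (K2 z Hz); f_equal; apply Cminus_eq, Z, Hz.
  - right; destruct p as [|p].
    { exfalso; apply H2; specialize (H3 c (disc_center c r Hr)); simpl in H3; rewrite Ec in H3.
      replace (H c) with (1 * H c)%C by ring; rewrite <- H3; ring. }
    assert (F : forall z, disc c r z -> f z = Fin (a + (z - c) ^ S p * H z)).
    { intros z Hz; rewrite (K2 z Hz); f_equal; rewrite <- (H3 z Hz); ring. }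
    exists p, r, H; repeat split; auto; exists H; split; [|split; [exact H2|]]; apply locally_disc; exists r; split; auto.
    intros z Hz; apply ex_derive_isd, H1, Hz.
Qed.

Lemma pow_le_self s n : 0 < s <= 1 -> s ^ S n <= s.
Proof.
  intros Hs; assert (s ^ n <= 1) by (rewrite <- (pow1 n); apply pow_incr; lra).
  simpl; nra.
Qed.

(** The left side bounds the derivative, and the right side the value, near a
    zero of order [p = k + d + 1]. If the inequality failed, comparing with
    each summand on the right would give [s^(k-1) < M x^(p-1)] and
    [x^(p+1) <= (M / eta^2) s^(k+1)]. Eliminating [x] leaves the power [(k + 1)
    (p - 1) - (k - 1) (p + 1) = 2 (p - k) > 0] of [s], which is small. For
    [k = 0] the first summand alone suffices. *)
Lemma zero_estimate k d M eta : 0 < M -> 0 < eta -> exists delta, 0 < delta /\ forall s x, 0 < s < delta -> 0 <= x <= 1 ->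
  s ^ S k * (M * x ^ (k + d)) <= s ^ (2 * k) + (eta * x ^ S (k + d)) ^ 2.
Proof.
  intros HM He; destruct k as [|k].
  - exists (Rmin 1 (/ M)); split; [apply Rmin_glb_lt; [lra|apply Rinv_0_lt_compat, HM]|].
    intros s x Hs Hx; pose proof (Rmin_l 1 (/ M)); pose proof (Rmin_r 1 (/ M)).
    assert (x ^ (0 + d) <= 1) by (rewrite <- (pow1 (0 + d)); apply pow_incr; lra).
    assert (0 <= x ^ (0 + d)) by (apply pow_le; lra).
    pose proof (pow2_ge_0 (eta * x ^ S (0 + d))).
    assert (s * M <= 1) by (apply Rle_trans with (/ M * M); [apply Rmult_le_compat_r; lra|right; field; lra]).
    assert (s * (M * x ^ (0 + d)) <= 1) by nra.
    replace (s ^ 1) with s by ring; replace (s ^ (2 * 0)) with 1 by reflexivity; lra.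
  - set (D := M ^ (k + 3 + d) * (M / (eta * eta)) ^ (k + 1 + d)).
    assert (He2 : 0 < eta * eta) by nra.
    assert (HMe : 0 < M / (eta * eta)) by (apply Rdiv_lt_0_compat; lra).
    assert (HD : 0 < D) by (apply Rmult_lt_0_compat; apply pow_lt; assumption).
    exists (Rmin 1 (/ D)); split; [apply Rmin_glb_lt; [lra|apply Rinv_0_lt_compat, HD]|].
    intros s x Hs Hx; pose proof (Rmin_l 1 (/ D)); pose proof (Rmin_r 1 (/ D)).
    apply Rnot_lt_le; intros Lt.
    set (Y := x ^ (S k + d)) in *; assert (HY : 0 <= Y) by (apply pow_le; lra).
    assert (Sk : forall n, 0 < s ^ n) by (intros n; apply pow_lt; lra).
    replace (2 * S k)%nat with (k + S (S k))%nat in Lt by lia; rewrite pow_add in Lt.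
    pose proof (pow2_ge_0 (eta * x ^ S (S k + d))); pose proof (Sk k); pose proof (Sk (S (S k))).
    assert (I1 : s ^ k < M * Y).
    { apply Rmult_lt_reg_r with (s ^ S (S k)); [apply Sk|]; nra. }
    assert (PY : 0 < Y) by nra.
    assert (I2 : x ^ (k + 3 + d) <= M / (eta * eta) * s ^ S (S k)).
    { apply Rmult_le_reg_r with (eta * eta * Y); [nra|].
      replace (M / (eta * eta) * s ^ S (S k) * (eta * eta * Y)) with (s ^ S (S k) * (M * Y)) by (field; lra).
      replace (x ^ (k + 3 + d) * (eta * eta * Y)) with ((eta * x ^ S (S k + d)) ^ 2).
      - assert (0 <= s ^ k * s ^ S (S k)) by nra; lra.
      - unfold Y; replace (k + 3 + d)%nat with (2 + (S k + d))%nat by lia; rewrite pow_add; simpl; ring. }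
    assert (J1 : (s ^ k) ^ (k + 3 + d) <= (M * Y) ^ (k + 3 + d)) by (apply pow_incr; split; [left; apply Sk|lra]).
    assert (J2 : (x ^ (k + 3 + d)) ^ (k + 1 + d) <= (M / (eta * eta) * s ^ S (S k)) ^ (k + 1 + d)).
    { apply pow_incr; split; [apply pow_le; lra|exact I2]. }
    rewrite Rpow_mult_distr in J1, J2; unfold Y in J1; rewrite <- !pow_mult in J1; rewrite <- !pow_mult in J2.
    replace ((S k + d) * (k + 3 + d))%nat with ((k + 3 + d) * (k + 1 + d))%nat in J1 by lia.
    replace (S (S k) * (k + 1 + d))%nat with (k * (k + 3 + d) + S (2 * d + 1))%nat in J2 by lia.
    rewrite (pow_add s) in J2; set (T := s ^ (k * (k + 3 + d))) in *.
    assert (HT : 0 < T) by apply Sk.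
    assert (PM : 0 < M ^ (k + 3 + d)) by (apply pow_lt, HM).
    assert (J3 : T <= M ^ (k + 3 + d) * ((M / (eta * eta)) ^ (k + 1 + d) * (T * s ^ S (2 * d + 1)))).
    { eapply Rle_trans; [exact J1|]; apply Rmult_le_compat_l; [lra|exact J2]. }
    assert (L1 : s ^ S (2 * d + 1) <= s) by (apply pow_le_self; lra).
    assert (J4 : T * 1 <= T * (D * s ^ S (2 * d + 1))) by (unfold D; nra).
    apply Rmult_le_reg_l in J4; [|exact HT].
    assert (D * s < 1); [|nra].
    apply Rlt_le_trans with (D * / D); [apply Rmult_lt_compat_l; lra|right; field; lra].
Qed.

(** Near a zero of [f - a] of order greater than [k] this is [zero_estimate].
    Elsewhere [|f - a|] is bounded below, and at a pole it outweighs the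
    derivative: with [G = 1 / f] one has [|f'| = |G'| / |G|^2] and
    [|f - a| >= 1 / (2 |G|)]. *)
Lemma not_bad_near k a f c : sph f c -> (f c = Fin a -> forall p, zero_multiplicity f a c p -> (S k <= p)%nat) ->
  exists d, 0 < d /\ forall z s, disc c d z -> 0 < s < d -> ~ bad k a f z s.
Proof.
  intros Hs Hm; destruct (sph_cases f c Hs) as [[Ni [r [Hr [K1 K2]]]]|[Ei [r [Hr [K1 K2]]]]].
  - destruct (hol_bounded _ c r (r / 2) (hol_derive _ _ _ K1) ltac:(lra)) as [M [PM HM]].
    destruct (classic (f c = Fin a)) as [E|E].
    + specialize (Hm E); destruct (zero_structure f c a Hs E) as [[t [Ht Z]]|[p [t [H [ZM [Ht [H1 [H2 H3]]]]]]]].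
      * exists t; split; [exact Ht|]; intros z s Hz Hs' [w [_ Hw]].
        assert (D : C_derive (finpart f) z = 0).
        { rewrite (C_derive_ext c t (fun _ => a) (finpart f) z Hz); [apply isd_C_derive, isd_const| |apply hol_const].
          intros y Hy; symmetry; apply finpart_Fin, Z, Hy. }
        rewrite D, Cmod_0 in Hw; pose proof (pow2_ge_0 (Cmod (w - a))).
        assert (0 < s ^ (2 * k)) by (apply pow_lt; lra); lra.
      * specialize (Hm _ ZM); destruct (Nat.le_exists_sub k p ltac:(lia)) as [d0 [-> _]]; rewrite (Nat.add_comm d0 k) in *.
        destruct (hol_bounded _ c t (t / 2) (hol_plus c t _ _ (hol_mult c t (fun _ => RtoC (INR (S (k + d0)))) H (hol_const _ _ _) H1)
          (hol_mult c t (fun z => z - c)%C _ (fun z _ => der_minus _ _ _ (der_id z) (der_const c z)) (hol_derive _ _ _ H1))) ltac:(lra)) as [M2 [PM2 HM2]].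
        assert (Pe : 0 < Cmod (H c) / 2) by (pose proof (proj1 (Cmod_gt_0 (H c)) H2); lra).
        destruct (proj1 (cts_eps _ _) (der_cts _ _ (H1 c (disc_center c t Ht))) _ Pe) as [q [Hq L]].
        destruct (zero_estimate k d0 M2 (Cmod (H c) / 2) PM2 Pe) as [q2 [Hq2 ZE]].
        exists (Rmin (Rmin q q2) (Rmin (t / 2) 1)); split; [pos|].
        intros z s Hz Hs' [w [Ew Hw]]; unfold disc in Hz.
        pose proof (Rmin_l (Rmin q q2) (Rmin (t / 2) 1)); pose proof (Rmin_r (Rmin q q2) (Rmin (t / 2) 1)).
        pose proof (Rmin_l q q2); pose proof (Rmin_r q q2); pose proof (Rmin_l (t / 2) 1); pose proof (Rmin_r (t / 2) 1).
        assert (Hzt : disc c t z) by (unfold disc; lra).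
        rewrite (H3 z Hzt) in Ew; apply (f_equal finval) in Ew; cbn [finval] in Ew.
        assert (D : C_derive (finpart f) z = ((z - c) ^ (k + d0) * (RtoC (INR (S (k + d0))) * H z + (z - c) * C_derive H z))%C).
        { apply isd_C_derive, isd_ext_loc with (fun z => a + (z - c) ^ S (k + d0) * H z)%C.
          - generalize (disc_open c t z Hzt); apply filter_imp; intros y Hy; symmetry; apply finpart_Fin, H3, Hy.
          - replace ((z - c) ^ (k + d0) * (RtoC (INR (S (k + d0))) * H z + (z - c) * C_derive H z))%C
              with (0 + (RtoC (INR (S (k + d0))) * (z - c) ^ (k + d0) * H z + (z - c) ^ S (k + d0) * C_derive H z))%C by (rewrite Cpow_S; ring).
            apply isd_plus; [apply isd_const|apply (isd_mult (fun z => (z - c) ^ S (k + d0))%C H); [apply isd_pow|apply H1, Hzt]]. }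
        rewrite D, <- Ew, Cmod_mult, Cmod_pow in Hw; revert Hw; apply Rle_not_lt.
        replace (a + (z - c) ^ S (k + d0) * H z - a)%C with (H z * (z - c) ^ S (k + d0))%C by ring.
        rewrite Cmod_mult, Cmod_pow; specialize (HM2 z ltac:(unfold disc; lra)); cbv beta in HM2.
        pose proof (Cmod_ge_0 (z - c)); set (x := Cmod (z - c)) in *.
        specialize (ZE s x ltac:(lra) ltac:(lra)).
        specialize (L z ltac:(unfold disc; fold x; lra)).
        pose proof (Cmod_ge_sub (H c) (H z)) as T; rewrite Cmod_sym in T.
        assert (0 <= x ^ (k + d0)) by (apply pow_le; lra); assert (0 <= x ^ S (k + d0)) by (apply pow_le; lra).
        assert (0 < s ^ S k) by (apply pow_lt; lra).
        eapply Rle_trans; [eapply Rle_trans; [|exact ZE]|].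
        -- apply Rmult_le_compat_l; [lra|]; rewrite (Rmult_comm M2); apply Rmult_le_compat_l; [lra|exact HM2].
        -- apply Rplus_le_compat_l, pow_incr; split; [nra|apply Rmult_le_compat_r; lra].
    + assert (Nb : finpart f c <> a) by (intros Q; apply E; rewrite (not_Inf_Fin f c Ni), Q; reflexivity).
      set (m := Cmod (finpart f c - a) / 2); assert (Pm : 0 < m) by (unfold m; pose proof (Cmod_pos _ _ Nb); lra).
      destruct (proj1 (cts_eps _ _) (der_cts _ _ (K1 c (disc_center c r Hr))) m Pm) as [q [Hq L]].
      assert (Pq : 0 < m * m / M) by (apply Rdiv_lt_0_compat; nra).
      exists (Rmin (Rmin q (r / 2)) (Rmin (m * m / M) 1)); split; [pos|].
      intros z s Hz Hs' [w [Ew Hw]]; unfold disc in Hz.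
      pose proof (Rmin_l (Rmin q (r / 2)) (Rmin (m * m / M) 1)); pose proof (Rmin_r (Rmin q (r / 2)) (Rmin (m * m / M) 1)).
      pose proof (Rmin_l q (r / 2)); pose proof (Rmin_r q (r / 2)); pose proof (Rmin_l (m * m / M) 1); pose proof (Rmin_r (m * m / M) 1).
      specialize (L z ltac:(unfold disc; lra)); specialize (HM z ltac:(unfold disc; lra)); rewrite (finpart_Fin f z w Ew) in L.
      assert (Lw : m <= Cmod (w - a)) by (pose proof (Cmod_tri3 (finpart f c) w a) as T; rewrite (Cmod_sym (finpart f c) w) in T; unfold m in *; lra).
      assert (P1 := pow_le_self s k ltac:(lra)); assert (0 < s ^ S k) by (apply pow_lt; lra); assert (0 < s ^ (2 * k)) by (apply pow_lt; lra).
      pose proof (Cmod_ge_0 (C_derive (finpart f) z)).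
      assert (Q1 : s ^ S k * Cmod (C_derive (finpart f) z) <= s * M) by (apply Rmult_le_compat; lra).
      assert (Q2 : s * M <= m * m) by (apply Rle_div_r; lra).
      assert (Q3 : m * m <= Cmod (w - a) ^ 2) by (replace (Cmod (w - a) ^ 2) with (Cmod (w - a) * Cmod (w - a)) by ring; apply Rmult_le_compat; lra).
      lra.
  - set (G := finpart (sinvf f)) in *.
    assert (Gc : G c = 0) by (unfold G, finpart, sinvf; rewrite Ei; reflexivity).
    destruct (hol_bounded _ c r (r / 2) (hol_derive _ _ _ K1) ltac:(lra)) as [M [PM HM]].
    assert (Pa : 0 < / (2 * Cmod a + 1)) by (apply Rinv_0_lt_compat; pose proof (Cmod_ge_0 a); lra).
    destruct (proj1 (cts_eps _ _) (der_cts _ _ (K1 c (disc_center c r Hr))) _ Pa) as [q [Hq L]].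
    assert (Pq : 0 < / (4 * M)) by (apply Rinv_0_lt_compat; lra).
    exists (Rmin (Rmin q (r / 2)) (Rmin (/ (4 * M)) 1)); split; [pos|].
    intros z s Hz Hs' [w [Ew Hw]]; unfold disc in Hz.
    pose proof (Rmin_l (Rmin q (r / 2)) (Rmin (/ (4 * M)) 1)); pose proof (Rmin_r (Rmin q (r / 2)) (Rmin (/ (4 * M)) 1)).
    pose proof (Rmin_l q (r / 2)); pose proof (Rmin_r q (r / 2)); pose proof (Rmin_l (/ (4 * M)) 1); pose proof (Rmin_r (/ (4 * M)) 1).
    specialize (L z ltac:(unfold disc; lra)); specialize (HM z ltac:(unfold disc; lra)); rewrite Gc in L.
    replace (G z - 0)%C with (G z) in L by ring.
    assert (EG : sinvf f z = Fin (G z)) by (apply K2; unfold disc; lra).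
    assert (Nz : G z <> RtoC 0).
    { intros Z; unfold sinvf in EG; rewrite Ew, Z in EG; apply (f_equal sinv) in EG; rewrite sinv_sinv, sinv_0 in EG; discriminate. }
    assert (Ez : w = (/ G z)%C).
    { assert (EG' := f_equal sinv EG); unfold sinvf in EG'; rewrite sinv_sinv, Ew, sinv_Fin in EG' by exact Nz.
      apply (f_equal finval) in EG'; exact EG'. }
    assert (Sz : sph (sinvf f) z).
    { destruct (disc_sub c r z ltac:(unfold disc; lra)) as [t [Ht Sub]]; exists t; split; [exact Ht|left; exists G].
      apply fin_on_sub with c r; [exact Sub|split; assumption]. }
    assert (D := derive_sinvf (sinvf f) z (G z) Sz EG Nz); rewrite sinvf_sinvf in D.
    rewrite D, Cmod_div, Cmod_opp, Cmod_mult in Hw by (apply Cmult_neq_0; exact Nz).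
    assert (P : 0 < Cmod (G z)) by (apply Cmod_gt_0; exact Nz).
    fold G in Hw; set (x := Cmod (G z)) in *.
    assert (W : / (2 * x) <= Cmod (w - a)).
    { pose proof (Cmod_ge_sub w a) as T; rewrite Ez, Cmod_inv in T by exact Nz; rewrite Ez; fold x in T.
      pose proof (Cmod_ge_0 a).
      assert (A1 : 2 * Cmod a + 1 <= / x) by (rewrite <- (Rinv_inv (2 * Cmod a + 1)); apply Rinv_le_contravar; lra).
      replace (/ (2 * x)) with (/ x / 2) by (field; lra); lra. }
    assert (P1 := pow_le_self s k ltac:(lra)); assert (0 < s ^ S k) by (apply pow_lt; lra); assert (0 < s ^ (2 * k)) by (apply pow_lt; lra).
    assert (Q1 : s ^ S k * (Cmod (C_derive G z) / (x * x)) <= / (4 * M) * (M / (x * x))).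
    { pose proof (Cmod_ge_0 (C_derive G z)); apply Rmult_le_compat; [lra|apply Rle_mult_inv_pos; nra|lra|].
      apply Rmult_le_compat_r; [left; apply Rinv_0_lt_compat; nra|exact HM]. }
    assert (Q2 : / (4 * M) * (M / (x * x)) = / (2 * x) * / (2 * x)) by (field; lra).
    assert (Px : 0 < / (2 * x)) by (apply Rinv_0_lt_compat; lra).
    assert (/ (2 * x) * / (2 * x) <= Cmod (w - a) * Cmod (w - a)) by (apply Rmult_le_compat; lra).
    replace (Cmod (w - a) ^ 2) with (Cmod (w - a) * Cmod (w - a)) in Hw by ring; lra.
Qed.

Definition saff (a t : C) (p : Csph) : Csph := match p with Fin w => Fin ((w - a) / t) | Inf => Inf end.
(** [(f (z + s x) - a) / s^k], extended to poles. *)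
Definition resc (k : nat) (a : C) (f : C -> Csph) (z : C) (s : R) : C -> Csph :=
  fun x => saff a (RtoC (s ^ k)) (f (z + RtoC s * x)%C).

Lemma RtoC_nz x : x <> 0 -> RtoC x <> RtoC 0.
Proof. intros H E; apply H, RtoC_inj, E. Qed.

Lemma disc_affine z (s : R) x c r : disc c r (z + RtoC s * x)%C -> exists t, 0 < t /\ forall y, disc x t y -> disc c r (z + RtoC s * y)%C.
Proof.
  intros H; destruct (disc_sub _ _ _ H) as [t [Ht Sub]].
  exists (t / (1 + Rabs s)); split; [apply Rdiv_lt_0_compat; pose proof (Rabs_pos s); lra|].
  intros y Hy; apply Sub; unfold disc in *.
  replace (z + RtoC s * y - (z + RtoC s * x))%C with (RtoC s * (y - x))%C by ring; rewrite Cmod_mult, Cmod_R.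
  apply Rlt_div_r in Hy; [|pose proof (Rabs_pos s); lra]; pose proof (Cmod_ge_0 (y - x)); nra.
Qed.

Lemma isd_affine z (s : R) x : isd (fun x => z + RtoC s * x)%C x (RtoC s).
Proof.
  pose proof (isd_plus _ _ _ _ _ (isd_const z x) (isd_mult _ _ _ _ _ (isd_const (RtoC s) x) (isd_id x))) as I; cbv beta in I.
  replace (0 + (0 * x + RtoC s * 1))%C with (RtoC s) in I by ring; exact I.
Qed.

Lemma sph_saff a t f c : t <> RtoC 0 -> sph f c -> sph (fun z => saff a t (f z)) c.
Proof.
  intros Nt H; destruct (sph_cases f c H) as [[_ [r [Hr [K1 K2]]]]|[Ei [r [Hr [K1 K2]]]]].
  - exists r; split; [exact Hr|left; exists (fun z => (finpart f z - a) / t)%C; split].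
    + intros z Hz; apply der_div; [exact Nt|apply der_minus; [apply K1, Hz|apply der_const]|apply der_const].
    + intros z Hz; rewrite (K2 z Hz); reflexivity.
  - set (G := finpart (sinvf f)) in *.
    assert (Gc : G c = 0) by (unfold G, finpart, sinvf; rewrite Ei; reflexivity).
    assert (Hd : hol c r (fun z => 1 - a * G z)%C) by (apply hol_minus; [apply hol_const|apply hol_mult; [apply hol_const|exact K1]]).
    destruct (nonzero_near _ c (der_cts _ _ (Hd c (disc_center c r Hr)))) as [s [Hs N]].
    { rewrite Gc; replace (1 - a * 0)%C with (RtoC 1) by ring; exact C1_nz. }
    exists (Rmin r s); split; [pos|right; exists (fun z => t * G z / (1 - a * G z))%C; split].
    + intros z Hz; assert (Z1 : disc c r z) by exact (disc_minl Hz).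
      assert (Z2 : disc c s z) by exact (disc_minr Hz).
      apply (der_div (fun z => t * G z)%C); [apply N, Z2|apply der_mult; [apply der_const|apply K1, Z1]|apply Hd, Z1].
    + intros z Hz; assert (Z1 : disc c r z) by exact (disc_minl Hz).
      assert (Nd := N z (disc_minr Hz)).
      unfold sinvf at 1; rewrite (sinv_sinvf f z), (K2 z Z1).
      destruct (classic (G z = 0)) as [Z|Nz].
      * rewrite Z, sinv_0; simpl saff; simpl sinv; f_equal; field; rewrite Z in Nd; exact Nd.
      * assert (Q : ((/ G z - a) / t)%C <> 0).
        { intros Q; apply Nd; replace (1 - a * G z)%C with ((/ G z - a) / t * (t * G z))%C by (field; auto); rewrite Q; ring. }
        rewrite sinv_Fin by exact Nz; simpl saff; rewrite sinv_Fin by exact Q; f_equal; field; auto.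
Qed.

Lemma sph_affine f z (s : R) x : sph f (z + RtoC s * x)%C -> sph (fun x => f (z + RtoC s * x)%C) x.
Proof.
  intros [r [Hr H]]; destruct (disc_affine z s x _ _ (disc_center _ r Hr)) as [t [Ht Sub]].
  exists t; split; [exact Ht|]; destruct H as [[h [H1 H2]]|[h [H1 H2]]]; [left|right]; exists (fun x => h (z + RtoC s * x)%C);
    (split; [intros y Hy; apply (der_comp h (fun x => z + RtoC s * x)%C); [eapply isd_der, isd_affine|apply H1, Sub, Hy]|
             intros y Hy; apply H2, Sub, Hy]).
Qed.

Lemma sph_resc k a f z s x : 0 < s -> sph f (z + RtoC s * x)%C -> sph (resc k a f z s) x.
Proof.
  intros Hs H; apply (sph_saff a (RtoC (s ^ k)) (fun x => f (z + RtoC s * x)%C)).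
  - apply RtoC_nz, pow_nonzero; lra.
  - apply sph_affine, H.
Qed.

Lemma derive_n_affine F c r z (s : R) a t : t <> RtoC 0 -> hol c r F -> forall j x, disc c r (z + RtoC s * x)%C ->
  C_derive_n (S j) (fun x => (F (z + RtoC s * x) - a) / t)%C x = (RtoC s ^ S j / t * C_derive_n (S j) F (z + RtoC s * x))%C.
Proof.
  intros Nt H; induction j as [|j IH]; intros x Hx.
  - apply isd_C_derive.
    apply isd_ext with (fun x => / t * (F (z + RtoC s * x) + - a))%C; [intros; field; exact Nt|].
    replace (RtoC s ^ 1 / t * C_derive_n 1 F (z + RtoC s * x))%C
      with (0 * (F (z + RtoC s * x) + - a) + / t * (C_derive F (z + RtoC s * x) * RtoC s + 0))%C by (simpl; field; exact Nt).
    apply (isd_mult (fun _ => / t)%C (fun x => F (z + RtoC s * x) + - a)%C); [apply isd_const|].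
    apply isd_plus; [|apply isd_const].
    apply (isd_comp F (fun x => z + RtoC s * x)%C); [apply isd_affine|apply H, Hx].
  - destruct (disc_affine z s x c r Hx) as [q [Hq Sub]].
    change (C_derive (C_derive_n (S j) (fun x => (F (z + RtoC s * x) - a) / t)%C) x = (RtoC s ^ S (S j) / t * C_derive_n (S (S j)) F (z + RtoC s * x))%C).
    apply isd_C_derive, isd_ext_loc with (fun x => RtoC s ^ S j / t * C_derive_n (S j) F (z + RtoC s * x))%C.
    + apply locally_disc; exists q; split; [exact Hq|]; intros y Hy; symmetry; apply IH, Sub, Hy.
    + replace (RtoC s ^ S (S j) / t * C_derive_n (S (S j)) F (z + RtoC s * x))%C
        with (0 * C_derive_n (S j) F (z + RtoC s * x) + RtoC s ^ S j / t * (C_derive (C_derive_n (S j) F) (z + RtoC s * x) * RtoC s))%C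
        by (rewrite (Cpow_S (RtoC s) (S j)); change (C_derive_n (S (S j)) F (z + RtoC s * x)) with (C_derive (C_derive_n (S j) F) (z + RtoC s * x)); field; exact Nt).
      apply (isd_mult (fun _ => RtoC s ^ S j / t)%C (fun x => C_derive_n (S j) F (z + RtoC s * x)%C)); [apply isd_const|].
      apply (isd_comp (C_derive_n (S j) F) (fun x => z + RtoC s * x)%C); [apply isd_affine|apply (hol_derive_n F c r (S j) H), Hx].
Qed.

Lemma derive_n_ext_loc f g c r : 0 < r -> hol c r f -> (forall z, disc c r z -> f z = g z) -> forall j z, disc c r z ->
  C_derive_n j g z = C_derive_n j f z.
Proof.
  intros Hr H E; induction j as [|j IH]; intros z Hz; [symmetry; apply E, Hz|].
  apply (C_derive_ext c r (C_derive_n j f) (C_derive_n j g) z Hz); [intros; symmetry; auto|apply hol_derive_n, H].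
Qed.

Lemma derive_n_resc k a f z s x : 0 < s -> sph f (z + RtoC s * x)%C -> f (z + RtoC s * x)%C <> Inf -> forall j,
  C_derive_n (S j) (finpart (resc k a f z s)) x = (RtoC s ^ S j / RtoC (s ^ k) * C_derive_n (S j) (finpart f) (z + RtoC s * x))%C.
Proof.
  intros Hs H Ni j; destruct (sph_finite f _ H Ni) as [r [Hr [K1 K2]]].
  assert (Nt : RtoC (s ^ k) <> RtoC 0) by (apply RtoC_nz, pow_nonzero; lra).
  destruct (disc_affine z s x _ _ (disc_center _ r Hr)) as [t [Ht Sub]].
  rewrite <- (derive_n_affine (finpart f) _ r z s a (RtoC (s ^ k)) Nt K1 j x (disc_center _ r Hr)).
  apply (derive_n_ext_loc _ _ x t Ht); [| |apply disc_center, Ht].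
  - intros y Hy; apply der_div; [exact Nt| |apply der_const]; apply der_minus; [|apply der_const].
    apply (der_comp (finpart f) (fun x => z + RtoC s * x)%C); [eapply isd_der, isd_affine|apply K1, Sub, Hy].
  - intros y Hy; symmetry; apply finpart_Fin; unfold resc; rewrite (K2 _ (Sub y Hy)); reflexivity.
Qed.

Lemma derive_resc k a f z s x : 0 < s -> sph f (z + RtoC s * x)%C -> f (z + RtoC s * x)%C <> Inf ->
  Cmod (C_derive (finpart (resc k a f z s)) x) * (s ^ k * s ^ k) = s ^ S k * Cmod (C_derive (finpart f) (z + RtoC s * x)).
Proof.
  intros Hs H Ni; pose proof (derive_n_resc k a f z s x Hs H Ni 0) as D.
  change (C_derive (finpart (resc k a f z s)) x = (RtoC s ^ 1 / RtoC (s ^ k) * C_derive (finpart f) (z + RtoC s * x))%C) in D.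
  assert (P : 0 < s ^ k) by (apply pow_lt, Hs).
  rewrite D, Cmod_mult, Cmod_div, Cmod_pow, !Cmod_R, !Rabs_pos_eq by (lra || (apply RtoC_nz; lra)).
  simpl; field; lra.
Qed.

Lemma pow_two_mul s k : s ^ (2 * k) = s ^ k * s ^ k.
Proof. replace (2 * k)%nat with (k + k)%nat by lia; apply pow_add. Qed.

Lemma Cmod_resc a w s k : 0 < s -> Cmod ((w - a) / RtoC (s ^ k)) ^ 2 = Cmod (w - a) ^ 2 / (s ^ k * s ^ k).
Proof.
  intros Hs; assert (P : 0 < s ^ k) by (apply pow_lt, Hs).
  rewrite Cmod_div, Cmod_R, Rabs_pos_eq by (lra || (apply RtoC_nz; lra)); simpl; field; lra.
Qed.

Lemma bad_resc k a f z s : 0 < s -> sph f z -> bad k a f z s ->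
  exists w, resc k a f z s 0 = Fin w /\ 1 + Cmod w ^ 2 <= Cmod (C_derive (finpart (resc k a f z s)) 0).
Proof.
  intros Hs H [w [E B]]; assert (Z : (z + RtoC s * 0)%C = z) by ring.
  exists ((w - a) / RtoC (s ^ k))%C; split; [unfold resc; rewrite Z, E; reflexivity|].
  assert (D := derive_resc k a f z s 0 Hs); rewrite Z in D; specialize (D H ltac:(rewrite E; discriminate)).
  rewrite pow_two_mul in B; rewrite Cmod_resc by exact Hs; assert (P : 0 < s ^ k) by (apply pow_lt, Hs).
  apply Rmult_le_reg_r with (s ^ k * s ^ k); [nra|]; rewrite D.
  replace ((1 + Cmod (w - a) ^ 2 / (s ^ k * s ^ k)) * (s ^ k * s ^ k)) with (s ^ k * s ^ k + Cmod (w - a) ^ 2) by (field; lra); lra.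
Qed.

(** The bound is [2^(k+1)] rather than 1, because the absence of bad pairs is
    known for half the size only. *)
Lemma not_bad_resc k a f z s x : 0 < s -> sph f (z + RtoC s * x)%C -> ~ bad k a f (z + RtoC s * x)%C (s / 2) ->
  sharp (resc k a f z s) (2 ^ S k) x.
Proof.
  intros Hs H NB v Ev; unfold resc in Ev; destruct (f (z + RtoC s * x)%C) as [w|] eqn:E; [|discriminate].
  simpl in Ev; apply (f_equal finval) in Ev; simpl finval in Ev; subst v.
  assert (D := derive_resc k a f z s x Hs H ltac:(rewrite E; discriminate)).
  assert (P : 0 < s ^ k) by (apply pow_lt, Hs).
  assert (B : (s / 2) ^ S k * Cmod (C_derive (finpart f) (z + RtoC s * x)) <= (s / 2) ^ (2 * k) + Cmod (w - a) ^ 2).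
  { apply Rnot_lt_le; intros L; apply NB; exists w; auto. }
  assert (Q : (s / 2) ^ (2 * k) <= s ^ k * s ^ k) by (rewrite <- pow_two_mul; apply pow_incr; lra).
  rewrite Cmod_resc by exact Hs; apply Rmult_le_reg_r with (s ^ k * s ^ k); [nra|]; rewrite D.
  replace (2 ^ S k * (1 + Cmod (w - a) ^ 2 / (s ^ k * s ^ k)) * (s ^ k * s ^ k)) with (2 ^ S k * (s ^ k * s ^ k + Cmod (w - a) ^ 2)) by (field; lra).
  replace (s ^ S k) with (2 ^ S k * (s / 2) ^ S k) by (rewrite <- Rpow_mult_distr; f_equal; field).
  rewrite Rmult_assoc; apply Rmult_le_compat_l; [apply pow_le; lra|lra].
Qed.

(** The rescaling lemma of Zalcman and Pang. By [doubling] one may pass to bad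
    pairs around which no pair of half the size is bad, in a neighbourhood that
    grows relative to the size. So the rescaled functions have bounded
    spherical derivatives on growing discs, and spherical derivative greater
    than 1 at [0]; Marty's criterion yields a nonconstant limit. *)
Theorem zalcman k a (f : nat -> C -> Csph) (z : nat -> C) (s : nat -> R) :
  (forall n, 0 < s n) -> (forall n, bad k a (f n) (z n) (s n)) ->
  (forall n w, Cmod (w - z n) <= 3 * INR (S n) * s n -> sph (f n) w /\
     (f n w = Fin a -> forall p, zero_multiplicity (f n) a w p -> (S k <= p)%nat)) ->
  exists phi z' s' g, extr phi /\
    (forall n, 0 < s' n <= s (phi n) /\ Cmod (z' n - z (phi n)) <= 2 * INR (S (phi n)) * s (phi n)) /\
    (forall x, conv_sph (fun n => resc k a (f (phi n)) (z' n) (s' n)) g x /\ sph g x) /\ nonconstant g.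
Proof.
  intros Hs Hb H.
  assert (Pn : forall n, 0 < INR (S n)) by (intros n; apply lt_0_INR; lia).
  assert (K : forall n, exists y : C * R, 0 < snd y <= s n /\ Cmod (fst y - z n) <= 2 * INR (S n) * s n /\
    bad k a (f n) (fst y) (snd y) /\ forall w t, Cmod (w - fst y) <= INR (S n) * snd y -> 0 < t <= snd y / 2 -> ~ bad k a (f n) w t).
  { intros n; destruct (doubling (bad k a (f n)) (INR (S n)) (z n) (s n) (Pn n) (Hs n) (Hb n)) as [z1 [s1 K]].
    - intros w Hw; destruct (H n w) as [H1 H2]; [pose proof (Pn n); pose proof (Hs n); nra|].
      apply not_bad_near; assumption.
    - exists (z1, s1); exact K. }
  pose (y := fun n => proj1_sig (constructive_indefinite_description _ (K n))).
  assert (Hy : forall n, 0 < snd (y n) <= s n /\ Cmod (fst (y n) - z n) <= 2 * INR (S n) * s n /\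
    bad k a (f n) (fst (y n)) (snd (y n)) /\ forall w t, Cmod (w - fst (y n)) <= INR (S n) * snd (y n) -> 0 < t <= snd (y n) / 2 -> ~ bad k a (f n) w t).
  { intros n; unfold y; destruct constructive_indefinite_description; assumption. }
  clearbody y; clear K.
  assert (Sx : forall n x, Cmod x <= INR (S n) -> sph (f n) (fst (y n) + RtoC (snd (y n)) * x)%C).
  { intros n x Hx; destruct (Hy n) as [[S1 S2] [Z _]]; apply H.
    replace (fst (y n) + RtoC (snd (y n)) * x - z n)%C with (RtoC (snd (y n)) * x + (fst (y n) - z n))%C by ring.
    eapply Rle_trans; [apply Cmod_triangle|]; rewrite Cmod_mult, Cmod_R, Rabs_pos_eq by lra.
    assert (snd (y n) * Cmod x <= s n * INR (S n)) by (apply Rmult_le_compat; try lra; apply Cmod_ge_0); lra. }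
  set (u := fun n => resc k a (f n) (fst (y n)) (snd (y n))).
  destruct (marty u) as [phi [g [Hphi M]]].
  assert (MA : forall x, marty_at u x).
  { intros x; destruct (INR_unbounded (Cmod x + 1)) as [N HN]; exists 1, (2 ^ S k), N.
    split; [lra|split; [apply pow_le; lra|]]; intros n Hn w Hw.
    assert (Lw : Cmod w <= INR (S n)).
    { apply le_INR in Hn; rewrite S_INR; unfold disc in Hw; pose proof (Cmod_ge_sub w x); lra. }
    destruct (Hy n) as [[S1 S2] [_ [_ NB]]]; split; [apply sph_resc; [exact S1|apply Sx, Lw]|].
    apply not_bad_resc; [exact S1|apply Sx, Lw|apply NB; [|lra]].
    rewrite add_sub, Cmod_mult, Cmod_R, Rabs_pos_eq by lra; rewrite Rmult_comm; apply Rmult_le_compat_r; lra. }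
  exists phi, (fun n => fst (y (phi n))), (fun n => snd (y (phi n))), g; split; [exact Hphi|split; [|split]].
  - intros n; split; apply Hy.
  - intros x; apply (M x (MA x)).
  - apply (nonconstant_limit _ g 0 (proj1 (M 0 (MA 0)))); intros n.
    destruct (Hy (phi n)) as [[S1 S2] [_ [B _]]]; apply bad_resc; [exact S1| |exact B].
    specialize (Sx (phi n) 0 ltac:(rewrite Cmod_0; left; apply Pn)).
    replace (fst (y (phi n)) + RtoC (snd (y (phi n))) * 0)%C with (fst (y (phi n))) in Sx by ring; exact Sx.
Qed.

(** * Entire functions without zeros whose 1-points are multiple *)

(** By Hurwitz's theorem, a zero being a point where the limit is finite. *)
Lemma limit_no_zero u g : (forall x, conv_sph u g x) -> nonconstant g -> (forall n z, u n z <> Fin 0) -> forall x, g x <> Fin 0.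
Proof.
  intros H Hg Hu x E.
  assert (Hs : forall x, sph g x) by (intros y; eapply conv_sph_limit, H).
  destruct (conv_sph_fin u g x (H x) ltac:(rewrite E; discriminate)) as [A [r [N [Hr B]]]].
  destruct (hurwitz_at x _ _ A (finpart_Fin g x _ E)) with (s := r) as [M HM]; [|exact Hr|].
  - intros [s [Hs' Z]]; apply Hg; exists (Fin 0); intros y.
    apply (constant_near g 0 x (Rmin r s) Hs); [pos|]; intros w Hw.
    rewrite (proj2 (B N w (le_n N) (disc_minl Hw))), Z; [reflexivity|].
    exact (disc_minr Hw).
  - destruct (HM (Nat.max N M) ltac:(lia)) as [z [Z1 Z2]]; apply (Hu (Nat.max N M) z).
    rewrite (proj1 (B (Nat.max N M) z ltac:(lia) Z1)), Z2; reflexivity.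
Qed.

Lemma cts_fst_sign V z : cts V z -> fst (V z) <> 0 -> exists r, 0 < r /\ forall w, disc z r w -> 0 < fst (V w) * fst (V z).
Proof.
  intros H N; destruct (proj1 (cts_eps _ _) H (Rabs (fst (V z))) ltac:(apply Rabs_pos_lt, N)) as [d [Hd K]].
  exists d; split; [exact Hd|]; intros w Hw; specialize (K w Hw).
  pose proof (re_le_Cmod (V w - V z)) as L; simpl in L; revert L K; generalize (Cmod (V w - V z)); intros m L K.
  change (fst (V w) + - fst (V z)) with (fst (V w) - fst (V z)) in L.
  assert (Q : Rabs (fst (V w) - fst (V z)) < Rabs (fst (V z))) by (eapply Rle_lt_trans; [exact L|exact K]).
  revert Q; unfold Rabs; repeat destruct Rcase_abs; nra.
Qed.

Lemma Cexp_i_ne t t' : 0 < t' - t <= 1 -> Cexp (0, t') <> Cexp (0, t).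
Proof.
  intros Ht E; assert (K : Cexp (0, t' - t) = 1).
  { replace (0, t' - t) with ((0, t') + - (0, t))%C by (apply injective_projections; simpl; ring).
    rewrite Cexp_add, Cexp_opp, E; field; apply Cexp_nz. }
  apply (f_equal snd) in K; simpl in K; rewrite exp_0, Rmult_1_l in K.
  pose proof (sin_gt_0 (t' - t) ltac:(lra) ltac:(pose proof PI2_1; lra)); lra.
Qed.

Lemma cvg_Cexp_i (t : nat -> R) l : (forall eps, 0 < eps -> exists N, forall n, (N <= n)%nat -> Rabs (t n - l) < eps) ->
  cvg (fun n => Cexp (0, t n)) (Cexp (0, l)).
Proof.
  intros H e He; destruct (proj1 (cts_eps _ _) (der_cts _ _ (der_Cexp (0, l))) e He) as [d [Hd K]].
  destruct (H d Hd) as [N HN]; exists N; intros n Hn; apply K; unfold disc.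
  replace ((0, t n) - (0, l))%C with (Ci * RtoC (t n - l))%C by (apply injective_projections; simpl; ring).
  rewrite Cmod_mult, Cmod_Ci, Cmod_R, Rmult_1_l; apply HN, Hn.
Qed.

Lemma conv_at_minus_seq c F f a l : conv_at c F f -> cvg a l -> conv_at c (fun n z => F n z - a n)%C (fun z => f z - l)%C.
Proof.
  intros H Ha; apply (conv_at_plus c F f (fun n _ => - a n)%C (fun _ => - l)%C H).
  apply (conv_at_const c (fun n => - a n)%C); intros e He; destruct (Ha e He) as [N HN]; exists N; intros n Hn.
  replace (- a n - - l)%C with (- (a n - l))%C by ring; rewrite Cmod_opp; apply HN, Hn.
Qed.

(** The roots [e^(v / n)] of [u = e^v] have critical points wherever they take
    an [n]-th root of unity as value. A rescaled limit [W] of these roots is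
    entire, without zeros, and critical wherever [|W| = 1], the roots of unity
    being dense in the unit circle. If [|W| = 1] somewhere, then the values of
    [W] nearby fill an arc of the unit circle, so that the critical points have
    a limit point there and [W] is constant. Otherwise [|W| < 1] everywhere or
    [|W| > 1] everywhere, and [W] is constant by Liouville's theorem. But
    rescaled limits are nonconstant. This adapts the proof of Picard's theorem
    due to Ros. *)
Theorem entire_ramified u : entire u -> (forall z, u z <> RtoC 0) -> (forall z, u z = 1 -> C_derive u z = 0) ->
  forall z w, u z = u w.
Proof.
  intros Hu Hnz H1.
  destruct (classic (forall z, C_derive u z = 0)) as [Z|Z].
  { intros z w; rewrite (zero_derive_const u w (Cmod (z - w) + 1) (entire_hol _ _ _ Hu) ltac:(auto) z) by (unfold disc; lra); reflexivity. }
  exfalso; apply not_all_ex_not in Z; destruct Z as [z0 Hz0].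
  destruct (entire_log u Hu Hnz) as [v [Hv Ev]].
  assert (Pn : forall n, 0 < INR (S n)) by (intros n; apply lt_0_INR; lia).
  assert (Nn : forall n, RtoC (INR (S n)) <> RtoC 0) by (intros n; apply RtoC_nz; pose proof (Pn n); lra).
  pose (r := fun n z => Cexp (v z / RtoC (INR (S n)))%C).
  assert (Dr : forall n z, isd (r n) z (r n z * (C_derive v z / RtoC (INR (S n))))%C).
  { intros n z; apply (isd_comp Cexp (fun z => v z / RtoC (INR (S n)))%C); [|apply isd_Cexp].
    apply isd_ext with (fun z => / RtoC (INR (S n)) * v z)%C; [intros; apply Cmult_comm|].
    replace (C_derive v z / RtoC (INR (S n)))%C with (0 * v z + / RtoC (INR (S n)) * C_derive v z)%C by (field; apply Nn).
    apply (isd_mult (fun _ => / RtoC (INR (S n)))%C v); [apply isd_const|apply Hv]. }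
  assert (Er : forall n, entire (r n)) by (intros n z; eapply isd_der, Dr).
  assert (Nr : forall n z, r n z <> 0) by (intros n z; apply Cexp_nz).
  assert (Pw : forall n z, (r n z ^ S n)%C = u z).
  { intros n z; unfold r; rewrite Cexp_pow, Ev; f_equal; field; apply Nn. }
  assert (Du : forall z, C_derive u z = (u z * C_derive v z)%C).
  { intros z; apply isd_C_derive; rewrite (Ev z); apply isd_ext with (fun z => Cexp (v z)); [intros; symmetry; apply Ev|].
    apply (isd_comp Cexp v); [apply Hv|apply isd_Cexp]. }
  assert (Hv0 : C_derive v z0 <> 0).
  { intros Q; apply Hz0; rewrite Du, Q; ring. }
  pose (f := fun n z => Fin (r n z)).
  assert (Ff : forall n, finpart (f n) = r n) by (intros n; apply functional_extensionality; reflexivity).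
  assert (Pd : forall n, 0 < Cmod (C_derive (r n) z0)).
  { intros n; apply Cmod_gt_0; rewrite (isd_C_derive _ _ _ (Dr n z0)); apply Cmult_neq_0; [apply Nr|].
    intros Q; apply Hv0; replace (C_derive v z0) with (C_derive v z0 / RtoC (INR (S n)) * RtoC (INR (S n)))%C by (field; apply Nn); rewrite Q; ring. }
  (* as no zeros are to be scaled, the exponent 0 serves; the radius makes every pair bad *)
  destruct (zalcman 0 0 f (fun _ => z0) (fun n => (2 + Cmod (r n z0) ^ 2) / Cmod (C_derive (r n) z0))) as [phi [y [s [g [Hphi [Hs [Hg Hnc]]]]]]].
  { intros n; apply Rdiv_lt_0_compat; [pose proof (pow2_ge_0 (Cmod (r n z0))); lra|apply Pd]. }
  { intros n; exists (r n z0); split; [reflexivity|]; rewrite Ff; replace (r n z0 - 0)%C with (r n z0) by ring.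
    rewrite pow_1, Nat.mul_0_r; replace ((2 + Cmod (r n z0) ^ 2) / Cmod (C_derive (r n) z0) * Cmod (C_derive (r n) z0)) with (2 + Cmod (r n z0) ^ 2)
      by (field; pose proof (Pd n); lra). cbn [pow]; lra. }
  { intros n w _; split.
    - exists 1; split; [lra|left; exists (r n); split; [apply entire_hol, Er|reflexivity]].
    - intros Q; apply (f_equal finval) in Q; elim (Nr n w Q). }
  pose (U := fun n x => r (phi n) (y n + RtoC (s n) * x)%C).
  assert (ER : forall n, resc 0 0 (f (phi n)) (y n) (s n) = fun x => Fin (U n x)).
  { intros n; apply functional_extensionality; intros x; unfold resc, f; simpl; f_equal; unfold U; field; exact C1_nz. }
  assert (Cv : forall x, conv_sph (fun n x => Fin (U n x)) g x).
  { intros x; destruct (Hg x) as [K _]; replace (fun n x => Fin (U n x)) with (fun n => resc 0 0 (f (phi n)) (y n) (s n)); [exact K|].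
    apply functional_extensionality; exact ER. }
  assert (Hsg : forall x, sph g x) by (intros x; apply Hg).
  assert (G0 : forall x, g x <> Fin 0).
  { apply (limit_no_zero _ g Cv Hnc); intros n z Q; apply (f_equal finval) in Q; elim (Nr _ _ Q). }
  assert (GI : forall x, g x <> Inf).
  { intros x Q; apply (limit_no_zero (fun n => sinvf (fun x => Fin (U n x))) (sinvf g)) with (x := x).
    - intros z; apply conv_sph_sinvf, Cv.
    - intros [p E]; apply Hnc; exists (sinv p); intros z; rewrite <- (E z); symmetry; apply sinv_sinv.
    - intros n z E; unfold sinvf in E; rewrite sinv_Fin in E by apply Nr; apply (f_equal finval) in E.
      exact (Cinv_nz _ (Nr _ _) E).
    - unfold sinvf; rewrite Q; reflexivity. }
  set (W := finpart g).
  assert (EW : forall x, g x = Fin (W x)) by (intros x; apply not_Inf_Fin, GI).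
  assert (HW : entire W).
  { intros x; destruct (sph_finite g x (Hsg x) (GI x)) as [d [Hd [K _]]]; apply K, disc_center, Hd. }
  assert (NW : forall x, W x <> 0) by (intros x Q; apply (G0 x); rewrite EW, Q; reflexivity).
  assert (CW : forall x, conv_at x U W).
  { intros x; apply (conv_sph_fin _ g x (Cv x) (GI x)). }
  assert (NC : forall b x, ~ vanishes_near (fun z => W z - b)%C x).
  { intros b x [d [Hd K]]; apply Hnc; exists (Fin b); apply (constant_near g b x d Hsg Hd); intros w Hw; rewrite EW; f_equal; apply Cminus_eq, K, Hw. }
  destruct (entire_log W HW NW) as [V [HV EV]].
  (* [th n] is an argument, close to [t], of an [S (phi n)]-th root of unity *)
  assert (Crit : forall t x, W x = Cexp (0, t) -> C_derive W x = 0).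
  { intros t x Hx; pose proof PI_RGT_0.
    pose (m := fun n => up (t * INR (S (phi n)) / (2 * PI))).
    pose (th := fun n => 2 * IZR (m n) * PI / INR (S (phi n))).
    assert (Hth : forall n, Rabs (th n - t) <= 2 * PI * / INR (S (phi n))).
    { intros n; destruct (archimed (t * INR (S (phi n)) / (2 * PI))) as [A1 A2]; fold (m n) in A1, A2.
      specialize (Pn (phi n)).
      replace (th n - t) with ((IZR (m n) - t * INR (S (phi n)) / (2 * PI)) * (2 * PI * / INR (S (phi n)))) by (unfold th; field; lra).
      assert (0 < / INR (S (phi n))) by apply inv_S_pos.
      rewrite Rabs_mult, (Rabs_pos_eq (2 * PI * _)) by nra.
      rewrite <- (Rmult_1_l (2 * PI * / INR (S (phi n)))) at 2; apply Rmult_le_compat_r; [nra|apply Rabs_le; lra]. }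
    assert (Cth : cvg (fun n => Cexp (0, th n)) (Cexp (0, t))).
    { apply cvg_Cexp_i; intros e He; destruct (inv_S_small (e / (2 * PI)) ltac:(apply Rdiv_lt_0_compat; lra)) as [N HN].
      exists N; intros n Hn; specialize (HN (phi n) ltac:(pose proof (extr_ge phi n Hphi); lia)).
      apply Rlt_div_r in HN; [|lra]; specialize (Hth n); lra. }
    destruct (hurwitz_seq x _ _ (conv_at_minus_seq x U W _ _ (CW x) Cth)) as [xi [N [X1 X2]]].
    { rewrite Hx; ring. }
    { apply NC. }
    apply (cvg_unique (fun n => C_derive (U n) (xi n))).
    - apply (conv_at_moving x _ _ xi (conv_at_derive _ _ _ (CW x)) X1).
    - intros e He; exists N; intros n Hn; specialize (X2 n Hn); apply Cminus_eq in X2.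
      assert (D : C_derive (U n) (xi n) = 0).
      { set (q := (y n + RtoC (s n) * xi n)%C).
        assert (U1 : u q = 1).
        { rewrite <- (Pw (phi n) q); change (r (phi n) q) with (U n (xi n)); rewrite X2, Cexp_pow.
          replace (RtoC (INR (S (phi n))) * (0%R, th n))%C with (0 + Ci * RtoC (2 * IZR (m n) * PI))%C
            by (unfold th; apply injective_projections; simpl; field; pose proof (Pn (phi n)) as P; simpl in P; lra).
          rewrite Cexp_2kPI; apply Cexp_0. }
        assert (V1 : C_derive v q = 0) by (specialize (H1 q U1); rewrite Du, U1 in H1; rewrite <- H1; ring).
        transitivity (r (phi n) q * (C_derive v q / RtoC (INR (S (phi n)))) * RtoC (s n))%C.
        { exact (isd_C_derive _ _ _ (isd_comp (r (phi n)) (fun x => y n + RtoC (s n) * x)%C (xi n) _ _ (isd_affine (y n) (s n) (xi n)) (Dr (phi n) q))). }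
        rewrite V1; field; apply Nn. }
      rewrite D, Cmod_self; exact He. }
  (* the real part of [V] vanishes where [|W| = 1] *)
  assert (Off : forall x, fst (V x) <> 0).
  { intros x Hx; assert (Wx : W x = Cexp (0, snd (V x))) by (rewrite EV, <- Hx; f_equal; apply surjective_pairing).
    set (t := snd (V x)) in *.
    assert (Ct : cvg (fun n => Cexp (0, t + / INR (S n))) (Cexp (0, t))).
    { apply cvg_Cexp_i; intros e He; destruct (inv_S_small e He) as [N HN]; exists N; intros n Hn.
      replace (t + / INR (S n) - t) with (/ INR (S n)) by ring; rewrite Rabs_pos_eq by (left; apply inv_S_pos); apply HN, Hn. }
    assert (Cst : conv_at x (fun _ => W) W).
    { exists 1; split; [lra|split; [exists 0%nat; intros n _; apply entire_hol, HW|]].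
      intros e He; exists 0%nat; intros n _ z _; rewrite Cmod_self; exact He. }
    destruct (hurwitz_seq x _ _ (conv_at_minus_seq x _ _ _ _ Cst Ct)) as [xi [N [X1 X2]]].
    { rewrite Wx; ring. }
    { apply NC. }
    destruct (isolated_zero (C_derive W) x 1 ltac:(lra) (hol_derive _ _ _ (entire_hol W x 1 HW))) as [Z|[d [Hd Iso]]].
    - apply (NC (W x) x); exists 1; split; [lra|]; intros z Hz.
      rewrite (zero_derive_const W x 1 (entire_hol _ _ _ HW) Z z Hz); ring.
    - destruct (X1 d ltac:(lra)) as [M HM]; set (n := Nat.max N M).
      specialize (HM n ltac:(lia)); specialize (X2 n ltac:(lia)); apply Cminus_eq in X2.
      apply (Iso (xi n) HM); [|apply (Crit _ _ X2)].
      intros Q; rewrite Q, Wx in X2; apply (Cexp_i_ne t (t + / INR (S n))); [|symmetry; exact X2].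
      pose proof (inv_S_pos n); assert (/ INR (S n) <= 1); [|lra].
      rewrite <- Rinv_1; apply Rinv_le_contravar; [lra|]; rewrite S_INR; pose proof (pos_INR n); lra. }
  assert (Sign : forall b, 0 < fst (V 0) * b -> forall x, 0 < fst (V x) * b).
  { intros b Hb x; apply (clopen (fun _ => True) (fun x => 0 < fst (V x) * b) connected_C); [| |exists 0; split; [exact I|exact Hb]|exact I].
    - intros z _ Hz; destruct (cts_fst_sign V z (der_cts _ _ (HV z)) (Off z)) as [d [Hd K]].
      exists d; split; [exact Hd|]; intros w Hw; specialize (K w Hw); pose proof (Off z); nra.
    - intros z _ Hz; destruct (cts_fst_sign V z (der_cts _ _ (HV z)) (Off z)) as [d [Hd K]].
      exists d; split; [exact Hd|]; intros w Hw Q; specialize (K w Hw); apply Hz; nra. }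
  apply Hnc; exists (Fin (W 0)); intros x; rewrite EW; f_equal.
  destruct (Rlt_dec 0 (fst (V 0))) as [L|L].
  - assert (Inv : forall z w, (/ W z)%C = (/ W w)%C).
    { apply (liouville _ 1); [intros z; apply der_inv; [apply NW|apply HW]|]; intros z.
      rewrite Cmod_inv, EV, Cmod_Cexp by apply NW; rewrite <- exp_Ropp, <- exp_0; left; apply exp_increasing.
      specialize (Sign 1 ltac:(lra) z); lra. }
    apply Cminus_eq; replace (W x - W 0)%C with (W x * W 0 * (/ W 0 - / W x))%C by (field; split; apply NW).
    rewrite (Inv 0 x); ring.
  - apply (liouville W 1 HW); intros z; rewrite EV, Cmod_Cexp, <- exp_0; left; apply exp_increasing.
    specialize (Sign (-1) ltac:(pose proof (Off 0); lra) z); lra.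
Qed.

(** * Differential monomials under rescaling *)

(** The exponent of [s] that the substitution [f = s^k g (./s)] produces in a
    monomial; by [weight_deficit] it vanishes exactly when the ratio of weight
    and degree is [k + 1]. *)
Definition deficit (k : nat) (M : monomial) : nat :=
  list_sum (map (fun j => (k - j) * exponent M j)%nat (seq 1 (mono_order M))).

Lemma weight_deficit k M : (mono_order M <= k)%nat -> (weight M + deficit k M = S k * degree M)%nat.
Proof.
  intros H; unfold weight, deficit, degree.
  assert (K : forall j, In j (seq 1 (mono_order M)) -> (j <= k)%nat) by (intros j Hj; apply in_seq in Hj; lia).
  revert K; generalize (seq 1 (mono_order M)); induction l as [|j l IH]; intros K; [simpl; lia|].
  specialize (IH (fun i Hi => K i (or_intror Hi))); specialize (K j (or_introl eq_refl)); simpl in *; nia.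
Qed.

Lemma list_sum_zero (f : nat -> nat) l : list_sum (map f l) = 0%nat -> forall x, In x l -> f x = 0%nat.
Proof. induction l as [|y l IH]; simpl; [tauto|]; intros H x [->|Hx]; [lia|apply IH; [lia|exact Hx]]. Qed.

Lemma exponent_exists M : exists j, (1 <= j <= mono_order M)%nat /\ exponent M j <> 0%nat.
Proof.
  destruct (proj1 (Exists_nth _ _) (exponents_nonzero M)) as [i [d [Hi H]]].
  exists (S i); unfold mono_order; split; [lia|]; unfold exponent.
  replace (S i - 1)%nat with i by lia; rewrite (nth_indep _ 0%nat d Hi); exact H.
Qed.

Lemma degree_pos M : (1 <= degree M)%nat.
Proof.
  destruct (exponent_exists M) as [j [Hj H]]; destruct (degree M) eqn:E; [|lia].
  elim H; apply (list_sum_zero _ _ E); apply in_seq; lia.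
Qed.

Lemma ratio_deficit k M : (mono_order M <= k)%nat -> (ratio M = 1 + INR k <-> deficit k M = 0%nat).
Proof.
  intros H; pose proof (weight_deficit k M H) as W; pose proof (degree_pos M) as D.
  assert (P : 0 < INR (degree M)) by (apply lt_0_INR; lia).
  unfold ratio; split; intros E.
  - assert (Q : INR (weight M) = INR (S k * degree M)).
    { rewrite mult_INR, S_INR; replace (INR (weight M)) with (INR (weight M) / INR (degree M) * INR (degree M)) by (field; lra).
      rewrite E; ring. }
    apply INR_eq in Q; lia.
  - rewrite E, Nat.add_0_r in W; rewrite W, mult_INR, S_INR; field; lra.
Qed.

(** Each derivative of order less than [k] contributes to the deficit; so a
    monomial without deficit is a power of the [k]-th derivative. *)
Lemma full_monomial k M : (1 <= k)%nat -> (mono_order M <= k)%nat -> deficit k M = 0%nat ->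
  mono_order M = k /\ (forall j, (1 <= j < k)%nat -> exponent M j = 0%nat) /\ (1 <= exponent M k)%nat.
Proof.
  intros Hk Ho Hd.
  assert (Z : forall j, (1 <= j <= mono_order M)%nat -> (j < k)%nat -> exponent M j = 0%nat).
  { intros j Hj Hjk; pose proof (list_sum_zero _ _ Hd j ltac:(apply in_seq; lia)) as Q; simpl in Q; nia. }
  destruct (exponent_exists M) as [j [Hj H]].
  assert (j = k) by (destruct (Nat.eq_dec j k) as [|Ne]; [assumption|elim H; apply Z; lia]); subst j.
  assert (mono_order M = k) by lia; repeat split; [assumption|intros j Hj'; apply Z; lia|lia].
Qed.

Lemma full_monomial_inj k M N : (1 <= k)%nat -> (mono_order M <= k)%nat -> (mono_order N <= k)%nat ->
  deficit k M = 0%nat -> deficit k N = 0%nat -> exponent M k = exponent N k -> exponents M = exponents N.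
Proof.
  intros Hk HM HN DM DN E.
  destruct (full_monomial k M Hk HM DM) as [M1 [M2 _]]; destruct (full_monomial k N Hk HN DN) as [N1 [N2 _]].
  unfold mono_order in M1, N1; apply (nth_ext _ _ 0%nat 0%nat); [lia|]; intros i Hi.
  assert (Q : exponent M (S i) = exponent N (S i)).
  { destruct (Nat.eq_dec (S i) k) as [->|Ne]; [exact E|rewrite M2, N2 by lia; reflexivity]. }
  unfold exponent in Q; replace (S i - 1)%nat with i in Q by lia; exact Q.
Qed.

Lemma mono_eval_full k M g z : (1 <= k)%nat -> (mono_order M <= k)%nat -> deficit k M = 0%nat ->
  mono_eval M g z = (C_derive_n k g z ^ exponent M k)%C.
Proof.
  intros Hk Ho Hd; destruct (full_monomial k M Hk Ho Hd) as [E [Z _]]; unfold mono_eval; rewrite E.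
  destruct k as [|k]; [lia|]; rewrite seq_S, map_app, fold_right_app; simpl fold_right at 2.
  assert (K : forall j, In j (seq 1 k) -> exponent M j = 0%nat) by (intros j Hj; apply in_seq in Hj; apply Z; lia).
  revert K; generalize (seq 1 k); induction l as [|j l IH]; intros K; [simpl; ring|].
  cbn [map fold_right]; rewrite IH by (intros i Hi; apply K; right; exact Hi).
  rewrite (K j (or_introl eq_refl)); simpl; ring.
Qed.

Lemma mono_eval_scale k M F z G x (s : R) : (mono_order M <= k)%nat ->
  (forall j, (1 <= j <= k)%nat -> C_derive_n j F z = (RtoC (s ^ (k - j)) * C_derive_n j G x)%C) ->
  mono_eval M F z = (RtoC (s ^ deficit k M) * mono_eval M G x)%C.
Proof.
  intros Ho H; unfold mono_eval, deficit.
  assert (K : forall j, In j (seq 1 (mono_order M)) -> (1 <= j <= k)%nat) by (intros j Hj; apply in_seq in Hj; lia).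
  revert K; generalize (seq 1 (mono_order M)); induction l as [|j l IH]; intros K; [simpl; ring|].
  cbn [map fold_right]; rewrite IH by (intros i Hi; apply K; right; exact Hi).
  rewrite (H j (K j (or_introl eq_refl))), Cpow_mult_l, <- RtoC_pow, <- pow_mult.
  change (list_sum ((k - j) * exponent M j :: map (fun j => (k - j) * exponent M j) l)%nat)
    with ((k - j) * exponent M j + list_sum (map (fun j => (k - j) * exponent M j) l))%nat.
  rewrite pow_add, RtoC_mult; ring.
Qed.

Lemma mono_eval_zero k M F z : (mono_order M <= k)%nat -> (forall j, (1 <= j <= k)%nat -> C_derive_n j F z = 0) -> mono_eval M F z = 0.
Proof.
  intros Ho H; destruct (exponent_exists M) as [i [Hi Ni]]; unfold mono_eval.
  assert (K : In i (seq 1 (mono_order M))) by (apply in_seq; lia).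
  revert K; generalize (seq 1 (mono_order M)); induction l as [|j l IH]; intros K; [destruct K|].
  cbn [map fold_right]; destruct K as [->|K]; [|rewrite IH by exact K; ring].
  rewrite H by lia; destruct (exponent M i); [now elim Ni|simpl; ring].
Qed.

Lemma conv_at_mono_eval M c F f : conv_at c F f -> conv_at c (fun n => mono_eval M (F n)) (mono_eval M f).
Proof.
  intros H; unfold mono_eval; generalize (seq 1 (mono_order M)); induction l as [|j l IH]; [apply (conv_at_cst c 1)|].
  apply (conv_at_mult c (fun n z => C_derive_n j (F n) z ^ exponent M j)%C (fun z => C_derive_n j f z ^ exponent M j)%C
    (fun n z => fold_right Cmult 1 (map (fun j => C_derive_n j (F n) z ^ exponent M j)%C l))
    (fun z => fold_right Cmult 1 (map (fun j => C_derive_n j f z ^ exponent M j)%C l))); [|exact IH].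
  apply (conv_at_pow c (fun n => C_derive_n j (F n)) (C_derive_n j f)), conv_at_derive_n, H.
Qed.

Lemma hol_mono_eval M c r f : hol c r f -> hol c r (mono_eval M f).
Proof.
  intros H; unfold mono_eval; generalize (seq 1 (mono_order M)); induction l as [|j l IH]; [apply (hol_const c r 1)|].
  intros z Hz; apply (der_mult (fun z => C_derive_n j f z ^ exponent M j)%C
    (fun z => fold_right Cmult 1 (map (fun j => C_derive_n j f z ^ exponent M j)%C l))); [|apply IH, Hz].
  apply der_pow, (hol_derive_n f c r j H), Hz.
Qed.

(** At a point of continuity the limit through the punctured neighbourhood is
    the value. *)
Lemma mero_ext_cts G z : cts G z -> mero_ext G z = Fin (G z).
Proof.
  intros H; assert (L : filterlim G (locally' z) (locally (G z))).
  { intros Q HQ; apply clim_filterlim in H; [|typeclasses eauto]; specialize (H Q HQ).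
    unfold filtermap in *; apply locally_disc in H; destruct H as [d [Hd K]].
    apply locally_disc'; exists d; split; [exact Hd|]; intros w Hw _; apply K, Hw. }
  unfold mero_ext; destruct excluded_middle_informative as [E|E].
  - f_equal; apply is_C_lim_unique, L.
  - elim E; exists (G z); exact L.
Qed.

Lemma poly_apply_regular P f c r : 0 < r -> hol c r (finpart f) ->
  (forall i, (1 <= i <= nterms P)%nat -> hol c r (coef P i)) -> poly_apply P f c = Fin (poly_eval P (finpart f) c).
Proof.
  intros Hr H Hc; apply mero_ext_cts, der_cts.
  assert (K : forall i, In i (seq 1 (nterms P)) -> hol c r (coef P i)) by (intros i Hi; apply in_seq in Hi; apply Hc; lia).
  assert (HP : hol c r (poly_eval P (finpart f))); [|apply HP, disc_center, Hr].
  unfold poly_eval; revert K; generalize (seq 1 (nterms P)); induction l as [|i l IH]; intros K; [apply (hol_const c r 0)|].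
  apply (hol_plus c r (fun z => coef P i z * mono_eval (mono P i) (finpart f) z)%C
    (fun z => fold_right Cplus 0 (map (fun i => coef P i z * mono_eval (mono P i) (finpart f) z)%C l))).
  - apply hol_mult; [apply K; left; reflexivity|apply hol_mono_eval, H].
  - apply IH; intros j Hj; apply K; right; exact Hj.
Qed.

(** Each monomial contains some derivative of order between 1 and [k]. *)
Lemma poly_eval_zero k P F z : (forall i, (1 <= i <= nterms P)%nat -> (mono_order (mono P i) <= k)%nat) ->
  (forall j, (1 <= j <= k)%nat -> C_derive_n j F z = 0) -> poly_eval P F z = 0.
Proof.
  intros Ho H; unfold poly_eval.
  assert (K : forall i, In i (seq 1 (nterms P)) -> (1 <= i <= nterms P)%nat) by (intros i Hi; apply in_seq in Hi; lia).
  revert K; generalize (seq 1 (nterms P)); induction l as [|i l IH]; intros K; [reflexivity|].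
  cbn [map fold_right]; rewrite IH by (intros j Hj; apply K; right; exact Hj).
  rewrite (mono_eval_zero k) by (try exact H; apply Ho, K; left; reflexivity); ring.
Qed.

(** Differentiation lowers the order of the factor [z - c] by one. *)
Lemma derive_zero_of_multiplicity c r a : 0 < r -> forall p f H, hol c r H -> (forall z, disc c r z -> f z = (a + (z - c) ^ S p * H z)%C) ->
  forall j, (1 <= j <= p)%nat -> C_derive_n j f c = 0.
Proof.
  intros Hr p; revert a; induction p as [|p IH]; intros a f H HH E j Hj; [lia|].
  pose (H1 := fun z => (RtoC (INR (S (S p))) * H z + (z - c) * C_derive H z)%C).
  assert (HH1 : hol c r H1).
  { apply hol_plus; apply hol_mult; [apply hol_const|exact HH| |apply hol_derive, HH].
    intros z _; apply der_sub. }
  assert (D : forall z, disc c r z -> C_derive f z = (0 + (z - c) ^ S p * H1 z)%C).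
  { intros z Hz; apply isd_C_derive, isd_ext_loc with (fun z => a + (z - c) ^ S (S p) * H z)%C.
    - generalize (disc_open c r z Hz); apply filter_imp; intros y Hy; symmetry; apply E, Hy.
    - replace (0 + (z - c) ^ S p * H1 z)%C with (0 + (RtoC (INR (S (S p))) * (z - c) ^ S p * H z + (z - c) ^ S (S p) * C_derive H z))%C
        by (unfold H1; rewrite (Cpow_S (z - c) (S p)); ring).
      apply isd_plus; [apply isd_const|apply (isd_mult (fun z => (z - c) ^ S (S p))%C H); [apply isd_pow|apply HH, Hz]]. }
  destruct j as [|j]; [lia|]; destruct j as [|j].
  - change (C_derive f c = 0); rewrite (D c (disc_center c r Hr)), Cpow_S; ring.
  - rewrite C_derive_n_S; apply (IH 0 (C_derive f) H1 HH1 D); lia.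
Qed.

Lemma derive_zero_at f c a k : sph f c -> f c = Fin a -> (forall p, zero_multiplicity f a c p -> (S k <= p)%nat) ->
  forall j, (1 <= j <= k)%nat -> C_derive_n j (finpart f) c = 0.
Proof.
  intros Hs E Hm j Hj; destruct (zero_structure f c a Hs E) as [[r [Hr Z]]|[p [r [H [ZM [Hr [H1 [_ H3]]]]]]]].
  - apply (derive_zero_of_multiplicity c r a Hr k (finpart f) (fun _ => 0) (hol_const _ _ _)); [|exact Hj].
    intros z Hz; rewrite (finpart_Fin f z a (Z z Hz)); ring.
  - specialize (Hm _ ZM); apply (derive_zero_of_multiplicity c r a Hr p (finpart f) H H1); [|lia].
    intros z Hz; apply finpart_Fin, H3, Hz.
Qed.

(** * The limit polynomial *)

Lemma psum_plus a b n z : psum (fun j => a j + b j)%C n z = (psum a n z + psum b n z)%C.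
Proof. induction n as [|n IH]; simpl; [ring|rewrite IH; ring]. Qed.

Lemma psum_single c d n z : (d < n)%nat -> psum (fun j => if Nat.eq_dec d j then c else 0) n z = (c * z ^ d)%C.
Proof.
  assert (Z : forall m, (m <= d)%nat -> psum (fun j => if Nat.eq_dec d j then c else 0) m z = 0).
  { induction m as [|m IH]; intros Hm; [reflexivity|]; simpl; rewrite IH by lia; destruct Nat.eq_dec; [lia|ring]. }
  induction n as [|n IH]; intros H; [lia|]; simpl; destruct (Nat.eq_dec d n) as [->|Ne].
  - rewrite Z by lia; ring.
  - rewrite IH by lia; ring.
Qed.

Definition lsum (f : nat -> C) (l : list nat) : C := fold_right Cplus 0 (map f l).

(** Collects the terms with equal exponent. *)
Lemma lsum_psum (A : nat -> C) (d : nat -> nat) l : exists N, forall n, (N <= n)%nat -> forall w,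
  lsum (fun i => A i * w ^ d i)%C l = psum (fun j => lsum (fun i => if Nat.eq_dec (d i) j then A i else 0) l) n w.
Proof.
  induction l as [|i l [N IH]].
  - exists 0%nat; intros n _ w; induction n as [|n IH]; [reflexivity|]; simpl; rewrite <- IH; unfold lsum; simpl; ring.
  - exists (Nat.max N (S (d i))); intros n Hn w; unfold lsum in *; cbn [map fold_right].
    rewrite psum_plus, psum_single, <- IH by lia; reflexivity.
Qed.

Lemma lsum_unique (f : nat -> C) l i : NoDup l -> In i l -> (forall t, In t l -> t <> i -> f t = 0) -> lsum f l = f i.
Proof.
  intros ND; induction ND as [|t l Ht _ IH]; intros Hi H; [destruct Hi|]; unfold lsum in *; cbn [map fold_right].
  destruct Hi as [->|Hi].
  - replace (fold_right Cplus 0 (map f l)) with (RtoC 0); [ring|]; symmetry; clear IH.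
    assert (K : forall t, In t l -> f t = 0) by (intros t Q; apply H; [right; exact Q|intros ->; auto]).
    clear H Ht; induction l as [|t l IH]; [reflexivity|]; simpl; rewrite (K t (or_introl eq_refl)), IH; [ring|].
    intros q Q; apply K; right; exact Q.
  - rewrite IH by (auto; intros q Q; apply H; right; exact Q); rewrite H; [ring|left; reflexivity|intros ->; auto].
Qed.

(** The monomials of deficit zero are powers of the [k]-th derivative, with
    distinct exponents since the monomials are distinct. So their terms do not
    cancel, and [Q] has a nonzero coefficient of positive degree. *)
Lemma limit_polynomial_surjective k P (z0 : C) : (1 <= k)%nat ->
  (forall i, (1 <= i <= nterms P)%nat -> (mono_order (mono P i) <= k)%nat) -> deficit k (mono P 1) = 0%nat ->
  (forall i, (1 <= i <= nterms P)%nat -> deficit k (mono P i) = 0%nat -> coef P i z0 <> RtoC 0) ->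
  exists Q, entire Q /\ (forall b, exists w, Q w = b) /\
    forall w, Q w = lsum (fun i => (if Nat.eq_dec (deficit k (mono P i)) 0 then coef P i z0 else 0) * w ^ exponent (mono P i) k)%C (seq 1 (nterms P)).
Proof.
  intros Hk Ho H1 Hc; pose (A := fun i => if Nat.eq_dec (deficit k (mono P i)) 0 then coef P i z0 else RtoC 0).
  pose (d := fun i => exponent (mono P i) k); set (l := seq 1 (nterms P)).
  destruct (lsum_psum A d l) as [N HN].
  set (a := fun j => lsum (fun i => if Nat.eq_dec (d i) j then A i else 0) l) in *.
  pose proof (nterms_pos P) as Hp.
  destruct (full_monomial k (mono P 1) Hk (Ho 1%nat ltac:(lia)) H1) as [_ [_ D1]].
  assert (Na : a (d 1%nat) <> RtoC 0).
  { unfold a; rewrite (lsum_unique _ l 1%nat); [| apply seq_NoDup|apply in_seq; lia|].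
    - destruct Nat.eq_dec as [_|n]; [|now elim n]; unfold A; rewrite H1; simpl; apply Hc; [lia|exact H1].
    - intros t Ht Ne; apply in_seq in Ht; destruct Nat.eq_dec as [E|]; [|reflexivity].
      unfold A; destruct Nat.eq_dec as [Z|]; [|reflexivity]; exfalso.
      apply (mono_distinct P t 1); [lia|lia|exact Ne|].
      apply (full_monomial_inj k); auto; apply Ho; lia. }
  set (n := Nat.max N (S (d 1%nat))); exists (psum a n); split; [|split].
  - intros z; apply der_ext_loc with (fun z => psum a n (z - 0)%C); [|apply entire_psum].
    apply filter_forall; intros w; f_equal; ring.
  - apply psum_surjective; exists (d 1%nat); split; [unfold d in *; lia|exact Na].
  - intros w; symmetry; apply HN; lia.
Qed.

(** A monomial of deficit [e] acquires the factor [s^e] under rescaling, so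
    only those of deficit zero survive in the limit; their coefficients
    converge to the values at [z0]. *)
Lemma poly_eval_limit k P (F G : nat -> C -> C) (z : nat -> C) (s : nat -> R) z0 c r0 g : (1 <= k)%nat ->
  (forall i, (1 <= i <= nterms P)%nat -> (mono_order (mono P i) <= k)%nat) ->
  0 < r0 -> (forall i, (1 <= i <= nterms P)%nat -> hol z0 r0 (coef P i)) ->
  (forall n, 0 < s n) -> cvg z z0 -> cvg (fun n => RtoC (s n)) 0 -> conv_at c G g ->
  (exists r N, 0 < r /\ forall n x, (N <= n)%nat -> disc c r x -> forall j, (1 <= j <= k)%nat ->
     C_derive_n j (F n) (z n + RtoC (s n) * x)%C = (RtoC (s n ^ (k - j)) * C_derive_n j (G n) x)%C) ->
  conv_at c (fun n x => poly_eval P (F n) (z n + RtoC (s n) * x)%C)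
    (fun x => lsum (fun i => (if Nat.eq_dec (deficit k (mono P i)) 0 then coef P i z0 else 0) * C_derive_n k g x ^ exponent (mono P i) k)%C (seq 1 (nterms P))).
Proof.
  intros Hk Ho Hr0 Hc Hs Cz Cs CG [r [N [Hr HF]]].
  assert (Small : forall e, 0 < e -> exists N, forall n, (N <= n)%nat -> forall x, disc c 1 x -> Cmod (z n + RtoC (s n) * x - z0) < e).
  { intros e He; destruct (Cz (e / 2) ltac:(lra)) as [N1 H1].
    pose proof (Cmod_ge_0 c) as Pc.
    destruct (Cs (e / (2 * (Cmod c + 1))) ltac:(apply Rdiv_lt_0_compat; lra)) as [N2 H2].
    exists (Nat.max N1 N2); intros n Hn x Hx; specialize (H1 n ltac:(lia)); specialize (H2 n ltac:(lia)).
    apply Rlt_div_r in H2; [|lra]; replace (RtoC (s n) - 0)%C with (RtoC (s n)) in H2 by ring.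
    replace (z n + RtoC (s n) * x - z0)%C with ((z n - z0) + RtoC (s n) * x)%C by ring.
    eapply Rle_lt_trans; [apply Cmod_triangle|]; rewrite Cmod_mult.
    pose proof (Cmod_ge_sub x c); unfold disc in Hx; pose proof (Cmod_ge_0 (RtoC (s n))); nra. }
  assert (CC : forall i, (1 <= i <= nterms P)%nat -> conv_at c (fun n x => coef P i (z n + RtoC (s n) * x)%C) (fun _ => coef P i z0)).
  { intros i Hi; exists 1; split; [lra|split].
    - destruct (Small r0 Hr0) as [N1 H1]; exists N1; intros n Hn x Hx.
      apply (der_comp (coef P i) (fun x => z n + RtoC (s n) * x)%C); [eapply isd_der, isd_affine|apply (Hc i Hi), H1; assumption].
    - intros e He; destruct (proj1 (cts_eps _ _) (der_cts _ _ (Hc i Hi z0 (disc_center z0 r0 Hr0))) e He) as [d [Hd K]].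
      destruct (Small d Hd) as [N1 H1]; exists N1; intros n Hn x Hx; apply K, H1; assumption. }
  assert (CD : forall i, (1 <= i <= nterms P)%nat -> conv_at c (fun n _ => RtoC (s n ^ deficit k (mono P i))) (fun _ => if Nat.eq_dec (deficit k (mono P i)) 0 then 1 else 0)).
  { intros i Hi; destruct (deficit k (mono P i)) as [|e]; [apply (conv_at_cst c 1)|].
    apply (conv_at_const c (fun n => RtoC (s n ^ S e)) 0); intros eps He.
    destruct (Cs (Rmin 1 eps) ltac:(pos)) as [N1 H1]; exists N1; intros n Hn; specialize (H1 n Hn).
    replace (RtoC (s n) - 0)%C with (RtoC (s n)) in H1 by ring; replace (RtoC (s n ^ S e) - 0)%C with (RtoC (s n ^ S e)) by ring.
    rewrite Cmod_R, Rabs_pos_eq in H1 by (left; apply Hs); rewrite Cmod_R, Rabs_pos_eq by (apply pow_le; left; apply Hs).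
    pose proof (Rmin_l 1 eps); pose proof (Rmin_r 1 eps); pose proof (Hs n).
    pose proof (pow_le_self (s n) e ltac:(lra)); lra. }
  apply conv_at_ext with
    (F := fun n x => lsum (fun i => coef P i (z n + RtoC (s n) * x) * (RtoC (s n ^ deficit k (mono P i)) * mono_eval (mono P i) (G n) x))%C (seq 1 (nterms P)))
    (f := fun x => lsum (fun i => coef P i z0 * ((if Nat.eq_dec (deficit k (mono P i)) 0 then 1 else 0) * mono_eval (mono P i) g x))%C (seq 1 (nterms P))).
  - exists r, N; split; [exact Hr|]; intros x Hx; split.
    + unfold lsum; f_equal; apply map_ext_in; intros i Hi; apply in_seq in Hi.
      destruct Nat.eq_dec as [E|E]; [|ring]; rewrite (mono_eval_full k) by (auto; apply Ho; lia); ring.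
    + intros n Hn; unfold poly_eval, lsum; f_equal; apply map_ext_in; intros i Hi; apply in_seq in Hi; f_equal; symmetry.
      apply mono_eval_scale; [apply Ho; lia|]; intros j Hj; apply HF; assumption.
  - assert (K : forall i, In i (seq 1 (nterms P)) -> (1 <= i <= nterms P)%nat) by (intros i Hi; apply in_seq in Hi; lia).
    unfold lsum; revert K; generalize (seq 1 (nterms P)); induction l as [|i l IH]; intros K; [apply (conv_at_cst c 0)|].
    refine (conv_at_plus c (fun n x => coef P i (z n + RtoC (s n) * x) * (RtoC (s n ^ deficit k (mono P i)) * mono_eval (mono P i) (G n) x))%C
      (fun x => coef P i z0 * ((if Nat.eq_dec (deficit k (mono P i)) 0 then 1 else 0) * mono_eval (mono P i) g x))%C _ _ _ (IH _)).
    + assert (Hi := K i (or_introl eq_refl)).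
      apply (conv_at_mult c _ _ (fun n x => RtoC (s n ^ deficit k (mono P i)) * mono_eval (mono P i) (G n) x)%C
        (fun x => (if Nat.eq_dec (deficit k (mono P i)) 0 then 1 else 0) * mono_eval (mono P i) g x)%C (CC i Hi)).
      apply (conv_at_mult c _ _ (fun n => mono_eval (mono P i) (G n)) (mono_eval (mono P i) g) (CD i Hi)), conv_at_mono_eval, CG.
    + intros j Hj; apply K; right; exact Hj.
Qed.

(** * The rescaled limit *)

(** Such a [g] would be a polynomial of degree between 1 and [k], by the
    identity theorem. It has a root, by the fundamental theorem of algebra, and
    the order of this root would exceed the degree. *)
Lemma derive_n_locally_constant k g x0 b d : (forall x, sph g x) -> nonconstant g ->
  (forall x, g x = Fin 0 -> forall j, (j <= k)%nat -> C_derive_n j (finpart g) x = 0) ->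
  g x0 <> Inf -> 0 < d -> (forall x, disc x0 d x -> C_derive_n k (finpart g) x = b) -> False.
Proof.
  intros Hs Hn Hz Ni Hd E; destruct (sph_finite g x0 (Hs x0) Ni) as [r [Hr [K1 K2]]].
  destruct (derive_n_const_psum k (finpart g) x0 (Rmin d r) b) as [a [A1 A2]].
  { pos. }
  { eapply hol_le; [apply Rmin_r|exact K1]. }
  { intros x Hx; apply E; exact (disc_minl Hx). }
  pose (T := fun z => psum a (S k) (z - x0)%C).
  assert (HT : entire T) by apply entire_psum.
  assert (G : forall x, g x = Fin (T x)).
  { apply (identity_sph g T Hs HT); exists x0, (Rmin d r); split; [pos|].
    intros x Hx; rewrite (K2 x) by exact (disc_minr Hx); f_equal; apply A1, Hx. }
  assert (FT : finpart g = T) by (apply functional_extensionality; intros x; apply finpart_Fin, G).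
  destruct (classic (exists j, (1 <= j < S k)%nat /\ a j <> RtoC 0)) as [J|J].
  - destruct (psum_surjective a (S k) J 0) as [y Hy]; set (x1 := (y + x0)%C).
    assert (Z : T x1 = 0) by (unfold T, x1; replace (y + x0 - x0)%C with y by ring; exact Hy).
    assert (V : forall x, disc x1 1 x -> T x = 0).
    { apply (derive_n_const_zero k T x1 1 b); [lra|apply entire_hol, HT|intros x _; apply A2|].
      rewrite <- FT; apply Hz; rewrite G, Z; reflexivity. }
    apply Hn; exists (Fin 0); apply (constant_near g 0 x1 1 Hs); [lra|]; intros x Hx; rewrite G, (V x Hx); reflexivity.
  - apply Hn; exists (Fin (a 0%nat)); intros x; rewrite G; f_equal; unfold T; generalize (x - x0)%C; intros w.
    assert (Q : forall m, (m <= k)%nat -> psum a (S m) w = a 0%nat).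
    { induction m as [|m IH]; intros Hm; [simpl; ring|].
      change (psum a (S m) w + a (S m) * w ^ S m = a 0%nat)%C; rewrite IH by lia.
      assert (a (S m) = 0) as -> by (apply NNPP; intros N; apply J; exists (S m); split; [lia|exact N]); ring. }
    apply Q; lia.
Qed.

(** Each differentiation raises the order of a pole by one. *)
Lemma pole_derivative c r q H : hol c r H -> H c <> RtoC 0 -> (1 <= q)%nat -> forall k F,
  (forall z, disc c r z -> z <> c -> F z = (H z / (z - c) ^ q)%C) ->
  exists K, hol c r K /\ K c <> RtoC 0 /\ forall z, disc c r z -> z <> c -> C_derive_n k F z = (K z / (z - c) ^ (q + k))%C.
Proof.
  intros HH Hc Hq k F EF; induction k as [|k [K [K1 [K2 K3]]]].
  - exists H; rewrite Nat.add_0_r; auto.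
  - exists (fun z => (z - c) * C_derive K z - RtoC (INR (q + k)) * K z)%C; split; [|split].
    + apply hol_minus; apply hol_mult; [|apply hol_derive, K1|apply hol_const|exact K1].
      intros z _; apply der_sub.
    + replace ((c - c) * C_derive K c - RtoC (INR (q + k)) * K c)%C with (- RtoC (INR (q + k)) * K c)%C by ring.
      apply Cmult_neq_0; [|exact K2]; intros Q; assert (E : RtoC (INR (q + k)) = 0) by (replace (RtoC (INR (q + k))) with (- - RtoC (INR (q + k)))%C by ring; rewrite Q; ring).
      apply RtoC_inj in E; assert (0 < INR (q + k)) by (apply lt_0_INR; lia); lra.
    + intros z Hz Hne; assert (Nz := Cminus_nz z c Hne).
      change (C_derive (C_derive_n k F) z = (((z - c) * C_derive K z - RtoC (INR (q + k)) * K z) / (z - c) ^ (q + S k))%C).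
      replace (q + k)%nat with (S (q + k - 1)) in * by lia; set (m := (q + k - 1)%nat) in *.
      replace (q + S k)%nat with (S (S m)) by lia.
      assert (Pz : forall n, ((z - c) ^ n)%C <> 0) by (intros n; apply Cpow_nz, Nz).
      pose proof (isd_mult _ _ _ _ _ (K1 z Hz) (isd_inv _ z _ (Pz (S m)) (isd_pow c z m))) as I; cbv beta in I.
      apply isd_C_derive, isd_ext_loc with (fun z => K z * / (z - c) ^ S m)%C.
      * generalize (punctured_open c r z Hz Hne); apply filter_imp; intros w [W1 W2]; symmetry; apply K3; assumption.
      * replace (((z - c) * C_derive K z - RtoC (INR (S m)) * K z) / (z - c) ^ S (S m))%C
          with (C_derive K z * / (z - c) ^ S m + K z * (- (RtoC (INR (S m)) * (z - c) ^ m) / ((z - c) ^ S m * (z - c) ^ S m)))%C; [exact I|].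
        rewrite !Cpow_S; field; split; [apply Pz|exact Nz].
Qed.

(** A derivative has only multiple poles. So if it omits the values [b1] and
    [b2], then [(h - b1) / (h - b2)] is entire without zeros, and takes the
    value 1, at the poles, with multiplicity greater than one. *)
Lemma derivative_omits_two k g b1 b2 : (1 <= k)%nat -> (forall x, sph g x) -> nonconstant g -> b1 <> b2 ->
  (forall x, g x = Fin 0 -> forall j, (j <= k)%nat -> C_derive_n j (finpart g) x = 0) ->
  (forall x, g x <> Inf -> C_derive_n k (finpart g) x <> b1 /\ C_derive_n k (finpart g) x <> b2) -> False.
Proof.
  intros Hk Hs Hn Hb Hz Ho; set (h := C_derive_n k (finpart g)) in *.
  pose (u := fun x => if excluded_middle_informative (g x = Inf) then RtoC 1 else ((h x - b1) / (h x - b2))%C).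
  assert (Uf : forall x, g x <> Inf -> u x = ((h x - b1) / (h x - b2))%C).
  { intros x Hx; unfold u; destruct excluded_middle_informative as [E|_]; [elim Hx; exact E|reflexivity]. }
  assert (Up : forall x, g x = Inf -> u x = 1).
  { intros x Hx; unfold u; destruct excluded_middle_informative as [_|E]; [reflexivity|elim E; exact Hx]. }
  assert (Fin_near : forall x, g x <> Inf -> exists r, 0 < r /\ hol x r h /\ forall z, disc x r z -> g z <> Inf).
  { intros x Hx; destruct (sph_finite g x (Hs x) Hx) as [r [Hr [K1 K2]]]; exists r; split; [exact Hr|split].
    - apply (hol_derive_n (finpart g) x r k K1).
    - intros z Hz'; rewrite (K2 z Hz'); discriminate. }
  assert (Pole : forall x, g x = Inf -> der u x /\ C_derive u x = 0).
  { intros x Hx; destruct (sph_cases g x (Hs x)) as [[N _]|[_ [r [Hr [K1 K2]]]]]; [now elim N|].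
    set (G := finpart (sinvf g)) in *.
    assert (Gx : G x = 0) by (unfold G, finpart, sinvf; rewrite Hx; reflexivity).
    destruct (zero_order G x r Hr K1) as [Z|[q [H [H1 [H2 H3]]]]].
    { exfalso; apply Hn; exists Inf; intros z.
      assert (E : forall z, sinvf g z = Fin 0).
      { apply (constant_near (sinvf g) 0 x r); [intros; apply sph_sinvf, Hs|exact Hr|]; intros w Hw; rewrite (K2 w Hw), (Z w Hw); reflexivity. }
      rewrite (sinv_sinvf g z); rewrite E; apply sinv_0. }
    destruct q as [|q].
    { exfalso; apply H2; specialize (H3 x (disc_center x r Hr)); rewrite Gx in H3; simpl in H3.
      replace (H x) with (1 * H x)%C by ring; symmetry; exact H3. }
    destruct (nonzero_near H x (der_cts _ _ (H1 x (disc_center x r Hr))) H2) as [s [Hs' N]].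
    set (t := Rmin r s); assert (Ht : 0 < t) by pos.
    assert (T1 : forall z, disc x t z -> disc x r z) by (intros z; apply disc_le, Rmin_l).
    assert (T2 : forall z, disc x t z -> H z <> 0) by (intros z Hz'; apply N; exact (disc_minr Hz')).
    assert (Gf : forall z, disc x t z -> z <> x -> g z = Fin (/ ((z - x) ^ S q * H z))).
    { intros z Hz' Hne; rewrite (sinv_sinvf g z).
      rewrite (K2 z (T1 z Hz')), (H3 z (T1 z Hz')); apply sinv_Fin, Cmult_neq_0; [apply Cpow_nz, Cminus_nz, Hne|apply T2, Hz']. }
    destruct (pole_derivative x t (S q) (fun z => / H z)%C) with (k := k) (F := finpart g) as [K [D1 [D2 D3]]].
    { intros z Hz'; apply der_inv; [apply T2, Hz'|apply H1, T1, Hz']. }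
    { apply Cinv_nz, H2. }
    { lia. }
    { intros z Hz' Hne; rewrite (finpart_Fin g z _ (Gf z Hz' Hne)); field; split; [apply T2, Hz'|apply Cpow_nz, Cminus_nz, Hne]. }
    fold h in D3; set (m := (S q + k)%nat) in *.
    assert (Hden : hol x t (fun z => K z - b2 * (z - x) ^ m)%C).
    { apply hol_minus; [exact D1|apply hol_mult; [apply hol_const|apply hol_sub_pow]]. }
    assert (Z0 : ((x - x) ^ m)%C = 0) by (unfold m; replace (x - x)%C with (RtoC 0) by ring; simpl; ring).
    destruct (nonzero_near _ x (der_cts _ _ (Hden x (disc_center x t Ht)))) as [d [Hd Nd]].
    { rewrite Z0; replace (K x - b2 * 0)%C with (K x) by ring; exact D2. }
    set (e := Rmin t d); assert (He : 0 < e) by pos.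
    assert (Sub : forall z, disc x e z -> disc x t z /\ disc x d z).
    { intros z Hz'; split; (eapply disc_le; [|exact Hz']); [apply Rmin_l|apply Rmin_r]. }
    pose (E := fun z => ((b2 - b1) / (K z - b2 * (z - x) ^ m))%C).
    assert (HE : hol x e E).
    { intros z Hz'; destruct (Sub z Hz') as [S1 S2]; apply (der_div (fun _ => b2 - b1)%C); [apply Nd, S2|apply der_const|apply Hden, S1]. }
    (* [(K / y - b1) / (K / y - b2) = 1 + y (b2 - b1) / (K - b2 y)] for [y = (z - x)^m] *)
    assert (UE : forall z, disc x e z -> u z = (1 + (z - x) ^ S (m - 1) * E z)%C).
    { intros z Hz'; destruct (Sub z Hz') as [S1 S2]; replace (S (m - 1)) with m by (unfold m; lia).
      destruct (classic (z = x)) as [->|Hne]; [rewrite Up by exact Hx; rewrite Z0; ring|].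
      assert (Gi : g z <> Inf) by (rewrite (Gf z S1 Hne); discriminate).
      rewrite (Uf z Gi), (D3 z S1 Hne); unfold E.
      assert (Pz : ((z - x) ^ m)%C <> 0) by (apply Cpow_nz, Cminus_nz, Hne).
      assert (Nz := Nd z S2); cbv beta in Nz; field; repeat split; try assumption. }
    split.
    - apply der_ext_loc with (fun z => 1 + (z - x) ^ S (m - 1) * E z)%C.
      + apply locally_disc; exists e; split; [exact He|]; intros z Hz'; symmetry; apply UE, Hz'.
      + apply (hol_plus x e (fun _ => 1) (fun z => (z - x) ^ S (m - 1) * E z)%C); [apply hol_const| |apply disc_center, He].
        apply hol_mult; [apply hol_sub_pow|exact HE].
    - apply (derive_zero_of_multiplicity x e 1 He (m - 1) u E HE UE 1); unfold m; lia. }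
  assert (Hu : entire u).
  { intros x; destruct (classic (g x = Inf)) as [Hx|Hx]; [apply Pole, Hx|].
    destruct (Fin_near x Hx) as [r [Hr [K1 K2]]]; apply der_ext_loc with (fun x => (h x - b1) / (h x - b2))%C.
    - apply locally_disc; exists r; split; [exact Hr|]; intros z Hz'; symmetry; apply Uf, K2, Hz'.
    - assert (Dh := K1 x (disc_center x r Hr)); apply der_div.
      + apply Cminus_nz, Ho, Hx.
      + apply der_minus; [exact Dh|apply der_const].
      + apply der_minus; [exact Dh|apply der_const]. }
  assert (Cross : forall x c, g x <> Inf -> u x = c -> (h x - b1)%C = (c * (h x - b2))%C).
  { intros x c Hx <-; rewrite (Uf x Hx); field; apply Cminus_nz, Ho, Hx. }
  assert (Const := entire_ramified u Hu).
  assert (C1 : forall x y, u x = u y).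
  { apply Const.
    - intros x Q; destruct (classic (g x = Inf)) as [Hx|Hx]; [rewrite (Up x Hx) in Q; exact (C1_nz Q)|].
      apply (proj1 (Ho x Hx)), Cminus_eq; rewrite (Cross x 0 Hx Q); ring.
    - intros x Q; destruct (classic (g x = Inf)) as [Hx|Hx]; [apply Pole, Hx|].
      elim Hb; pose proof (Cross x 1 Hx Q) as W.
      apply Cminus_eq; replace (b1 - b2)%C with (1 * (h x - b2) - (h x - b1))%C by ring; rewrite W; ring. }
  assert (Ex : exists x, g x <> Inf).
  { apply NNPP; intros N; apply Hn; exists Inf; intros x; apply NNPP; intros Q; apply N; exists x; exact Q. }
  destruct Ex as [x0 Hx0]; destruct (Fin_near x0 Hx0) as [r [Hr [K1 K2]]].
  apply (derive_n_locally_constant k g x0 (h x0) r Hs Hn Hz Hx0 Hr); intros x Hx; change (h x = h x0).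
  assert (X1 := Cross x _ (K2 x Hx) (C1 x x0)); assert (X2 := Cross x0 _ Hx0 eq_refl).
  set (c := u x0) in *.
  (* eliminate [c] between the two equations *)
  assert (X3 : ((b2 - b1) * (h x - h x0))%C = 0).
  { transitivity ((h x - b2) * (h x0 - b1) - (h x - b1) * (h x0 - b2))%C; [ring|rewrite X1, X2; ring]. }
  apply Cminus_eq, NNPP; intros N; apply (Cmult_neq_0 (b2 - b1)%C _ (Cminus_nz _ _ (fun Q => Hb (eq_sym Q))) N), X3.
Qed.

Lemma finite_gap (l : list C) a : exists mu, 0 < mu /\ forall t, In t l -> t <> a -> mu <= Cmod (t - a).
Proof.
  induction l as [|t l [mu [Hmu IH]]]; [exists 1; split; [lra|intros t []]|].
  destruct (classic (t = a)) as [->|Ne].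
  - exists mu; split; [exact Hmu|]; intros t [<-|Ht] N; [now elim N|apply IH; assumption].
  - exists (Rmin mu (Cmod (t - a))); split; [apply Rmin_glb_lt; [exact Hmu|apply Cmod_pos, Ne]|].
    intros w [<-|Hw] N; [apply Rmin_r|eapply Rle_trans; [apply Rmin_l|apply IH; assumption]].
Qed.

Lemma resc_Fin k a f z (s : R) x w : 0 < s -> resc k a f z s x = Fin w -> f (z + RtoC s * x)%C = Fin (a + RtoC (s ^ k) * w).
Proof.
  intros Hs; unfold resc; destruct (f (z + RtoC s * x)%C) as [v|]; simpl; [|discriminate].
  intros E; apply (f_equal finval) in E; cbn [finval] in E; rewrite <- E; f_equal; field.
  apply RtoC_nz, pow_nonzero; lra.
Qed.

(** Let [Q] be the limit polynomial and [h] the [k]-th derivative of [g], so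
    that the rescaled [P[f n]] converge to [Q (h)]. A point where [Q (h)] takes
    a nonzero value [b] in [S1] would, by Hurwitz's theorem, be a limit of
    points where [P[f n] = b], so that [f n] takes a value in [S2] there. As
    [f n] is close to [a] near such points and [S2] is finite, this value is
    [a]; but at the zeros of [f n - a] their order makes [P[f n]] vanish. If
    [Q (h)] is [b] identically near the point, Hurwitz's theorem fails, but
    then [h] is constant there. Hence [Q (h)] omits [b1] and [b2], and as [Q]
    is surjective, [h] omits two values. *)
Lemma rescaled_contradiction (D S1 S2 : C -> Prop) P k a b1 b2 (f : nat -> C -> Csph) (z : nat -> C) (s : nat -> R) z0 g :
  (1 <= k)%nat -> open D -> D z0 ->
  (forall n, meromorphic D (f n)) -> finite_set S2 -> S1 b1 -> S1 b2 -> b1 <> RtoC 0 -> b2 <> RtoC 0 -> b1 <> b2 ->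
  (forall i, (1 <= i <= nterms P)%nat -> holomorphic D (coef P i)) ->
  (forall i, (1 <= i <= nterms P)%nat -> (mono_order (mono P i) <= k)%nat) -> deficit k (mono P 1) = 0%nat ->
  (forall i, (1 <= i <= nterms P)%nat -> deficit k (mono P i) = 0%nat -> coef P i z0 <> RtoC 0) ->
  (forall n w, D w -> f n w = Fin a -> forall p, zero_multiplicity (f n) a w p -> (S k <= p)%nat) ->
  (forall n, partially_shares D (poly_apply P (f n)) S1 (f n) S2) ->
  (forall n, 0 < s n) -> cvg z z0 -> cvg (fun n => RtoC (s n)) 0 ->
  (forall x, conv_sph (fun n => resc k a (f n) (z n) (s n)) g x) -> nonconstant g -> False.
Proof.
  intros Hk OD Dz0 Hmer [l2 HS2] Sb1 Sb2 Nb1 Nb2 Nb Hcoef Ho Hdef Hcnz Hmult Hshare Hs Cz Cs Cv Hn.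
  set (u := fun n => resc k a (f n) (z n) (s n)) in *.
  assert (Hsg : forall x, sph g x) by (intros x; eapply conv_sph_limit, Cv).
  destruct (proj1 (open_disc D) OD z0 Dz0) as [r0 [Hr0 Sub0]].
  assert (Hsph : forall n w, D w -> sph (f n) w).
  { intros n w Hw; destruct (Hmer n w Hw); [apply regular_sph|apply pole_sph]; assumption. }
  assert (Dom' : forall x, exists N, forall n, (N <= n)%nat -> forall y, disc x 1 y -> disc z0 r0 (z n + RtoC (s n) * y)%C).
  { intros x; destruct (Cz (r0 / 2) ltac:(lra)) as [N1 H1]; pose proof (Cmod_ge_0 x) as Px.
    destruct (Cs (r0 / (2 * (Cmod x + 1))) ltac:(apply Rdiv_lt_0_compat; lra)) as [N2 H2].
    exists (Nat.max N1 N2); intros n Hn' y Hy; specialize (H1 n ltac:(lia)); specialize (H2 n ltac:(lia)).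
    apply Rlt_div_r in H2; [|lra]; replace (RtoC (s n) - 0)%C with (RtoC (s n)) in H2 by ring.
    unfold disc in *; replace (z n + RtoC (s n) * y - z0)%C with ((z n - z0) + RtoC (s n) * y)%C by ring.
    eapply Rle_lt_trans; [apply Cmod_triangle|]; rewrite Cmod_mult.
    pose proof (Cmod_ge_sub y x); pose proof (Cmod_ge_0 (RtoC (s n))); nra. }
  assert (Dom : forall xi x, cvg xi x -> exists N, forall n, (N <= n)%nat -> disc z0 r0 (z n + RtoC (s n) * xi n)%C).
  { intros xi x Hxi; destruct (Dom' x) as [N1 H1]; destruct (Hxi 1 ltac:(lra)) as [N2 H2].
    exists (Nat.max N1 N2); intros n Hn'; apply H1; [lia|apply H2; lia]. }
  (* where [f = a], all derivatives up to order [k] vanish *)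
  assert (Vanish : forall n w, D w -> f n w = Fin a -> forall j, (1 <= j <= k)%nat -> C_derive_n j (finpart (f n)) w = 0).
  { intros n w Hw E; apply (derive_zero_at (f n) w a k (Hsph n w Hw) E); apply Hmult; assumption. }
  assert (Scale : forall n x, D (z n + RtoC (s n) * x)%C -> u n x <> Inf -> forall j, (1 <= j <= k)%nat ->
     C_derive_n j (finpart (f n)) (z n + RtoC (s n) * x)%C = (RtoC (s n ^ (k - j)) * C_derive_n j (finpart (u n)) x)%C).
  { intros n x Dx Ni j Hj; destruct j as [|j]; [lia|]; unfold u.
    rewrite (derive_n_resc k a (f n) (z n) (s n) x (Hs n) (Hsph n _ Dx)).
    - rewrite <- RtoC_pow; assert (Psk : s n ^ k <> 0) by (apply pow_nonzero; pose proof (Hs n); lra).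
      rewrite Cmult_assoc, <- RtoC_div by exact Psk; rewrite <- RtoC_mult.
      replace (s n ^ (k - S j) * (s n ^ S j / s n ^ k)) with 1; [ring|].
      replace (s n ^ (k - S j) * (s n ^ S j / s n ^ k)) with (s n ^ (k - S j + S j) / s n ^ k) by (rewrite pow_add; field; exact Psk).
      replace (k - S j + S j)%nat with k by lia; field; exact Psk.
    - intros Q; apply Ni; unfold u, resc; rewrite Q; reflexivity. }
  assert (Hz : forall x, g x = Fin 0 -> forall j, (j <= k)%nat -> C_derive_n j (finpart g) x = 0).
  { intros x Ex j Hj; destruct (conv_sph_fin _ g x (Cv x) ltac:(rewrite Ex; discriminate)) as [A [r [N [Hr B]]]].
    destruct j as [|j]; [exact (finpart_Fin g x _ Ex)|].
    destruct (hurwitz_seq x _ _ A (finpart_Fin g x _ Ex)) as [xi [M [X1 X2]]].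
    { intros [d [Hd K]]; apply Hn; exists (Fin 0); apply (constant_near g 0 x (Rmin d r) Hsg); [pos|]; intros w Hw.
      rewrite (proj2 (B N w (le_n N) (disc_minr Hw))), (K w); [reflexivity|].
      exact (disc_minl Hw). }
    destruct (Dom xi x X1) as [N2 H2]; destruct (X1 r Hr) as [N3 H3].
    apply (cvg_unique (fun n => C_derive_n (S j) (finpart (u n)) (xi n))).
    - apply (conv_at_moving x (fun n => C_derive_n (S j) (finpart (u n))) (C_derive_n (S j) (finpart g))); [apply conv_at_derive_n, A|exact X1].
    - intros e He; exists (Nat.max N (Nat.max M (Nat.max N2 N3))); intros n Hn'.
      specialize (H2 n ltac:(lia)); specialize (X2 n ltac:(lia)); specialize (H3 n ltac:(lia)).
      destruct (B n (xi n) ltac:(lia) H3) as [B1 _]; rewrite X2 in B1.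
      assert (Fa : f n (z n + RtoC (s n) * xi n)%C = Fin a).
      { rewrite (resc_Fin k a (f n) (z n) (s n) (xi n) 0 (Hs n) B1); f_equal; ring. }
      assert (V := Vanish n _ (Sub0 _ H2) Fa (S j) ltac:(lia)).
      rewrite (Scale n (xi n) (Sub0 _ H2) ltac:(rewrite B1; discriminate) (S j) ltac:(lia)) in V.
      assert (Z : C_derive_n (S j) (finpart (u n)) (xi n) = 0).
      { apply NNPP; intros Q; refine (Cmult_neq_0 _ _ _ Q V); apply RtoC_nz, pow_nonzero; pose proof (Hs n); lra. }
      rewrite Z, Cmod_self; exact He. }
  destruct (limit_polynomial_surjective k P z0 Hk Ho Hdef Hcnz) as [Q [HQ [Qs QE]]].
  set (h := C_derive_n k (finpart g)).
  assert (HolC : forall i, (1 <= i <= nterms P)%nat -> hol z0 r0 (coef P i)).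
  { intros i Hi w Hw; apply ex_derive_isd, Hcoef; [exact Hi|apply Sub0, Hw]. }
  assert (Omit : forall b, S1 b -> b <> RtoC 0 -> forall x, g x <> Inf -> Q (h x) <> b).
  { intros b Sb Nzb x Hx EQ; destruct (conv_sph_fin _ g x (Cv x) Hx) as [A [r [N [Hr B]]]].
    destruct (Dom' x) as [N1 HN1].
    assert (CP : conv_at x (fun n x => poly_eval P (finpart (f n)) (z n + RtoC (s n) * x)%C) (fun x => Q (h x))).
    { apply conv_at_ext with (2 := poly_eval_limit k P (fun n => finpart (f n)) (fun n => finpart (u n)) z s z0 x r0 (finpart g)
        Hk Ho Hr0 HolC Hs Cz Cs A ltac:(exists (Rmin r 1), (Nat.max N N1); split; [pos|];
          intros n y Hn' Hy j Hj; apply Scale; [apply Sub0, HN1; [lia|exact (disc_minr Hy)]| |exact Hj];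
          rewrite (proj1 (B n y ltac:(lia) (disc_minl Hy))); discriminate)).
      exists 1, 0%nat; split; [lra|]; intros y _; split; [symmetry; apply QE|reflexivity]. }
    destruct (classic (vanishes_near (fun x => Q (h x) - b)%C x)) as [[d [Hd V]]|NV].
    - (* then [h] stays in a discrete set near [x] *)
      destruct (isolated_zero (fun w => Q w - b)%C (h x) 1 ltac:(lra)) as [Zr|[e [He Iso]]].
      { apply hol_minus; [apply entire_hol, HQ|apply hol_const]. }
      { destruct (Qs 0) as [w Hw]; apply Nzb.
        assert (Ag : forall y, Fin (Q y) = Fin b).
        { apply (constant_near (fun y => Fin (Q y)) b (h x) 1); [|lra|intros y Hy; f_equal; apply Cminus_eq, Zr, Hy].
          intros y; exists 1; split; [lra|left; exists Q; split; [apply entire_hol, HQ|reflexivity]]. }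
        specialize (Ag w); rewrite Hw in Ag; symmetry; apply (f_equal finval) in Ag; exact Ag. }
      destruct (sph_finite g x (Hsg x) Hx) as [t [Ht [K1 _]]].
      assert (Ch : cts h x) by (apply der_cts, (hol_derive_n (finpart g) x t k K1), disc_center, Ht).
      destruct (proj1 (cts_eps _ _) Ch e ltac:(lra)) as [q [Hq L]].
      apply (derive_n_locally_constant k g x (h x) (Rmin d q) Hsg Hn Hz Hx); [pos|].
      intros y Hy; change (h y = h x); apply NNPP; intros Ne.
      apply (Iso (h y)); [apply L; exact (disc_minr Hy)|exact Ne|].
      apply V; exact (disc_minl Hy).
    - destruct (hurwitz_seq x _ _ (conv_at_minus_cst x _ _ b CP)) as [xi [M [X1 X2]]]; [rewrite EQ; ring|exact NV|].
      destruct (Dom xi x X1) as [N2 H2]; destruct (X1 r Hr) as [N3 H3].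
      destruct (conv_at_moving x _ _ xi A X1 1 ltac:(lra)) as [N4 H4].
      destruct (finite_gap l2 a) as [mu [Hmu Gap]].
      set (W := Cmod (finpart g x) + 1); assert (HW : 0 < W) by (unfold W; pose proof (Cmod_ge_0 (finpart g x)); lra).
      destruct (Cs (Rmin 1 (mu / W)) ltac:(pos)) as [N5 H5].
      set (n := Nat.max (Nat.max N M) (Nat.max (Nat.max N2 N3) (Nat.max N4 N5))).
      specialize (X2 n ltac:(lia)); specialize (H2 n ltac:(lia)); specialize (H3 n ltac:(lia)); specialize (H4 n ltac:(lia)); specialize (H5 n ltac:(lia)).
      apply Cminus_eq in X2; set (y := (z n + RtoC (s n) * xi n)%C) in *.
      destruct (B n (xi n) ltac:(lia) H3) as [B1 _]; set (v := finpart (u n) (xi n)) in *.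
      assert (Fy := resc_Fin k a (f n) (z n) (s n) (xi n) v (Hs n) B1); fold y in Fy.
      assert (Dy := Sub0 y H2).
      destruct (sph_finite (f n) y (Hsph n y Dy) ltac:(rewrite Fy; discriminate)) as [t [Ht [T1 _]]].
      assert (PA : poly_apply P (f n) y = Fin b).
      { destruct (disc_sub z0 r0 y H2) as [t' [Ht' Sub']].
        rewrite (poly_apply_regular P (f n) y (Rmin t t')); [rewrite X2; reflexivity|pos| |].
        - eapply hol_le; [apply Rmin_l|exact T1].
        - intros i Hi w Hw; apply (HolC i Hi), Sub'; exact (disc_minr Hw). }
      destruct (Hshare n y) as [_ [t2 [St2 Et2]]]; [split; [exact Dy|exists b; auto]|].
      rewrite Fy in Et2; apply (f_equal finval) in Et2; cbn [finval] in Et2.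
      assert (Ta : t2 = a).
      { apply NNPP; intros Ne; specialize (Gap t2 (proj1 (HS2 t2) St2) Ne); rewrite <- Et2, add_sub, Cmod_mult, Cmod_R in Gap.
        replace (RtoC (s n) - 0)%C with (RtoC (s n)) in H5 by ring; rewrite Cmod_R, Rabs_pos_eq in H5 by (left; apply Hs).
        pose proof (Rmin_l 1 (mu / W)); pose proof (Rmin_r 1 (mu / W)); pose proof (Hs n) as Psn.
        assert (S1n : s n ^ k <= s n) by (destruct k as [|k']; [lia|apply pow_le_self; lra]).
        rewrite Rabs_pos_eq in Gap by (apply pow_le; lra).
        assert (Vb : Cmod v < W) by (pose proof (Cmod_ge_sub v (finpart g x)); unfold W; lra).
        assert (s n * W < mu) by (apply Rlt_div_r; lra).
        assert (s n ^ k * Cmod v <= s n * W); [|lra].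
        apply Rmult_le_compat; [apply pow_le; lra|apply Cmod_ge_0|exact S1n|lra]. }
      apply Nzb; rewrite <- X2; apply (poly_eval_zero k); [exact Ho|].
      apply (Vanish n y Dy); rewrite Fy, Et2, Ta; reflexivity. }
  destruct (Qs b1) as [c1 C1]; destruct (Qs b2) as [c2 C2].
  apply (derivative_omits_two k g c1 c2 Hk Hsg Hn); [intros ->; apply Nb; congruence|exact Hz|].
  intros x Hx; split; intros E; [apply (Omit b1 Sb1 Nb1 x Hx)|apply (Omit b2 Sb2 Nb2 x Hx)]; fold h in E; rewrite E; assumption.
Qed.

(** * Normality *)

Lemma hc_spherical e : 0 < e -> exists d, 0 < d /\ forall p q, half_chord p q < d -> spherical_dist p q < e.
Proof.
  intros He; set (m := Rmin (e / 2) (PI / 2)); pose proof PI_RGT_0.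
  assert (Hm : 0 < m <= e / 2 /\ m <= PI / 2) by (unfold m; pose proof (Rmin_l (e / 2) (PI / 2)); pose proof (Rmin_r (e / 2) (PI / 2)); assert (0 < Rmin (e / 2) (PI / 2)) by pos; lra).
  exists (sin m); split; [apply sin_gt_0; lra|]; intros p q Hpq; unfold spherical_dist.
  assert (asin (half_chord p q) < m); [|lra].
  pose proof (hc_ge0 p q); pose proof (hc_le1 p q); apply Rnot_le_lt; intros L.
  pose proof (asin_bound (half_chord p q)).
  apply (Rlt_not_le _ _ Hpq); rewrite <- (sin_asin (half_chord p q)) by lra.
  apply sin_incr_1; lra.
Qed.

Definition locally_bounded_sharp (F : (C -> Csph) -> Prop) (z : C) : Prop :=
  exists d L, 0 < d /\ 0 <= L /\ forall f, F f -> forall w, disc z d w -> sharp f L w.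

(** Marty's criterion yields a limit on all of [D] at once, and connectedness
    makes it meromorphic or identically [Inf]. *)
Theorem marty_normal D F : domain D -> (forall f, F f -> meromorphic D f) ->
  (forall z, D z -> locally_bounded_sharp F z) -> normal_family D F.
Proof.
  intros [OD [_ CD]] HF HB u Hu; destruct (marty u) as [phi [g [Hphi M]]].
  assert (MA : forall z, D z -> marty_at u z).
  { intros z Hz; destruct (HB z Hz) as [d [L [Hd [HL K]]]]; destruct (proj1 (open_disc D) OD z Hz) as [r [Hr Sub]].
    exists (Rmin d r), L, 0%nat; split; [pos|split; [exact HL|]]; intros n _ w Hw; split.
    - destruct (HF (u n) (Hu n) w); [apply Sub; exact (disc_minr Hw)|apply regular_sph; assumption|apply pole_sph; assumption].
    - apply K; [apply Hu|exact (disc_minl Hw)]. }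
  exists phi; split; [exact Hphi|]; exists g; split.
  - apply inf_dichotomy; [exact CD|]; intros z Hz; apply (M z (MA z Hz)).
  - intros z Hz; destruct (M z (MA z Hz)) as [[_ [_ [d [Hd HU]]]] _]; exists (mkposreal d Hd); intros eps.
    destruct (hc_spherical eps (cond_pos eps)) as [e [He K]]; destruct (HU e He) as [N HN].
    exists N; intros n w Hn _ Hw; apply K, HN; assumption.
Qed.

(** Large spherical derivatives near [z0] yield bad pairs of sizes tending to
    0, to which the rescaling lemma applies. *)
Lemma unbounded_zalcman D (F : (C -> Csph) -> Prop) k a z0 : open D -> D z0 -> (forall f, F f -> meromorphic D f) ->
  (forall f, F f -> forall w, D w -> f w = Fin a -> forall p, zero_multiplicity f a w p -> (S k <= p)%nat) ->
  ~ locally_bounded_sharp F z0 ->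
  exists (f : nat -> C -> Csph) z s g, (forall n, F (f n)) /\ (forall n, 0 < s n) /\ cvg z z0 /\ cvg (fun n => RtoC (s n)) 0 /\
    (forall x, conv_sph (fun n => resc k a (f n) (z n) (s n)) g x) /\ nonconstant g.
Proof.
  intros OD Dz HF Hm NB; destruct (proj1 (open_disc D) OD z0 Dz) as [r0 [Hr0 Sub]].
  set (c := Rmin 1 (r0 / 8)); assert (Hc : 0 < c <= 1 /\ c <= r0 / 8).
  { unfold c; pose proof (Rmin_l 1 (r0 / 8)); pose proof (Rmin_r 1 (r0 / 8)); assert (0 < Rmin 1 (r0 / 8)) by pos; lra. }
  (* [INR (S n) * s0 n] tends to [0], so that the discs of the rescaling lemma shrink to [z0] *)
  pose (s0 := fun n => c * (/ INR (S n) * / INR (S n))).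
  assert (Pn : forall n, 0 < / INR (S n) <= 1).
  { intros n; split; [apply inv_S_pos|]; rewrite <- Rinv_1; apply Rinv_le_contravar; [lra|]; rewrite S_INR; pose proof (pos_INR n); lra. }
  assert (Hs0 : forall n, 0 < s0 n <= c * / INR (S n)).
  { intros n; unfold s0; destruct (Pn n) as [P1 P2]; split; [repeat apply Rmult_lt_0_compat; lra|].
    apply Rmult_le_compat_l; [lra|]; rewrite <- (Rmult_1_r (/ INR (S n))) at 3; apply Rmult_le_compat_l; lra. }
  assert (Hs1 : forall n, s0 n <= 1).
  { intros n; destruct (Hs0 n) as [_ K]; destruct (Pn n); nra. }
  (* [A * (1 + |v|^2)] exceeds [1 + |v - a|^2] *)
  set (A := 3 + 2 * Cmod a ^ 2); assert (HA : 3 <= A) by (unfold A; pose proof (pow2_ge_0 (Cmod a)); lra).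
  assert (Pick : forall n, exists fz : (C -> Csph) * C, F (fst fz) /\ disc z0 (c * / INR (S n)) (snd fz) /\ bad k a (fst fz) (snd fz) (s0 n)).
  { intros n; apply NNPP; intros K; apply NB; destruct (Hs0 n) as [Ps _]; assert (Pk : 0 < s0 n ^ S k) by (apply pow_lt, Ps).
    exists (c * / INR (S n)), (A / s0 n ^ S k); split; [destruct (Pn n); nra|split; [left; apply Rdiv_lt_0_compat; lra|]].
    intros f Ff w Hw v Ev; apply Rnot_lt_le; intros L; apply K; exists (f, w); split; [exact Ff|split; [exact Hw|]].
    exists v; split; [exact Ev|]; simpl fst; simpl snd.
    assert (L2 : A * (1 + Cmod v ^ 2) < s0 n ^ S k * Cmod (C_derive (finpart f) w)).
    { replace (A * (1 + Cmod v ^ 2)) with (s0 n ^ S k * (A / s0 n ^ S k * (1 + Cmod v ^ 2))) by (field; lra).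
      apply Rmult_lt_compat_l; assumption. }
    assert (L3 : s0 n ^ (2 * k) <= 1) by (rewrite <- (pow1 (2 * k)); apply pow_incr; split; [lra|apply Hs1]).
    pose proof (Cmod_triangle v (- a)) as T; rewrite Cmod_opp in T; change (v + - a)%C with (v - a)%C in T.
    pose proof (Cmod_ge_0 (v - a)); pose proof (Cmod_ge_0 v); pose proof (Cmod_ge_0 a).
    assert (L4 : Cmod (v - a) ^ 2 <= 2 * Cmod v ^ 2 + 2 * Cmod a ^ 2).
    { apply Rle_trans with ((Cmod v + Cmod a) ^ 2); [apply pow_incr; lra|]; pose proof (pow2_ge_0 (Cmod v - Cmod a)); simpl in *; lra. }
    pose proof (pow2_ge_0 (Cmod v)); pose proof (pow2_ge_0 (Cmod a)); unfold A in *; nra. }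
  pose (fz := fun n => proj1_sig (constructive_indefinite_description _ (Pick n))).
  assert (Hfz : forall n, F (fst (fz n)) /\ disc z0 (c * / INR (S n)) (snd (fz n)) /\ bad k a (fst (fz n)) (snd (fz n)) (s0 n)).
  { intros n; unfold fz; destruct constructive_indefinite_description; assumption. }
  clearbody fz.
  assert (Rs : forall n, INR (S n) * s0 n = c * / INR (S n)).
  { intros n; unfold s0; field; apply not_0_INR; lia. }
  destruct (zalcman k a (fun n => fst (fz n)) (fun n => snd (fz n)) s0) as [phi [z' [s' [g [Hphi [H1 [H2 H3]]]]]]].
  - intros n; apply Hs0.
  - intros n; apply Hfz.
  - intros n w Hw; destruct (Hfz n) as [Ff [Dz' _]].
    assert (Dw : D w).
    { apply Sub; unfold disc in *; rewrite Rmult_assoc, Rs in Hw; pose proof (Cmod_tri3 w (snd (fz n)) z0); destruct (Pn n); nra. }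
    split; [|apply Hm; assumption].
    destruct (HF _ Ff w Dw); [apply regular_sph|apply pole_sph]; assumption.
  - assert (Small : forall e, 0 < e -> exists N, forall n, (N <= n)%nat -> 3 * (c * / INR (S (phi n))) < e).
    { intros e He; destruct (inv_S_small (e / 3) ltac:(lra)) as [N HN]; exists N; intros n Hn.
      specialize (HN (phi n) ltac:(pose proof (extr_ge phi n Hphi); lia)); destruct (Pn (phi n)); nra. }
    exists (fun n => fst (fz (phi n))), z', s', g; split; [intros n; apply Hfz|split; [intros n; apply H1|split; [|split; [|split]]]].
    + intros e He; destruct (Small e He) as [N HN]; exists N; intros n Hn; specialize (HN n Hn).
      destruct (H1 n) as [_ Q]; destruct (Hfz (phi n)) as [_ [Dz' _]]; unfold disc in Dz'.
      rewrite Rmult_assoc, Rs in Q; pose proof (Cmod_tri3 (z' n) (snd (fz (phi n))) z0); lra.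
    + intros e He; destruct (Small e He) as [N HN]; exists N; intros n Hn; specialize (HN n Hn).
      destruct (H1 n) as [Q _]; destruct (Hs0 (phi n)).
      replace (RtoC (s' n) - 0)%C with (RtoC (s' n)) by ring; rewrite Cmod_R, Rabs_pos_eq by lra; lra.
    + intros x; apply H2.
    + exact H3.
Qed.

Theorem theorem8
  (D : C -> Prop) (F : (C -> Csph) -> Prop)
  (S1 S2 : C -> Prop) (a1 a2 : C)
  (P : diff_polynomial) (alpha : Z)
  (HD : domain D)
  (HF : forall f, F f -> meromorphic D f)
  (HS1 : finite_set S1) (HS2 : finite_set S2)
  (HS1a : forall s, S1 s <-> s = a1 \/ s = a2)
  (Ha1 : a1 <> RtoC 0) (Ha2 : a2 <> RtoC 0) (Ha12 : a1 <> a2)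
  (Hcoef : forall i, (1 <= i <= nterms P)%nat -> holomorphic D (coef P i))
  (Halpha : 1 + IZR alpha = ratio (mono P 1))
  (Hratio : forall t, (2 <= t <= nterms P)%nat ->
     ratio (mono P 1) >= ratio (mono P t))
  (Hkappa : (alpha >= Z.of_nat (diff_order P))%Z)
  (Hcoef_nz : forall i, (1 <= i <= nterms P)%nat ->
     ratio (mono P i) = 1 + IZR alpha ->
     forall z, D z -> coef P i z <> RtoC 0)
  (Hmult : forall f, F f ->
     all_zeros_multiplicity_ge D f a1 (alpha + 1) /\
     all_zeros_multiplicity_ge D f a2 (alpha + 1))
  (Hshare : forall f, F f -> partially_shares D (poly_apply P f) S1 f S2)
  (Ha3 : exists (M : R) (a3 : C), 0 < M /\ ~ S1 a3 /\
     forall f, F f -> forall z, D z -> f z = Fin a3 ->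
       Cmod (C_derive (finpart f) z) <= M) :
  normal_family D F.
Proof.
  destruct HD as [OD [NE CD]].
  assert (Hord : forall i, (1 <= i <= nterms P)%nat -> (Z.of_nat (mono_order (mono P i)) <= alpha)%Z).
  { intros i Hi; assert (L : (mono_order (mono P i) <= diff_order P)%nat); [|lia].
    pose proof (proj1 (list_max_le _ (diff_order P)) (le_n (diff_order P))) as Fa.
    rewrite Forall_forall in Fa; apply Fa; apply (in_map (fun i => mono_order (mono P i))), in_seq; lia. }
  pose proof (nterms_pos P) as Hp.
  destruct (exponent_exists (mono P 1)) as [j [Hj _]].
  pose proof (Hord 1%nat ltac:(lia)) as H1.
  set (k := Z.to_nat alpha); assert (Ek : alpha = Z.of_nat k) by (unfold k; rewrite Z2Nat.id; lia).
  assert (Hk : (1 <= k)%nat) by lia.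
  assert (Ho : forall i, (1 <= i <= nterms P)%nat -> (mono_order (mono P i) <= k)%nat) by (intros i Hi; specialize (Hord i Hi); lia).
  assert (Hdef : deficit k (mono P 1) = 0%nat).
  { apply ratio_deficit; [apply Ho; lia|]; rewrite <- Halpha, Ek, <- INR_IZR_INZ; reflexivity. }
  assert (Hm : forall f, F f -> forall w, D w -> f w = Fin a1 -> forall p, zero_multiplicity f a1 w p -> (S k <= p)%nat).
  { intros f Ff w Dw Ew p Hmp; pose proof (proj1 (Hmult f Ff) w Dw Ew p Hmp); lia. }
  apply marty_normal; [split; [exact OD|split; assumption]|exact HF|].
  intros z0 Dz0; apply NNPP; intros NB.
  destruct (unbounded_zalcman D F k a1 z0 OD Dz0 HF Hm NB) as [f [z [s [g [Ff [Hs [Cz [Cs [Cv Hn]]]]]]]]].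
  apply (rescaled_contradiction D S1 S2 P k a1 a1 a2 f z s z0 g); auto.
  - apply HS1a; left; reflexivity.
  - apply HS1a; right; reflexivity.
  - intros i Hi Hd; apply (Hcoef_nz i Hi); [|exact Dz0].
    rewrite (proj2 (ratio_deficit k (mono P i) (Ho i Hi)) Hd), Ek, <- INR_IZR_INZ; reflexivity.
  - intros n w Dw Ew; apply (Hm (f n) (Ff n) w Dw Ew).
Qed.
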